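(* Let $n\in\mathbb{N}$. The determinant of the Laplacian on the odd-dimensional unit sphere $\mathbb{S}^{2n+1}$ satisfies $$-\log\left[\det\left(\mathbb{S}^{2n+1}\right)\right]=\zeta'_{\mathbb{S}^{2n+1}}(0)=\frac{2}{(2n)!}\sum_{k=1}^{n}\zeta'(-2k)\,\big[s(2n,2k)+s(2n+1,2k+1)\big]+\log\left(\frac{n}{\pi}\right).$$
   Context: $\mathbb{N}=\{1,2,3,\dots\}$, and $\zeta$ is the Riemann zeta function with derivative $\zeta'$. For $N\ge 1$, the positive eigenvalues of the Laplacian on the unit sphere $\mathbb{S}^{N}$ (standard metric) are $k(k+N-1)$, $k=1,2,\dots$, with multiplicities $m_k^N=(2k+N-1)\frac{(k+N-2)!}{k!\,(N-1)!}$. The spectral zeta function is $\zeta_{\mathbb{S}^N}(s)=\sum_{k=1}^\infty m_k^N\,(k(k+N-1))^{-s}$ for $\mathrm{Re}(s)$ large, extended meromorphically to $\mathbb{C}$; it is analytic at $s=0$, and the determinant is $\det(\mathbb{S}^N):=e^{-\zeta_{\mathbb{S}^N}'(0)}$. The (signed) Stirling numbers of the first kind $s(n,k)$ are defined by $x(x-1)\cdots(x-n+1)=\sum_{k=0}^n s(n,k)x^k$. *)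

(* Defs.v *)
From Stdlib Require Import Arith Factorial Reals ClassicalEpsilon.
From Coquelicot Require Import Coquelicot.

Open Scope R_scope.
Open Scope C_scope.

Definition Cexp (z : C) : C :=
  ((exp (Re z) * cos (Im z))%R, (exp (Re z) * sin (Im z))%R).

(* [x ^ s] for a positive real base; Stdlib's [ln] is [0] on nonpositive reals,
   and only positive bases are used below. *)
Definition Rcpow (x : R) (s : C) : C := Cexp (s * RtoC (ln x)).

Definition analytic_at (f : C -> C) (a : C) : Prop :=
  exists c : nat -> C, locally a (fun z => is_pseries c (z - a) (f z)).

(* A genuine pole (of order [m >= 1]): removable singularities are excluded, so
   that a meromorphic function is determined at every point except its poles. *)
Definition pole_at (f : C -> C) (a : C) : Prop :=
  exists (m : nat) (g : C -> C),
    (1 <= m)%nat /\ analytic_at g a /\ g a <> 0 /\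
    locally' a (fun z => f z = g z / pow_n (z - a) m).

Definition meromorphic (f : C -> C) : Prop :=
  forall a : C, analytic_at f a \/ pole_at f a.

Definition is_meromorphic_continuation
    (u : nat -> C -> C) (Z : C -> C) : Prop :=
  meromorphic Z /\
  exists c : R, forall s : C, (c < Re s)%R -> is_series (fun j => u j s) (Z s).

(* The meromorphic continuation to the whole plane of [\sum_j u j s], [Re s]
   large. By the identity theorem it is unique, except that its values at the
   poles are unspecified. *)
Definition meromorphic_continuation (u : nat -> C -> C) : C -> C :=
  epsilon (inhabits (fun _ : C => RtoC 0)) (is_meromorphic_continuation u).

(* The series below run over [k = S j >= 1]. *)
Definition riemann_zeta : C -> C :=
  meromorphic_continuation (fun j s => Rcpow (INR (S j)) (- s)).

Definition sphere_eigenvalue (N k : nat) : R :=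
  (INR k * (INR k + INR N - 1))%R.

(* For [N, k >= 1] none of the truncated subtractions underflows. *)
Definition sphere_multiplicity (N k : nat) : R :=
  ((2 * INR k + INR N - 1) * INR (fact (k + N - 2))
     / (INR (fact k) * INR (fact (N - 1))))%R.

Definition sphere_zeta (N : nat) : C -> C :=
  meromorphic_continuation (fun j s =>
    RtoC (sphere_multiplicity N (S j)) * Rcpow (sphere_eigenvalue N (S j)) (- s)).

Definition sphere_det (N : nat) : C := Cexp (- C_derive (sphere_zeta N) 0).

(* MathComp is imported only here, so that the definitions above use the
   operations of Stdlib; Rstruct makes Stdlib's [R] a MathComp ring. *)
From mathcomp Require Import all_boot all_algebra.
From mathcomp Require Import Rstruct.

Open Scope ring_scope.

(* Signed Stirling numbers of the first kind: the coefficient of [x ^ k] in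
   [x (x - 1) ... (x - n + 1)]. *)
Definition stirling1 (n k : nat) : R :=
  (\prod_(i < n) ('X - i%:R%:P) : {poly R})`_k.

Close Scope ring_scope.

(* Main.v *)
(** With [j = k + n] the [k]-th eigenvalue on the sphere is [j^2 - n^2 = k (k + 2 n)] and its
    multiplicity is an even polynomial [P j]. Replacing [(k (k + 2 n)) ^ (- s)] by the average of
    [k ^ (- 2 s)] and [(k + 2 n) ^ (- 2 s)] changes the spectral zeta function by a series whose
    coefficients [Q_l s = (2 s)_{2 l} / (2 l)! - (s)_l / l!] all vanish to second order at [s = 0],
    so the derivative at [0] is not affected. The averaged series is a combination of the
    [zeta (2 s - 2 k)], because [(P (x + n) + P (x - n)) / 2] is the even part of a polynomial
    whose coefficients are Stirling numbers, and a correction [(2 n) ^ (- 2 s) / 2]; the term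
    [k = 0] contributes [zeta' 0], known from Wallis' product.

    The continuations come from binomial expansions. Analyticity is certified without Cauchy's
    theory: power series with an absolute norm on a closed disc form an algebra that is closed
    under normally convergent series and under recentering. *)
Require Import Defs.
From Stdlib Require Import Arith Factorial Reals Lra Lia ClassicalEpsilon FunctionalExtensionality.
From Coquelicot Require Import Coquelicot.
From mathcomp Require all_boot all_algebra Rstruct.
Open Scope R_scope.

(** Parity is what closes the argument. A correction is [Q_l s] times [zeta (2 s - 2 m + 2 l)], and
    a double zero against a simple pole would still leave a nonzero derivative at [s = 0]. Since the
    multiplicity is even in [j], all arguments of zeta at [s = 0] are even integers, and regularity
    of zeta at even integers suffices. The continuation of zeta is designed for this:
    [(x - 1/2)^(1 - s) - (x + 1/2)^(1 - s)], expanded about the midpoint [x], has only odd powers of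
    [1 / (2 x)], so its telescoped sum expresses [(s - 1) zeta s] through [zeta (s + 2 l)] alone,
    and iterating this can create singularities only at [1, -1, -3, ...]. The average is dictated by
    [ln (k (k + 2 n)) = ln k + ln (k + 2 n)]: it agrees with the power of the eigenvalue to first
    order at [s = 0]. The correction [(2 n) ^ (- 2 s) / 2] arises when the sum over [k + 2 n] is
    completed to all positive integers: [P] vanishes at the integers of absolute value below [n],
    and [P n = 1]. At first order in [s] the telescoped identity for zeta turns into partial sums of
    Stirling's formula, which is how Wallis' product gives [zeta' 0]. *)

Ltac csum_abs :=
  repeat match goal with |- context [@sum_n ?G ?a ?n] =>
    let x := fresh "x" in
    pose (x := @sum_n G a n : C); change (@sum_n G a n) with x; clearbody x end.

(* The carrier of the structures over [C] has to be folded back to [C] for [ring]. *)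
Ltac cring :=
  csum_abs;
  match goal with |- @eq _ ?a ?b =>
    let H := fresh in enough (H : @eq C a b) by exact H end; ring.

Ltac rring :=
  match goal with |- @eq _ ?a ?b =>
    let H := fresh in enough (H : @eq R a b) by exact H end; ring.

(** * Double series *)

Lemma csum_O (a : nat -> C) : sum_n a 0 = a 0%nat.
Proof. exact (sum_O a). Qed.

Lemma csum_S (a : nat -> C) n : sum_n a (S n) = (sum_n a n + a (S n))%C.
Proof. exact (sum_Sn a n). Qed.

Lemma rsum_S (a : nat -> R) n : sum_n a (S n) = sum_n a n + a (S n).
Proof. exact (sum_Sn a n). Qed.

Lemma rsum_O (a : nat -> R) : sum_n a 0 = a 0%nat.
Proof. exact (sum_O a). Qed.

Lemma rsum_mult_l (a : nat -> R) c n :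
  sum_n (fun k => c * a k) n = c * sum_n a n.
Proof. exact (sum_n_mult_l (K := R_Ring) c a n). Qed.

Lemma rsum_mult_r (a : nat -> R) c n :
  sum_n (fun k => a k * c) n = sum_n a n * c.
Proof. exact (sum_n_mult_r (K := R_Ring) c a n). Qed.

Lemma rsum_plus (a b : nat -> R) n :
  sum_n (fun k => a k + b k) n = sum_n a n + sum_n b n.
Proof. exact (sum_n_plus a b n). Qed.

Lemma rsum_le (a b : nat -> R) n :
  (forall k, (k <= n)%nat -> a k <= b k) -> sum_n a n <= sum_n b n.
Proof.
  induction n as [|n IH]; intros H.
  - rewrite !rsum_O. apply H; lia.
  - rewrite !rsum_S. apply Rplus_le_compat; [apply IH; intros; apply H; lia | apply H; lia].
Qed.

Lemma rsum_ge0 (a : nat -> R) n : (forall k, 0 <= a k) -> 0 <= sum_n a n.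
Proof.
  intros H; induction n as [|n IH].
  - rewrite rsum_O. apply H.
  - rewrite rsum_S. specialize (H (S n)). lra.
Qed.

Lemma rsum_mono (a : nat -> R) m n :
  (forall k, 0 <= a k) -> (m <= n)%nat -> sum_n a m <= sum_n a n.
Proof.
  intros H L; induction L as [|n L IH].
  - lra.
  - rewrite rsum_S. specialize (H (S n)). lra.
Qed.

Lemma term_le_rsum (a : nat -> R) n :
  (forall k, 0 <= a k) -> a n <= sum_n a n.
Proof.
  intros H; destruct n.
  - rewrite rsum_O; lra.
  - rewrite rsum_S. pose proof (rsum_ge0 a n H). lra.
Qed.

Lemma Cmod_csum (a : nat -> C) n : Cmod (sum_n a n) <= sum_n (fun k => Cmod (a k)) n.
Proof.
  induction n as [|n IH].
  - rewrite csum_O, rsum_O. lra.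
  - rewrite csum_S, rsum_S. eapply Rle_trans; [apply Cmod_triangle|]. lra.
Qed.

Lemma rsum_switch (u : nat -> nat -> R) m n :
  sum_n (fun i => sum_n (u i) n) m = sum_n (fun j => sum_n (fun i => u i j) m) n :> R.
Proof. exact (sum_n_switch u m n). Qed.

Lemma Cmod_minus_sym a b : Cmod (a - b) = Cmod (b - a).
Proof. rewrite <- Cmod_opp. f_equal. cring. Qed.

Lemma Cmod_triangle_minus a b : Cmod (a - b) <= Cmod a + Cmod b.
Proof. unfold Cminus. rewrite <- (Cmod_opp b). apply Cmod_triangle. Qed.

Lemma is_series_C_eps (a : nat -> C) (l : C) :
  is_series a l <->
  forall eps, 0 < eps -> exists N, forall n, (N <= n)%nat -> Cmod (sum_n a n - l) < eps.
Proof.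
  refine (iff_trans (filterlim_locally_ball_norm (K := C_AbsRing) (U := C_NormedModule) (sum_n a) l) _). split.
  - intros H eps He. destruct (H (mkposreal eps He)) as [N HN]. exists N. exact HN.
  - intros H eps. destruct (H eps (cond_pos eps)) as [N HN]. exists N. exact HN.
Qed.

Lemma is_series_R_eps (a : nat -> R) (l : R) :
  is_series a l <->
  forall eps, 0 < eps -> exists N, forall n, (N <= n)%nat -> Rabs (sum_n a n - l) < eps.
Proof.
  refine (iff_trans (filterlim_locally_ball_norm (K := R_AbsRing) (U := R_NormedModule) (sum_n a) l) _). split.
  - intros H eps He. destruct (H (mkposreal eps He)) as [N HN]. exists N. exact HN.
  - intros H eps. destruct (H eps (cond_pos eps)) as [N HN]. exists N. exact HN.
Qed.

Lemma Ceq_eps (a b : C) : (forall eps, 0 < eps -> Cmod (a - b) < eps) -> a = b.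
Proof.
  intros H. destruct (Req_dec (Cmod (a - b)) 0) as [E|E].
  - apply Cmod_eq_0 in E. replace a with ((a - b) + b)%C by cring. rewrite E. cring.
  - pose proof (Cmod_ge_0 (a - b)). specialize (H (Cmod (a - b))). lra.
Qed.

Lemma is_series_C_unique (a : nat -> C) (l1 l2 : C) :
  is_series a l1 -> is_series a l2 -> l1 = l2.
Proof.
  rewrite !is_series_C_eps. intros H1 H2. apply Ceq_eps. intros eps He.
  destruct (H1 (eps/2)) as [N1 h1]; [lra|]. destruct (H2 (eps/2)) as [N2 h2]; [lra|].
  specialize (h1 (max N1 N2) ltac:(lia)). specialize (h2 (max N1 N2) ltac:(lia)).
  set (s := sum_n a (max N1 N2)) in *.
  replace (l1 - l2)%C with ((s - l2) - (s - l1))%C by cring.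
  eapply Rle_lt_trans; [apply Cmod_triangle_minus|]. lra.
Qed.

Lemma is_series_C_ext (a b : nat -> C) (l : C) :
  (forall n, a n = b n) -> is_series a l -> is_series b l.
Proof. apply is_series_ext. Qed.

Lemma is_series_C_plus (a b : nat -> C) (la lb : C) :
  is_series a la -> is_series b lb -> is_series (fun n => (a n + b n)%C) (la + lb)%C.
Proof. apply (is_series_plus a b la lb). Qed.

Lemma is_series_C_minus (a b : nat -> C) (la lb : C) :
  is_series a la -> is_series b lb -> is_series (fun n => (a n - b n)%C) (la - lb)%C.
Proof. apply (is_series_minus a b la lb). Qed.

Lemma is_series_C_scal (c : C) (a : nat -> C) (l : C) :
  is_series a l -> is_series (fun n => (c * a n)%C) (c * l)%C.
Proof. apply (is_series_scal c a l). Qed.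

Lemma is_series_C_scal_r (c : C) (a : nat -> C) (l : C) :
  is_series a l -> is_series (fun n => (a n * c)%C) (l * c)%C.
Proof.
  intros H. rewrite Cmult_comm. eapply is_series_C_ext; [|apply (is_series_C_scal c a l H)].
  intros n. apply Cmult_comm.
Qed.

Lemma is_series_C_0 : is_series (fun _ => RtoC 0) (RtoC 0).
Proof.
  apply is_series_C_eps. intros eps He. exists 0%nat. intros n _.
  replace (sum_n (fun _ => RtoC 0) n) with (RtoC 0).
  - replace (RtoC 0 - RtoC 0)%C with (RtoC 0) by cring. rewrite Cmod_0. lra.
  - induction n as [|n IH]; [now rewrite csum_O|]. rewrite csum_S, <- IH. cring.
Qed.

Lemma is_series_C_finite (a : nat -> C) N :
  (forall k, (N < k)%nat -> a k = 0) -> is_series a (sum_n a N).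
Proof.
  intros H. apply is_series_C_eps. intros eps He. exists N. intros n Hn.
  replace (sum_n a n) with (sum_n a N).
  - replace (sum_n a N - sum_n a N)%C with (RtoC 0) by cring. rewrite Cmod_0. lra.
  - induction Hn as [|n Hn IH]; [reflexivity|].
    rewrite csum_S, <- IH, H by lia. cring.
Qed.

Lemma is_series_C_first (a : nat -> C) (l : C) :
  (forall k, a (S k) = 0) -> a 0%nat = l -> is_series a l.
Proof.
  intros H E. rewrite <- E, <- csum_O. apply is_series_C_finite. intros [|k] Hk; [lia | apply H].
Qed.

Lemma is_series_C_shift (a : nat -> C) (l : C) :
  is_series (fun k => a (S k)) l -> is_series a (a 0%nat + l)%C.
Proof.
  intros H. apply (is_series_decr_1 a).
  change (is_series (fun k => a (S k)) ((a 0%nat + l) + - a 0%nat)%C).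
  replace ((a 0%nat + l) + - a 0%nat)%C with l by cring. exact H.
Qed.

Lemma is_series_C_unshift (a : nat -> C) (l : C) :
  is_series a l -> is_series (fun k => a (S k)) (l - a 0%nat)%C.
Proof.
  intros H. apply (is_series_incr_1 a).
  change (is_series a ((l - a 0%nat) + a 0%nat)%C).
  replace ((l - a 0%nat) + a 0%nat)%C with l by cring. exact H.
Qed.

Lemma series_Cmod_le (a : nat -> C) (l : C) M :
  is_series a l -> (forall n, sum_n (fun k => Cmod (a k)) n <= M) -> Cmod l <= M.
Proof.
  rewrite is_series_C_eps. intros H HM. apply le_epsilon. intros eps He.
  destruct (H eps He) as [N HN]. specialize (HN N (le_n N)). specialize (HM N).
  replace l with (sum_n a N - (sum_n a N - l))%C by cring.
  eapply Rle_trans; [apply Cmod_triangle_minus|].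
  pose proof (Cmod_csum a N). lra.
Qed.

Lemma bounded_ex_series (a : nat -> R) M :
  (forall k, 0 <= a k) -> (forall n, sum_n a n <= M) -> ex_series a.
Proof.
  intros H0 HM.
  destruct (ex_finite_lim_seq_incr (sum_n a) M) as [l Hl].
  - intros n. rewrite rsum_S. specialize (H0 (S n)). lra.
  - exact HM.
  - exists l. exact Hl.
Qed.

Lemma is_series_R_le (a : nat -> R) l n :
  (forall k, 0 <= a k) -> is_series a l -> sum_n a n <= l.
Proof.
  intros H0. rewrite is_series_R_eps. intros H. apply le_epsilon. intros eps He.
  destruct (H eps He) as [N HN]. specialize (HN (max n N) ltac:(lia)).
  pose proof (rsum_mono a n (max n N) H0 ltac:(lia)).
  apply Rabs_def2 in HN. lra.
Qed.

Lemma bounded_ex_series_C (a : nat -> C) M :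
  (forall n, sum_n (fun k => Cmod (a k)) n <= M) -> exists l : C, is_series a l.
Proof.
  intros HM. apply (ex_series_le (V := C_CompleteNormedModule) a (fun k => Cmod (a k))).
  - intros n. apply Rle_refl.
  - apply (bounded_ex_series _ M); [intros; apply Cmod_ge_0 | exact HM].
Qed.

Lemma bounded_tail (a : nat -> R) M :
  (forall k, 0 <= a k) -> (forall n, sum_n a n <= M) ->
  forall eps, 0 < eps -> exists N, forall n, (N <= n)%nat -> sum_n a n - sum_n a N < eps.
Proof.
  intros H0 HM eps He. destruct (bounded_ex_series a M H0 HM) as [l Hl].
  pose proof (fun n => is_series_R_le a l n H0 Hl) as Hle.
  rewrite is_series_R_eps in Hl. destruct (Hl eps He) as [N HN].
  exists N. intros n Hn. specialize (HN N (le_n N)). apply Rabs_def2 in HN.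
  specialize (Hle n). lra.
Qed.

Lemma Cmod_csum_diff (a : nat -> C) (b : nat -> R) N n :
  (forall k, Cmod (a k) <= b k) -> (N <= n)%nat ->
  Cmod (sum_n a n - sum_n a N) <= sum_n b n - sum_n b N.
Proof.
  intros H L; induction L as [|n L IH].
  - replace (sum_n a N - sum_n a N)%C with (RtoC 0) by cring. rewrite Cmod_0. lra.
  - rewrite csum_S, rsum_S.
    replace (sum_n a n + a (S n) - sum_n a N)%C with ((sum_n a n - sum_n a N) + a (S n))%C by cring.
    eapply Rle_trans; [apply Cmod_triangle|]. specialize (H (S n)). lra.
Qed.

Lemma csum_small (d : nat -> nat -> C) J :
  (forall j, forall eps, 0 < eps -> exists N, forall K, (N <= K)%nat -> Cmod (d K j) < eps) ->
  forall eps, 0 < eps -> exists N, forall K, (N <= K)%nat -> Cmod (sum_n (d K) J) < eps.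
Proof.
  intros H; induction J as [|J IH]; intros eps He.
  - destruct (H 0%nat eps He) as [N HN]. exists N. intros K HK. rewrite csum_O. auto.
  - destruct (IH (eps/2)) as [N1 h1]; [lra|]. destruct (H (S J) (eps/2)) as [N2 h2]; [lra|].
    exists (max N1 N2). intros K HK. rewrite csum_S.
    eapply Rle_lt_trans; [apply Cmod_triangle|].
    specialize (h1 K ltac:(lia)). specialize (h2 K ltac:(lia)). lra.
Qed.

(** Dominated convergence for series: cut at a [J] beyond which the majorant [B] contributes little,
    and use termwise convergence on the finitely many terms up to [J]. *)
Lemma tannery (d : nat -> nat -> C) (D : nat -> C) (B : nat -> R) M :
  (forall K j, Cmod (d K j) <= B j) -> (forall n, sum_n B n <= M) ->
  (forall j, forall eps, 0 < eps -> exists N, forall K, (N <= K)%nat -> Cmod (d K j) < eps) ->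
  (forall K, is_series (d K) (D K)) ->
  forall eps, 0 < eps -> exists N, forall K, (N <= K)%nat -> Cmod (D K) < eps.
Proof.
  intros HB HM Hd HD eps He.
  assert (B0 : forall j, 0 <= B j).
  { intros j. eapply Rle_trans; [apply Cmod_ge_0 | apply (HB 0%nat j)]. }
  destruct (bounded_tail B M B0 HM (eps/3)) as [J HJ]; [lra|].
  destruct (csum_small d J Hd (eps/3)) as [N HN]; [lra|].
  exists N. intros K HK. specialize (HN K HK).
  assert (Hs := HD K). rewrite is_series_C_eps in Hs.
  destruct (Hs (eps/3)) as [N' HN']; [lra|].
  specialize (HN' (max J N') ltac:(lia)). specialize (HJ (max J N') ltac:(lia)).
  pose proof (Cmod_csum_diff (d K) B J (max J N') (HB K) ltac:(lia)).
  set (s := sum_n (d K) (max J N')) in *. set (t := sum_n (d K) J) in *.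
  replace (D K) with ((s - t) + t - (s - D K))%C by cring.
  eapply Rle_lt_trans; [apply Cmod_triangle_minus|].
  eapply Rle_lt_trans; [apply Rplus_le_compat_r, Cmod_triangle|]. lra.
Qed.

(** This is [tannery] applied to the row remainders [sum_n (c j) K - f j], which tend to 0 for each
    [j] and are dominated by [2 * B j]. *)
Lemma series_fubini (c : nat -> nat -> C) (f T : nat -> C) (F : C) (B : nat -> R) M :
  (forall j K, sum_n (fun k => Cmod (c j k)) K <= B j) -> (forall n, sum_n B n <= M) ->
  (forall j, is_series (c j) (f j)) -> is_series f F ->
  (forall k, is_series (fun j => c j k) (T k)) ->
  is_series T F.
Proof.
  intros HB HM Hf HF HT. rewrite is_series_C_eps.
  apply (tannery (fun K j => (sum_n (c j) K - f j)%C) (fun K => (sum_n T K - F)%C)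
           (fun j => 2 * B j) (2 * M)).
  - intros K j. eapply Rle_trans; [apply Cmod_triangle_minus|].
    pose proof (Cmod_csum (c j) K). pose proof (HB j K).
    pose proof (series_Cmod_le _ _ _ (Hf j) (HB j)). lra.
  - intros n. rewrite rsum_mult_l. specialize (HM n). lra.
  - intros j. apply is_series_C_eps, Hf.
  - intros K. apply is_series_C_minus; [|exact HF].
    induction K as [|K IH].
    + apply (is_series_C_ext (fun j => c j 0%nat)); [intros j; now rewrite csum_O|].
      rewrite csum_O. apply HT.
    + apply (is_series_C_ext (fun j => (sum_n (c j) K + c j (S K))%C)); [intros j; now rewrite csum_S|].
      rewrite csum_S. apply is_series_C_plus; [exact IH | apply HT].
Qed.

(** * Power series with an absolute norm *)

(* The weighted Wiener algebra: power series about [a] that converge absolutely on the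
   closed disc of radius [r], with norm at most [M] there. *)
Definition wiener_coef (a : C) (r : R) (f : C -> C) (M : R) (c : nat -> C) : Prop :=
  (forall n, sum_n (fun k => Cmod (c k) * r ^ k) n <= M) /\
  forall z : C, Cmod (z - a) <= r -> is_series (fun k => (c k * (z - a) ^ k)%C) (f z).

Definition wiener (a : C) (r : R) (f : C -> C) (M : R) : Prop :=
  exists c, wiener_coef a r f M c.

Lemma wiener_term_bound a r c z k :
  Cmod (z - a) <= r -> Cmod (c * (z - a) ^ k) <= Cmod c * r ^ k.
Proof.
  intros H. rewrite Cmod_mult, Cmod_pow.
  apply Rmult_le_compat_l; [apply Cmod_ge_0|].
  apply pow_incr. split; [apply Cmod_ge_0 | exact H].
Qed.

Lemma wiener_coef_terms a r f M c z n :
  wiener_coef a r f M c -> Cmod (z - a) <= r ->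
  sum_n (fun k => Cmod (c k * (z - a) ^ k)%C) n <= M.
Proof.
  intros [H _] Hz. eapply Rle_trans; [|apply (H n)].
  apply rsum_le. intros k _. now apply wiener_term_bound.
Qed.

Lemma wiener_le a r f M z : wiener a r f M -> Cmod (z - a) <= r -> Cmod (f z) <= M.
Proof.
  intros [c Hc] Hz. eapply series_Cmod_le; [apply Hc, Hz|].
  intros n. eapply wiener_coef_terms; eauto.
Qed.

Lemma wiener_ge0 a r f M : 0 <= r -> wiener a r f M -> 0 <= M.
Proof.
  intros hr H. eapply Rle_trans; [apply Cmod_ge_0|].
  apply (wiener_le a r f M a H). replace (a - a)%C with (RtoC 0) by cring. now rewrite Cmod_0.
Qed.

Lemma wiener_coef_mono a r f M M' c :
  M <= M' -> wiener_coef a r f M c -> wiener_coef a r f M' c.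
Proof.
  intros HM [H1 H2]. split; [|exact H2]. intros n. specialize (H1 n). lra.
Qed.

Lemma wiener_mono a r f M M' : M <= M' -> wiener a r f M -> wiener a r f M'.
Proof. intros HM [c Hc]. exists c. eapply wiener_coef_mono; eauto. Qed.

Lemma wiener_coef_ext a r f g M c :
  (forall z, Cmod (z - a) <= r -> f z = g z) -> wiener_coef a r f M c -> wiener_coef a r g M c.
Proof.
  intros H [H1 H2]. split; [exact H1|]. intros z Hz. rewrite <- H by exact Hz. auto.
Qed.

Lemma wiener_ext a r f g M :
  (forall z, Cmod (z - a) <= r -> f z = g z) -> wiener a r f M -> wiener a r g M.
Proof. intros H [c Hc]. exists c. eapply wiener_coef_ext; eauto. Qed.

Lemma rsum_first_only (a : nat -> R) n : (forall k, a (S k) = 0) -> sum_n a n = a 0%nat.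
Proof.
  intros H. induction n as [|n IH]; [apply rsum_O|]. rewrite rsum_S, IH, H. rring.
Qed.

Lemma wiener_const a r c : wiener a r (fun _ => c) (Cmod c).
Proof.
  exists (fun k => match k with O => c | S _ => RtoC 0 end). split.
  - intros n. rewrite rsum_first_only.
    + simpl. lra.
    + intros k. rewrite Cmod_0. ring.
  - intros z _.
    apply is_series_C_first; [intros k|]; simpl; cring.
Qed.

Lemma wiener_coef_shift a r f M c :
  0 <= r -> wiener_coef a r f M c ->
  wiener_coef a r (fun z => ((z - a) * f z)%C) (r * M)
    (fun k => match k with O => RtoC 0 | S k => c k end).
Proof.
  intros hr [H1 H2]. split.
  - assert (E : forall n, sum_n (fun k => Cmod (match k with O => RtoC 0 | S k => c k end) * r ^ k) (S n)
                 = r * sum_n (fun k => Cmod (c k) * r ^ k) n).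
    { induction n as [|n IH].
      - rewrite rsum_S, !rsum_O, Cmod_0. simpl. rring.
      - rewrite rsum_S, IH, rsum_S. simpl. rring. }
    assert (M0 : 0 <= M) by (apply (wiener_ge0 a r f M hr); exists c; now split).
    intros [|n].
    + rewrite rsum_O, Cmod_0. simpl. nra.
    + rewrite E. apply Rmult_le_compat_l; auto.
  - intros z Hz.
    replace ((z - a) * f z)%C
      with ((fun k => (match k with O => RtoC 0 | S k => c k end * (z - a) ^ k)%C) 0%nat + (z - a) * f z)%C
      by (simpl; cring).
    apply is_series_C_shift. eapply is_series_C_ext; [|apply is_series_C_scal, H2, Hz].
    intros k. simpl. cring.
Qed.

Lemma wiener_shift a r f M :
  0 <= r -> wiener a r f M -> wiener a r (fun z => ((z - a) * f z)%C) (r * M).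
Proof. intros hr [c Hc]. eexists. apply wiener_coef_shift; eauto. Qed.

Lemma wiener_coef_scal a r f M c k :
  wiener_coef a r f M c ->
  wiener_coef a r (fun z => (k * f z)%C) (Cmod k * M) (fun n => (k * c n)%C).
Proof.
  intros [H1 H2]. split.
  - intros n. apply Rle_trans with (Cmod k * sum_n (fun k => Cmod (c k) * r ^ k) n).
    + rewrite <- rsum_mult_l. apply rsum_le. intros j _. rewrite Cmod_mult. lra.
    + apply Rmult_le_compat_l; [apply Cmod_ge_0 | apply H1].
  - intros z Hz. eapply is_series_C_ext; [|apply (is_series_C_scal k), H2, Hz].
    intros n. simpl. cring.
Qed.

Lemma wiener_scal a r f M k :
  wiener a r f M -> wiener a r (fun z => (k * f z)%C) (Cmod k * M).
Proof. intros [c Hc]. eexists. apply wiener_coef_scal; eauto. Qed.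

Lemma wiener_coef_plus a r f g M N c d :
  0 <= r -> wiener_coef a r f M c -> wiener_coef a r g N d ->
  wiener_coef a r (fun z => (f z + g z)%C) (M + N) (fun n => (c n + d n)%C).
Proof.
  intros hr [H1 H2] [H3 H4]. split.
  - intros n. eapply Rle_trans; [|apply Rplus_le_compat; [apply (H1 n)|apply (H3 n)]].
    rewrite <- rsum_plus. apply rsum_le. intros k _. rewrite <- Rmult_plus_distr_r.
    apply Rmult_le_compat_r; [now apply pow_le | apply Cmod_triangle].
  - intros z Hz. eapply is_series_C_ext; [|apply is_series_C_plus; [apply H2, Hz | apply H4, Hz]].
    intros n. simpl. cring.
Qed.

Lemma wiener_plus a r f g M N :
  0 <= r -> wiener a r f M -> wiener a r g N -> wiener a r (fun z => (f z + g z)%C) (M + N).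
Proof. intros hr [c Hc] [d Hd]. eexists. apply wiener_coef_plus; eauto. Qed.

(** Each column converges absolutely because [Cmod (c j k) * r ^ k <= N j]. The coefficients [T]
    stay in the conclusion since the entry of index 1 later gives termwise differentiation. *)
Lemma wiener_coef_series a r (f : nat -> C -> C) (N : nat -> R) M c F :
  0 < r -> (forall j, wiener_coef a r (f j) (N j) (c j)) -> (forall n, sum_n N n <= M) ->
  (forall z, Cmod (z - a) <= r -> is_series (fun j => f j z) (F z)) ->
  exists T, wiener_coef a r F M T /\ forall k, is_series (fun j => c j k) (T k).
Proof.
  intros hr Hc HN HF.
  assert (Hex : forall k, exists t : C, is_series (fun j => c j k) t).
  { intros k. apply (bounded_ex_series_C _ (M * / r ^ k)). intros n.
    assert (hk : 0 < r ^ k) by now apply pow_lt.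
    apply Rle_trans with (sum_n (fun j => N j * / r ^ k) n).
    - apply rsum_le. intros j _. destruct (Hc j) as [h _]. specialize (h k).
      pose proof (term_le_rsum (fun k => Cmod (c j k) * r ^ k) k) as h'. cbv beta in h'.
      apply Rmult_le_reg_r with (r ^ k); [exact hk|]. field_simplify; [|lra].
      eapply Rle_trans; [apply h'|exact h].
      intros i. apply Rmult_le_pos; [apply Cmod_ge_0 | apply pow_le; lra].
    - rewrite rsum_mult_r. apply Rmult_le_compat_r; [left; now apply Rinv_0_lt_compat | apply HN]. }
  set (T := fun k => proj1_sig (constructive_indefinite_description _ (Hex k))).
  assert (HT : forall k, is_series (fun j => c j k) (T k)).
  { intros k. unfold T. apply proj2_sig. }
  exists T. split; [|exact HT]. split.
  - intros K. apply le_epsilon. intros eps He.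
    (* The norm bound passes to the limit: the finitely many columns up to [K] are approximated by
       partial sums with a common [J]. *)
    assert (Hs : forall e, 0 < e -> exists J0, forall J, (J0 <= J)%nat ->
       sum_n (fun k => Cmod (T k - sum_n (fun j => c j k) J) * r ^ k) K <= e).
    { induction K as [|K IH]; intros e he.
      - destruct (proj1 (is_series_C_eps _ _) (HT 0%nat) e he) as [J0 h]. exists J0. intros J HJ.
        rewrite rsum_O. specialize (h J HJ). rewrite Cmod_minus_sym in h. simpl. lra.
      - destruct (IH (e/2)) as [J1 h1]; [lra|].
        assert (hk : 0 < r ^ S K) by now apply pow_lt.
        destruct (proj1 (is_series_C_eps _ _) (HT (S K)) (e/2 * / r ^ S K)) as [J2 h2].
        { apply Rmult_lt_0_compat; [lra | now apply Rinv_0_lt_compat]. }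
        exists (max J1 J2). intros J HJ. rewrite rsum_S.
        specialize (h1 J ltac:(lia)). specialize (h2 J ltac:(lia)). rewrite Cmod_minus_sym in h2.
        apply (Rmult_lt_compat_r (r ^ S K)) in h2; [|exact hk].
        rewrite Rmult_assoc, Rinv_l in h2 by lra. lra. }
    destruct (Hs eps He) as [J HJ]. specialize (HJ J (le_n J)).
    apply Rle_trans with (sum_n (fun k => Cmod (sum_n (fun j => c j k) J) * r ^ k) K + 
                          sum_n (fun k => Cmod (T k - sum_n (fun j => c j k) J) * r ^ k) K).
    + rewrite <- rsum_plus. apply rsum_le. intros k _. rewrite <- Rmult_plus_distr_r.
      apply Rmult_le_compat_r; [apply pow_le; lra|].
      eapply Rle_trans; [|apply Cmod_triangle]. apply Req_le. f_equal. cring.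
    + apply Rplus_le_compat; [|exact HJ].
      apply Rle_trans with (sum_n (fun k => sum_n (fun j => Cmod (c j k) * r ^ k) J) K).
      * apply rsum_le. intros k _. rewrite rsum_mult_r.
        apply Rmult_le_compat_r; [apply pow_le; lra|]. apply Cmod_csum.
      * rewrite rsum_switch. eapply Rle_trans; [|apply (HN J)]. apply rsum_le.
        intros j _. apply (Hc j).
  - intros z Hz.
    apply (series_fubini (fun j k => (c j k * (z - a) ^ k)%C) (fun j => f j z) _ _ N M).
    + intros j K. apply (wiener_coef_terms a r (f j)); auto.
    + exact HN.
    + intros j. apply (Hc j), Hz.
    + apply HF, Hz.
    + intros k. apply is_series_C_scal_r, HT.
Qed.

Lemma wiener_series a r (f : nat -> C -> C) (N : nat -> R) M F :
  0 < r -> (forall j, wiener a r (f j) (N j)) -> (forall n, sum_n N n <= M) ->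
  (forall z, Cmod (z - a) <= r -> is_series (fun j => f j z) (F z)) ->
  wiener a r F M.
Proof.
  intros hr Hf HN HF.
  set (c := fun j => proj1_sig (constructive_indefinite_description _ (Hf j))).
  destruct (wiener_coef_series a r f N M c F) as [T [HT _]]; auto.
  - intros j. unfold c. apply proj2_sig.
  - now exists T.
Qed.

Lemma wiener_pow_mult a r f M k :
  0 <= r -> wiener a r f M -> wiener a r (fun z => ((z - a) ^ k * f z)%C) (r ^ k * M).
Proof.
  intros hr Hf. induction k as [|k IH].
  - simpl. rewrite Rmult_1_l. eapply wiener_ext; [|apply Hf]. intros z _. simpl. cring.
  - eapply wiener_ext; [|eapply wiener_mono; [|apply (wiener_shift _ _ _ _ hr IH)]].
    + intros z _. simpl. cring.
    + simpl. lra.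
Qed.

(** Instead of a Cauchy product, [f * g] is read as the normally convergent series of the functions
    [c k * ((z - a) ^ k * g z)]. *)
Lemma wiener_mult a r f g M N :
  0 < r -> wiener a r f M -> wiener a r g N -> wiener a r (fun z => (f z * g z)%C) (M * N).
Proof.
  intros hr [c [H1 H2]] Hg.
  apply (wiener_series a r (fun k z => (c k * ((z - a) ^ k * g z))%C) (fun k => Cmod (c k) * (r ^ k * N))).
  - exact hr.
  - intros k. apply wiener_scal, wiener_pow_mult; [lra | exact Hg].
  - intros n. rewrite (sum_n_ext _ (fun k => (Cmod (c k) * r ^ k) * N)) by (intros; simpl; ring).
    rewrite rsum_mult_r. apply Rmult_le_compat_r; [|apply H1].
    apply (wiener_ge0 a r g); [lra | exact Hg].
  - intros z Hz. eapply is_series_C_ext; [|apply (is_series_C_scal_r (g z)), H2, Hz].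
    intros k. simpl. cring.
Qed.

Lemma wiener_pow a r f M k :
  0 < r -> wiener a r f M -> wiener a r (fun z => (f z ^ k)%C) (M ^ k).
Proof.
  intros hr Hf. induction k as [|k IH].
  - eapply wiener_mono; [|apply (wiener_const a r 1)]. rewrite Cmod_1. simpl. lra.
  - simpl. now apply wiener_mult.
Qed.

Lemma wiener_affine a r b : 0 <= r -> wiener a r (fun z => (z - b)%C) (r + Cmod (a - b)).
Proof.
  intros hr. eapply wiener_ext; [|eapply wiener_mono; [|apply (wiener_plus _ _ _ _ _ _ hr (wiener_shift _ _ _ _ hr (wiener_const a r 1)) (wiener_const a r (a - b)))]].
  - intros z _. simpl. cring.
  - rewrite Cmod_1. lra.
Qed.

(** On the new disc [(z - a) ^ k] has norm at most [(r' + Cmod (b - a)) ^ k <= r ^ k], so the old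
    expansion is a normally convergent series of polynomials there, with the same bound. *)
Lemma wiener_recenter a r b r' f M :
  0 < r' -> r' + Cmod (b - a) <= r -> wiener a r f M -> wiener b r' f M.
Proof.
  intros hr H [c [H1 H2]].
  apply (wiener_series b r' (fun k z => (c k * (z - a) ^ k)%C)
           (fun k => Cmod (c k) * (r' + Cmod (b - a)) ^ k)).
  - exact hr.
  - intros k. apply wiener_scal, wiener_pow; [exact hr|]. apply wiener_affine. lra.
  - intros n. eapply Rle_trans; [|apply (H1 n)]. apply rsum_le. intros k _.
    apply Rmult_le_compat_l; [apply Cmod_ge_0|]. apply pow_incr. split; [|exact H].
    pose proof (Cmod_ge_0 (b - a)). lra.
  - intros z Hz. apply H2. replace (z - a)%C with ((z - b) + (b - a))%C by cring.
    eapply Rle_trans; [apply Cmod_triangle|]. lra.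
Qed.

Lemma wiener_coef_0 a r f M c : 0 <= r -> wiener_coef a r f M c -> f a = c 0%nat.
Proof.
  intros hr [_ H].
  assert (h : Cmod (a - a) <= r) by (replace (a - a)%C with (RtoC 0) by cring; now rewrite Cmod_0).
  eapply is_series_C_unique; [apply H, h|].
  apply is_series_C_first; [intros k|]; simpl; cring.
Qed.

Lemma wiener_coef_div a r f M c :
  0 < r -> wiener_coef a r f M c -> c 0%nat = RtoC 0 ->
  exists g, wiener_coef a r g (M / r) (fun k => c (S k)) /\
    forall z, Cmod (z - a) <= r -> f z = ((z - a) * g z)%C.
Proof.
  intros hr Hc c0. pose proof Hc as [H1 H2].
  (* At the centre the quotient takes its removable value. *)
  exists (fun z => if excluded_middle_informative (z = a) then c 1%nat else (f z / (z - a))%C).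
  split.
  - split.
    + intros n. apply Rmult_le_reg_l with r; [exact hr|].
      replace (r * (M / r)) with M by (field; lra).
      eapply Rle_trans; [|apply (H1 (S n))]. rewrite <- rsum_mult_l.
      assert (E : forall n, sum_n (fun k => Cmod (c k) * r ^ k) (S n)
         = sum_n (fun k => r * (Cmod (c (S k)) * r ^ k)) n).
      { induction n0 as [|m IH].
        - rewrite rsum_S, !rsum_O, c0, Cmod_0. simpl. rring.
        - rewrite rsum_S, IH, rsum_S. simpl. rring. }
      rewrite E. lra.
    + intros z Hz. destruct (excluded_middle_informative (z = a)) as [->|hz].
      * apply is_series_C_first; [intros k|]; simpl; cring.
      * assert (hz' : (z - a)%C <> RtoC 0).
        { intros E. apply hz. replace z with ((z - a) + a)%C by cring. rewrite E. cring. }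
        pose proof (is_series_C_unshift _ _ (H2 z Hz)) as Hs. cbv beta in Hs.
        rewrite c0 in Hs.
        apply (is_series_C_scal (/ (z - a))%C) in Hs.
        replace (f z / (z - a))%C with (/ (z - a) * (f z - 0 * (z - a) ^ 0))%C
          by (simpl; field; exact hz').
        eapply is_series_C_ext; [|exact Hs]. intros k. simpl. field. exact hz'.
  - intros z Hz. destruct (excluded_middle_informative (z = a)) as [->|hz].
    + rewrite (wiener_coef_0 a r f M c) by (auto; lra). rewrite c0. cring.
    + field. intros E. apply hz. replace z with ((z - a) + a)%C by cring. rewrite E. cring.
Qed.

(** [f z - f a] is divisible by [z - a] with a quotient of norm at most [(M + M) / r]; the second
    [M] pays for the constant [f a]. *)
Lemma wiener_coef_lip a r f M c z :
  0 < r -> wiener_coef a r f M c -> Cmod (z - a) <= r ->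
  Cmod (f z - f a) <= 2 * M / r * Cmod (z - a).
Proof.
  intros hr Hc Hz.
  assert (M0 : 0 <= M) by (apply (wiener_ge0 a r f M); [lra | now exists c]).
  pose proof (wiener_coef_0 a r f M c ltac:(lra) Hc) as E0.
  assert (Hfa : Cmod (f a) <= M).
  { apply (wiener_le a r f M a); [now exists c|].
    replace (a - a)%C with (RtoC 0) by cring. rewrite Cmod_0. lra. }
  assert (Hw : wiener a r (fun w => (f w + - f a)%C) (M + M)).
  { eapply wiener_mono; [|apply wiener_plus; [lra | exists c; exact Hc | apply wiener_const]].
    rewrite Cmod_opp. lra. }
  destruct Hw as [d Hd].
  assert (d0 : d 0%nat = RtoC 0).
  { rewrite <- (wiener_coef_0 a r _ _ d (Rlt_le _ _ hr) Hd). cring. }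
  destruct (wiener_coef_div _ _ _ _ _ hr Hd d0) as [g [Hg Eg]].
  replace (f z - f a)%C with (f z + - f a)%C by cring.
  rewrite (Eg z Hz), Cmod_mult, Rmult_comm.
  apply Rmult_le_compat_r; [apply Cmod_ge_0|].
  replace (2 * M / r) with ((M + M) / r) by (field; lra).
  eapply (wiener_le a r); [eexists; exact Hg | exact Hz].
Qed.

(** * Analytic functions *)

(** Neighbourhoods in terms of [Cmod]; the balls behind [locally] are comparable with these discs
    only up to the factor [sqrt 2]. *)
Definition nearC (a : C) (P : C -> Prop) : Prop :=
  exists d, 0 < d /\ forall z : C, Cmod (z - a) < d -> P z.

Definition nearC' (a : C) (P : C -> Prop) : Prop :=
  exists d, 0 < d /\ forall z : C, z <> a -> Cmod (z - a) < d -> P z.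

Lemma sqrt2_bound : 0 < sqrt 2 < 2.
Proof.
  split; [apply sqrt_lt_R0; lra|].
  replace 2 with (sqrt 4) at 2.
  - apply sqrt_lt_1; lra.
  - replace 4 with (2 * 2) by lra. apply sqrt_square. lra.
Qed.

Lemma ball_Cmod (x y : C) (e : posreal) : ball x e y -> Cmod (y - x) < 2 * e.
Proof.
  intros H. eapply Rlt_le_trans; [apply (C_NormedModule_mixin_compat2 x y e H)|].
  pose proof sqrt2_bound. destruct e as [e he]. simpl. nra.
Qed.

Lemma Cmod_ball (x y : C) (e : R) : Cmod (y - x) < e -> ball x e y.
Proof. apply (C_NormedModule_mixin_compat1 x y e). Qed.

Lemma nearC_locally a P : nearC a P <-> locally a P.
Proof.
  split.
  - intros [d [hd H]]. exists (mkposreal (d/2) ltac:(lra)). intros z Hz. apply H.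
    apply ball_Cmod in Hz. simpl in Hz. lra.
  - intros [e H]. exists e. split; [apply cond_pos|]. intros z Hz. now apply H, Cmod_ball.
Qed.

Lemma nearC'_locally' a P : nearC' a P <-> locally' a P.
Proof.
  split.
  - intros [d [hd H]]. exists (mkposreal (d/2) ltac:(lra)). intros z Hz hza. apply H; [exact hza|].
    apply ball_Cmod in Hz. simpl in Hz. lra.
  - intros [e H]. exists e. split; [apply cond_pos|]. intros z hza Hz. apply H; [|exact hza]. now apply Cmod_ball.
Qed.

Lemma nearC_and a P Q : nearC a P -> nearC a Q -> nearC a (fun z => P z /\ Q z).
Proof.
  intros [d [hd H]] [e [he K]]. exists (Rmin d e). split; [now apply Rmin_glb_lt|].
  intros z Hz. pose proof (Rmin_l d e). pose proof (Rmin_r d e). split; [apply H | apply K]; lra.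
Qed.

Lemma nearC'_and a P Q : nearC' a P -> nearC' a Q -> nearC' a (fun z => P z /\ Q z).
Proof.
  intros [d [hd H]] [e [he K]]. exists (Rmin d e). split; [now apply Rmin_glb_lt|].
  intros z hz Hz. pose proof (Rmin_l d e). pose proof (Rmin_r d e). split; [apply H | apply K]; auto; lra.
Qed.

Lemma nearC_imp (a : C) (P Q : C -> Prop) : (forall z, P z -> Q z) -> nearC a P -> nearC a Q.
Proof. intros H [d [hd K]]. exists d. auto. Qed.

Lemma nearC'_imp (a : C) (P Q : C -> Prop) : (forall z, P z -> Q z) -> nearC' a P -> nearC' a Q.
Proof. intros H [d [hd K]]. exists d. auto. Qed.

Lemma nearC_nearC' a P : nearC a P -> nearC' a P.
Proof. intros [d [hd H]]. exists d. auto. Qed.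

Lemma nearC'_nearC (a : C) (P : C -> Prop) : P a -> nearC' a P -> nearC a P.
Proof.
  intros Pa [d [hd H]]. exists d. split; [exact hd|]. intros z Hz.
  destruct (excluded_middle_informative (z = a)) as [->|h]; auto.
Qed.

Lemma Cminus_diag (a : C) : (a - a)%C = RtoC 0.
Proof. cring. Qed.

Lemma Cminus_neq0 (a b : C) : a <> b -> (a - b)%C <> RtoC 0.
Proof. intros h E. apply h. replace a with ((a - b) + b)%C by cring. rewrite E. cring. Qed.

Lemma nearC_point (a : C) (P : C -> Prop) : nearC a P -> P a.
Proof. intros [d [hd H]]. apply H. now rewrite Cminus_diag, Cmod_0. Qed.

(** A punctured disc is open: keeping the radius below [Cmod (b - a)] prevents the disc about [b]
    from containing [a]. *)
Lemma nearC'_nearC_near (a : C) (P : C -> Prop) : nearC' a P -> nearC' a (fun b => nearC b P).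
Proof.
  intros [d [hd H]]. exists d. split; [exact hd|]. intros b hb Hb.
  pose proof (proj1 (Cmod_gt_0 _) (Cminus_neq0 _ _ hb)).
  exists (Rmin (d - Cmod (b - a)) (Cmod (b - a))). split; [apply Rmin_glb_lt; lra|]. intros z Hz.
  pose proof (Rmin_l (d - Cmod (b - a)) (Cmod (b - a))).
  pose proof (Rmin_r (d - Cmod (b - a)) (Cmod (b - a))).
  apply H.
  - intros ->. rewrite Cmod_minus_sym in Hz. lra.
  - replace (z - a)%C with ((z - b) + (b - a))%C by cring.
    eapply Rle_lt_trans; [apply Cmod_triangle|]. lra.
Qed.

Lemma is_derive_C_eps (f : C -> C) (a l : C) :
  (forall eps, 0 < eps -> nearC a (fun z => Cmod (f z - f a - (z - a) * l) <= eps * Cmod (z - a))) ->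
  is_derive f a l.
Proof.
  intros H. split.
  - apply is_linear_scal_l.
  - intros x Hx. 
    assert (E : a = x) by exact (is_filter_lim_locally_unique (V := AbsRing_NormedModule C_AbsRing) a x Hx).
    subst x. intros eps. destruct (H eps (cond_pos eps)) as [d [hd Hd]].
    exists (mkposreal d hd). exact Hd.
Qed.

Lemma wiener_coef_split a r f M c :
  0 < r -> wiener_coef a r f M c ->
  exists g N, wiener_coef a r g N (fun k => c (S k)) /\
    forall z, Cmod (z - a) <= r -> f z = (f a + (z - a) * g z)%C.
Proof.
  intros hr Hc. pose proof (wiener_coef_0 a r f M c (Rlt_le _ _ hr) Hc) as E0.
  assert (H1 : wiener_coef a r (fun z => (f z + - f a)%C) (M + Cmod (f a))
           (fun k => match k with O => RtoC 0 | S k => c (S k) end)).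
  { destruct Hc as [H1 H2]. split.
    - intros n. eapply Rle_trans; [|apply Rplus_le_compat; [apply (H1 n)|apply Cmod_ge_0]].
      rewrite Rplus_0_r. apply rsum_le. intros [|k] _; [|lra].
      rewrite Cmod_0. simpl. pose proof (Cmod_ge_0 (c 0%nat)). lra.
    - intros z Hz. pose proof (is_series_C_unshift _ _ (H2 z Hz)) as Hs. cbv beta in Hs.
      replace (f z + - f a)%C with ((fun k => (match k with O => RtoC 0 | S k => c (S k) end * (z - a) ^ k)%C) 0%nat
         + (f z - c 0%nat * (z - a) ^ 0))%C by (rewrite E0; simpl; cring).
      apply is_series_C_shift. exact Hs. }
  destruct (wiener_coef_div _ _ _ _ _ hr H1 eq_refl) as [g [Hg Eg]].
  exists g, ((M + Cmod (f a)) / r). split; [exact Hg|].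
  intros z Hz. rewrite <- (Eg z Hz). cring.
Qed.

Lemma wiener_coef_is_derive a r f M c :
  0 < r -> wiener_coef a r f M c -> is_derive f a (c 1%nat).
Proof.
  intros hr Hc. destruct (wiener_coef_split a r f M c hr Hc) as [g [N [Hg Eg]]].
  assert (N0 : 0 <= N) by (apply (wiener_ge0 a r g); [lra | eexists; exact Hg]).
  apply is_derive_C_eps. intros eps He.
  (* [2 * N / r] is the Lipschitz constant of the quotient [g] at the centre; the [+ 1] keeps the
     denominator positive when [N] is 0. *)
  exists (Rmin r (eps / (2 * N / r + 1))).
  assert (K0 : 0 <= 2 * N / r) by (apply Rmult_le_pos; [lra | left; now apply Rinv_0_lt_compat]).
  split; [apply Rmin_glb_lt; [exact hr|apply Rdiv_lt_0_compat; lra]|].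
  intros z Hz. pose proof (Rmin_l r (eps / (2 * N / r + 1))). pose proof (Rmin_r r (eps / (2 * N / r + 1))).
  rewrite <- (wiener_coef_0 a r g _ _ (Rlt_le _ _ hr) Hg), (Eg z) by lra.
  replace (f a + (z - a) * g z - f a - (z - a) * g a)%C with ((g z - g a) * (z - a))%C by cring.
  rewrite Cmod_mult. apply Rmult_le_compat_r; [apply Cmod_ge_0|].
  eapply Rle_trans; [apply (wiener_coef_lip a r g N _ z hr Hg); lra|].
  assert (h : Cmod (z - a) <= eps / (2 * N / r + 1)) by lra.
  apply (Rmult_le_compat_l (2 * N / r + 1)) in h; [|lra].
  replace ((2 * N / r + 1) * (eps / (2 * N / r + 1))) with eps in h by (field; lra).
  pose proof (Cmod_ge_0 (z - a)). lra.
Qed.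

(** Equivalent to [analytic_at], by [holomorphic_analytic] and [analytic_holomorphic], but with a
    disc and a norm bound at hand. *)
Definition holomorphic_at (f : C -> C) (a : C) : Prop :=
  exists r M, 0 < r /\ wiener a r f M.

Lemma wiener_holomorphic a r f M : 0 < r -> wiener a r f M -> holomorphic_at f a.
Proof. intros. now exists r, M. Qed.

Lemma holomorphic_ext a f g :
  nearC a (fun z => f z = g z) -> holomorphic_at f a -> holomorphic_at g a.
Proof.
  intros [d [hd H]] [r [M [hr Hf]]].
  assert (hm : 0 < Rmin r (d/2)) by (apply Rmin_glb_lt; lra).
  pose proof (Rmin_l r (d/2)). pose proof (Rmin_r r (d/2)).
  exists (Rmin r (d/2)), M. split; [exact hm|].
  apply (wiener_ext _ _ f); [intros z Hz; apply H; lra|].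
  apply (wiener_recenter a r); [exact hm | rewrite Cminus_diag, Cmod_0; lra | exact Hf].
Qed.

Lemma holomorphic_near a f : holomorphic_at f a -> nearC a (holomorphic_at f).
Proof.
  intros [r [M [hr Hf]]]. exists (r/2). split; [lra|]. intros b Hb.
  exists (r/2), M. split; [lra|]. apply (wiener_recenter a r); [lra | lra | exact Hf].
Qed.

Lemma wiener_shrink a r r' f M : 0 < r' -> r' <= r -> wiener a r f M -> wiener a r' f M.
Proof.
  intros h1 h2. apply wiener_recenter; [exact h1|]. rewrite Cminus_diag, Cmod_0. lra.
Qed.

Lemma holomorphic_common a f g :
  holomorphic_at f a -> holomorphic_at g a ->
  exists r M N, 0 < r /\ wiener a r f M /\ wiener a r g N.
Proof.
  intros [r [M [hr Hf]]] [r' [N [hr' Hg]]].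
  assert (hm : 0 < Rmin r r') by now apply Rmin_glb_lt.
  exists (Rmin r r'), M, N. split; [exact hm|].
  split; [apply (wiener_shrink a r) | apply (wiener_shrink a r')]; auto using Rmin_l, Rmin_r.
Qed.

Lemma holomorphic_plus a f g :
  holomorphic_at f a -> holomorphic_at g a -> holomorphic_at (fun z => (f z + g z)%C) a.
Proof.
  intros Hf Hg. destruct (holomorphic_common a f g Hf Hg) as [r [M [N [hr [h1 h2]]]]].
  eapply wiener_holomorphic; [exact hr|]. apply wiener_plus; eauto; lra.
Qed.

Lemma holomorphic_mult a f g :
  holomorphic_at f a -> holomorphic_at g a -> holomorphic_at (fun z => (f z * g z)%C) a.
Proof.
  intros Hf Hg. destruct (holomorphic_common a f g Hf Hg) as [r [M [N [hr [h1 h2]]]]].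
  eapply wiener_holomorphic; [exact hr|]. apply wiener_mult; eauto.
Qed.

Lemma holomorphic_const a c : holomorphic_at (fun _ => c) a.
Proof. apply (wiener_holomorphic a 1 _ (Cmod c)); [lra | apply wiener_const]. Qed.

Lemma holomorphic_affine a b : holomorphic_at (fun z => (z - b)%C) a.
Proof. eapply (wiener_holomorphic a 1); [lra | apply wiener_affine; lra]. Qed.

Lemma holomorphic_scal a c f : holomorphic_at f a -> holomorphic_at (fun z => (c * f z)%C) a.
Proof. apply holomorphic_mult, holomorphic_const. Qed.

Lemma holomorphic_minus a f g :
  holomorphic_at f a -> holomorphic_at g a -> holomorphic_at (fun z => (f z - g z)%C) a.
Proof.
  intros Hf Hg. apply (holomorphic_ext a (fun z => (f z + (- (1)) * g z)%C)).
  - exists 1. split; [lra|]. intros; cring.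
  - apply holomorphic_plus; [exact Hf|]. now apply holomorphic_scal.
Qed.

Lemma holomorphic_pow a f k : holomorphic_at f a -> holomorphic_at (fun z => (f z ^ k)%C) a.
Proof.
  intros [r [M [hr H]]]. eapply wiener_holomorphic; [exact hr|]. apply wiener_pow; eauto.
Qed.

Lemma geom_sum_le q n : 0 <= q < 1 -> sum_n (fun k => q ^ k) n <= / (1 - q).
Proof.
  intros hq. apply is_series_R_le; [intros; now apply pow_le|].
  apply is_series_geom. rewrite Rabs_pos_eq; lra.
Qed.

Lemma is_series_C_geom (q : C) : Cmod q < 1 -> is_series (fun k => (q ^ k)%C) (/ (1 - q))%C.
Proof.
  intros hq.
  assert (h1 : (1 - q)%C <> RtoC 0).
  { apply Cminus_neq0. intros E. rewrite <- E, Cmod_1 in hq. lra. }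
  apply is_series_C_eps. intros eps He.
  assert (E : forall n, (sum_n (fun k => q ^ k) n - / (1 - q) = - (q ^ S n) / (1 - q))%C).
  { induction n as [|n IH].
    - rewrite csum_O. simpl. field. exact h1.
    - rewrite csum_S.
      replace (sum_n (fun k => q ^ k) n + q ^ S n - / (1 - q))%C
        with ((sum_n (fun k => q ^ k) n - / (1 - q)) + q ^ S n)%C by cring.
      rewrite IH. simpl. field. exact h1. }
  assert (hp : 0 < Cmod (1 - q)) by now apply Cmod_gt_0.
  destruct (pow_lt_1_zero (Cmod q)) with (y := eps * Cmod (1 - q)) as [N HN].
  - rewrite Rabs_pos_eq; [exact hq | apply Cmod_ge_0].
  - nra.
  - exists N. intros n Hn. rewrite E, Cmod_div, Cmod_opp, Cmod_pow by exact h1.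
    specialize (HN (S n) ltac:(lia)).
    rewrite Rabs_pos_eq in HN by (apply pow_le, Cmod_ge_0).
    apply Rmult_lt_reg_r with (Cmod (1 - q)); [exact hp|].
    replace (Cmod q ^ S n / Cmod (1 - q) * Cmod (1 - q)) with (Cmod q ^ S n) by (field; lra).
    exact HN.
Qed.

(** Geometric series in [q = - (z - a) / (a - b)]; on the disc of half the distance to [b] its ratio
    is at most 1/2. *)
Lemma holomorphic_inv_affine a b : a <> b -> holomorphic_at (fun z => (/ (z - b))%C) a.
Proof.
  intros h. pose proof (Cminus_neq0 _ _ h) as hab.
  assert (hp : 0 < Cmod (a - b)) by now apply Cmod_gt_0.
  set (r := Cmod (a - b) / 2). assert (hr : 0 < r) by (unfold r; lra).
  exists r, (/ Cmod (a - b) * / (1 - /2)). split; [exact hr|].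
  apply (wiener_series a r (fun k z => ((/ (a - b)) * ((z - a) ^ k * (- / (a - b)) ^ k))%C)
           (fun k => / Cmod (a - b) * (/2) ^ k)).
  - exact hr.
  - intros k. eapply wiener_mono; [|apply wiener_scal, wiener_pow_mult; [lra|apply wiener_const]].
    rewrite Cmod_inv by exact hab. apply Rmult_le_compat_l; [left; now apply Rinv_0_lt_compat|].
    rewrite Cmod_pow, Cmod_opp, Cmod_inv, <- Rpow_mult_distr by exact hab.
    apply Req_le. f_equal. unfold r. field. lra.
  - intros n. rewrite rsum_mult_l. apply Rmult_le_compat_l; [left; now apply Rinv_0_lt_compat|].
    apply geom_sum_le. lra.
  - intros z Hz.
    set (q := ((z - a) * (- / (a - b)))%C).
    assert (hq : Cmod q < 1).
    { unfold q. rewrite Cmod_mult, Cmod_opp, Cmod_inv by exact hab.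
      apply Rmult_lt_reg_r with (Cmod (a - b)); [exact hp|]. unfold r in Hz.
      rewrite Rmult_assoc, Rinv_l; lra. }
    assert (h1 : (1 - q)%C <> RtoC 0).
    { apply Cminus_neq0. intros E. rewrite <- E, Cmod_1 in hq. lra. }
    assert (hz : (z - b)%C <> RtoC 0).
    { replace (z - b)%C with ((1 - q) * (a - b))%C by (unfold q; field; exact hab).
      now apply Cmult_neq_0. }
    replace (/ (z - b))%C with (/ (a - b) * / (1 - q))%C.
    + apply is_series_C_scal.
      apply (is_series_C_ext (fun k => (q ^ k)%C)); [intros k; unfold q; apply Cpow_mult_l|].
      now apply is_series_C_geom.
    + replace (1 - q)%C with ((z - b) / (a - b))%C by (unfold q; field; exact hab).
      field. now split.
Qed.

Lemma holomorphic_comp_scale a k b f :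
  0 < k -> holomorphic_at f (RtoC k * a + b)%C -> holomorphic_at (fun z => f (RtoC k * z + b)%C) a.
Proof.
  intros hk [r [M [hr [c [H1 H2]]]]].
  exists (r / k), M. split; [now apply Rdiv_lt_0_compat|].
  exists (fun n => (c n * RtoC k ^ n)%C). split.
  - intros n. eapply Rle_trans; [|apply (H1 n)]. apply rsum_le. intros j _.
    rewrite Cmod_mult, Cmod_pow, Cmod_R, Rabs_pos_eq, Rmult_assoc, <- Rpow_mult_distr by lra.
    apply Req_le. do 2 f_equal. field. lra.
  - intros z Hz.
    assert (E : (RtoC k * z + b - (RtoC k * a + b) = RtoC k * (z - a))%C) by cring.
    eapply is_series_C_ext; [|apply H2].
    + intros n. rewrite E, Cpow_mult_l. simpl. cring.
    + rewrite E, Cmod_mult, Cmod_R, Rabs_pos_eq by lra.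
      apply (Rmult_le_compat_l k) in Hz; [|lra]. replace (k * (r / k)) with r in Hz by (field; lra). exact Hz.
Qed.

Lemma holomorphic_continuous a f : holomorphic_at f a ->
  forall eps, 0 < eps -> nearC a (fun z => Cmod (f z - f a) < eps).
Proof.
  intros [r [M [hr [c H]]]] eps He.
  assert (M0 : 0 <= M) by (apply (wiener_ge0 a r f); [lra | eexists; exact H]).
  assert (K0 : 0 <= 2 * M / r) by (apply Rmult_le_pos; [lra | left; now apply Rinv_0_lt_compat]).
  exists (Rmin r (eps / (2 * M / r + 1))).
  split; [apply Rmin_glb_lt; [exact hr|apply Rdiv_lt_0_compat; lra]|].
  intros z Hz. pose proof (Rmin_l r (eps / (2 * M / r + 1))). pose proof (Rmin_r r (eps / (2 * M / r + 1))).
  eapply Rle_lt_trans; [apply (wiener_coef_lip a r f M c z hr H); lra|].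
  assert (h : Cmod (z - a) < eps / (2 * M / r + 1)) by lra.
  apply (Rmult_lt_compat_l (2 * M / r + 1)) in h; [|lra].
  replace ((2 * M / r + 1) * (eps / (2 * M / r + 1))) with eps in h by (field; lra).
  pose proof (Cmod_ge_0 (z - a)). lra.
Qed.

Lemma holomorphic_nonzero_near a f : holomorphic_at f a -> f a <> RtoC 0 ->
  nearC a (fun z => f z <> RtoC 0).
Proof.
  intros H h. eapply nearC_imp; [|apply (holomorphic_continuous a f H (Cmod (f a)))].
  - intros z Hz E. cbv beta in Hz. rewrite E in Hz.
    replace (0 - f a)%C with (- f a)%C in Hz by cring. rewrite Cmod_opp in Hz. lra.
  - now apply Cmod_gt_0.
Qed.

Lemma wiener_coef_factor a r f M c p :
  0 < r -> wiener_coef a r f M c -> (forall k, (k < p)%nat -> c k = RtoC 0) ->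
  exists g N, wiener_coef a r g N (fun k => c (p + k)%nat) /\
    forall z, Cmod (z - a) <= r -> f z = ((z - a) ^ p * g z)%C.
Proof.
  intros hr Hc. induction p as [|p IH]; intros H.
  - exists f, M. split; [exact Hc|]. intros z _. simpl. cring.
  - destruct IH as [g [N [Hg Eg]]]; [intros; apply H; lia|].
    destruct (wiener_coef_div a r g N _ hr Hg) as [g' [Hg' Eg']].
    + rewrite Nat.add_0_r. apply H. lia.
    + exists g', (N / r). split.
      * replace (fun k => c (S p + k)%nat) with (fun k => c (p + S k)%nat); [exact Hg'|].
        apply functional_extensionality. intros k. f_equal. lia.
      * intros z Hz. rewrite Eg, Eg' by exact Hz. simpl. cring.
Qed.

Lemma first_nonzero (c : nat -> C) :
  (exists k, c k <> RtoC 0) -> exists p, c p <> RtoC 0 /\ forall k, (k < p)%nat -> c k = RtoC 0.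
Proof.
  intros [k Hk]. revert Hk. induction k as [k IH] using lt_wf_ind. intros Hk.
  destruct (excluded_middle_informative (exists j, (j < k)%nat /\ c j <> RtoC 0)) as [[j [h1 h2]]|N].
  - now apply (IH j).
  - exists k. split; [exact Hk|]. intros j Hj.
    destruct (excluded_middle_informative (c j = RtoC 0)) as [E|E]; [exact E|].
    exfalso. apply N. now exists j.
Qed.

(** The order of vanishing [p] is the index of the first nonzero coefficient; if there is none, the
    power series is zero on its disc. *)
Lemma holomorphic_dichotomy a f :
  holomorphic_at f a ->
  nearC a (fun z => f z = RtoC 0) \/
  exists p g, holomorphic_at g a /\ g a <> RtoC 0 /\ nearC a (fun z => f z = ((z - a) ^ p * g z)%C).
Proof.
  intros [r [M [hr [c Hc]]]].
  destruct (excluded_middle_informative (exists k, c k <> RtoC 0)) as [E|E].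
  - right. destruct (first_nonzero c E) as [p [h1 h2]].
    destruct (wiener_coef_factor a r f M c p hr Hc h2) as [g [N [Hg Eg]]].
    exists p, g. split; [|split].
    + exists r, N. split; [exact hr | eexists; exact Hg].
    + rewrite (wiener_coef_0 a r g N _ (Rlt_le _ _ hr) Hg), Nat.add_0_r. exact h1.
    + exists r. split; [exact hr|]. intros z Hz. apply Eg. lra.
  - left. exists r. split; [exact hr|]. intros z Hz.
    apply (is_series_C_unique (fun k => (c k * (z - a) ^ k)%C)); [apply Hc; lra|].
    eapply is_series_C_ext; [|apply is_series_C_0]. intros k. simpl.
    destruct (excluded_middle_informative (c k = RtoC 0)) as [E'|E']; [rewrite E'; cring|].
    exfalso. apply E. now exists k.
Qed.

Lemma holomorphic_analytic f a : holomorphic_at f a -> analytic_at f a.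
Proof.
  intros [r [M [hr [c [_ H]]]]]. exists c. apply nearC_locally. exists r. split; [exact hr|].
  intros z Hz. unfold is_pseries. eapply is_series_C_ext; [|apply (H z); lra].
  intros k. change ((c k * (z - a) ^ k)%C = (pow_n (K := C_Ring) (z - a)%C k * c k)%C).
  apply Cmult_comm.
Qed.

Lemma is_series_C_terms_bounded (a : nat -> C) (l : C) :
  is_series a l -> exists B, 0 <= B /\ forall n, Cmod (a n) <= B.
Proof.
  intros H. rewrite is_series_C_eps in H. destruct (H 1 Rlt_0_1) as [N HN].
  exists (sum_n (fun k => Cmod (a k)) N + 2). split.
  - pose proof (rsum_ge0 (fun k => Cmod (a k)) N ltac:(intros; apply Cmod_ge_0)). simpl in *. lra.
  - intros n. destruct (le_lt_dec n N) as [L|L].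
    + pose proof (term_le_rsum (fun k => Cmod (a k)) n ltac:(intros; apply Cmod_ge_0)) as h. simpl in h.
      pose proof (rsum_mono (fun k => Cmod (a k)) n N ltac:(intros; apply Cmod_ge_0) L) as h'. simpl in h'.
      eapply Rle_trans; [exact h|]. eapply Rle_trans; [exact h'|]. lra.
    + destruct n as [|n]; [lia|].
      pose proof (rsum_ge0 (fun k => Cmod (a k)) N ltac:(intros; apply Cmod_ge_0)) as h0.
      pose proof (HN n ltac:(lia)) as h1. pose proof (HN (S n) ltac:(lia)) as h2.
      rewrite csum_S in h2.
      replace (a (S n)) with ((sum_n a n + a (S n) - l) - (sum_n a n - l))%C by cring.
      eapply Rle_trans; [apply Cmod_triangle_minus|]. simpl in *. lra.
Qed.

(** Convergence at a single point at distance [d/2] bounds the terms there, which yields a geometric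
    majorant of ratio 1/2 on the disc of radius [d/4]. *)
Lemma analytic_holomorphic f a : analytic_at f a -> holomorphic_at f a.
Proof.
  intros [c H]. apply nearC_locally in H. destruct H as [d [hd H]].
  assert (H' : forall z : C, Cmod (z - a) < d -> is_series (fun k => (c k * (z - a) ^ k)%C) (f z)).
  { intros z Hz. specialize (H z Hz). unfold is_pseries in H.
    eapply is_series_C_ext; [|exact H].
    intros k. change ((pow_n (K := C_Ring) (z - a)%C k * c k)%C = (c k * (z - a) ^ k)%C).
    apply Cmult_comm. }
  assert (hz : Cmod (a + RtoC (d/2) - a) = d / 2).
  { replace (a + RtoC (d/2) - a)%C with (RtoC (d/2)) by cring. rewrite Cmod_R, Rabs_pos_eq; lra. }
  destruct (is_series_C_terms_bounded _ _ (H' (a + RtoC (d/2))%C ltac:(lra))) as [B [B0 HB]].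
  exists (d/4), (B * / (1 - /2)). split; [lra|].
  exists c. split; [|intros z Hz; apply H'; lra].
  intros n. apply Rle_trans with (B * sum_n (fun k => (/2) ^ k) n).
  - rewrite <- rsum_mult_l. apply rsum_le. intros k _. specialize (HB k). cbv beta in HB.
    rewrite Cmod_mult, Cmod_pow, hz in HB.
    replace (d/4) with (d/2 * /2) by lra. rewrite Rpow_mult_distr, <- Rmult_assoc.
    apply Rmult_le_compat_r; [apply pow_le; lra | exact HB].
  - apply Rmult_le_compat_l; [exact B0|]. apply geom_sum_le. lra.
Qed.

(** * Poles, the identity theorem and continuation *)

(** Weaker than being a pole: [m] may be 0, [g] may vanish at [a], and nothing is said about the
    value at [a]. This makes the notion stable under sums and products without case distinctions. *)
Definition polar_at (f : C -> C) (a : C) : Prop :=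
  exists (m : nat) (g : C -> C),
    holomorphic_at g a /\ nearC' a (fun z => f z = (g z / (z - a) ^ m)%C).

Lemma polar_ext a f g : nearC' a (fun z => f z = g z) -> polar_at f a -> polar_at g a.
Proof.
  intros H [m [h [Hh E]]]. exists m, h. split; [exact Hh|].
  eapply nearC'_imp; [|exact (nearC'_and _ _ _ H E)]. cbv beta. intros z [h1 h2]. congruence.
Qed.

Lemma holomorphic_polar a f : holomorphic_at f a -> polar_at f a.
Proof.
  intros H. exists 0%nat, f. split; [exact H|]. exists 1. split; [lra|].
  intros z _ _. simpl. field.
Qed.

Lemma Cpow_minus_neq0 (z a : C) n : z <> a -> ((z - a) ^ n)%C <> RtoC 0.
Proof. intros h. apply Cpow_nz, Cminus_neq0, h. Qed.

Lemma polar_plus a f g : polar_at f a -> polar_at g a -> polar_at (fun z => (f z + g z)%C) a.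
Proof.
  intros [m [f1 [Hf Ef]]] [n [g1 [Hg Eg]]].
  exists (m + n)%nat, (fun z => (f1 z * (z - a) ^ n + g1 z * (z - a) ^ m)%C). split.
  - apply holomorphic_plus; apply holomorphic_mult; auto; apply (holomorphic_pow a (fun z => (z - a)%C)), holomorphic_affine.
  - destruct (nearC'_and _ _ _ Ef Eg) as [d [hd H]]. exists d. split; [exact hd|].
    intros z hz Hz. destruct (H z hz Hz) as [-> ->]. rewrite Cpow_add_r. field.
    split; now apply Cpow_minus_neq0.
Qed.

Lemma polar_mult a f g : polar_at f a -> polar_at g a -> polar_at (fun z => (f z * g z)%C) a.
Proof.
  intros [m [f1 [Hf Ef]]] [n [g1 [Hg Eg]]].
  exists (m + n)%nat, (fun z => (f1 z * g1 z)%C). split.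
  - now apply holomorphic_mult.
  - destruct (nearC'_and _ _ _ Ef Eg) as [d [hd H]]. exists d. split; [exact hd|].
    intros z hz Hz. destruct (H z hz Hz) as [-> ->]. rewrite Cpow_add_r. field.
    split; now apply Cpow_minus_neq0.
Qed.

Lemma polar_scal a c f : polar_at f a -> polar_at (fun z => (c * f z)%C) a.
Proof. apply polar_mult, holomorphic_polar, holomorphic_const. Qed.

Lemma polar_minus a f g : polar_at f a -> polar_at g a -> polar_at (fun z => (f z - g z)%C) a.
Proof.
  intros Hf Hg. apply (polar_ext a (fun z => (f z + (- (1)) * g z)%C)).
  - exists 1. split; [lra|]. intros; cring.
  - apply polar_plus; [exact Hf|]. now apply polar_scal.
Qed.

Lemma polar_inv_affine a b : polar_at (fun z => (/ (z - b))%C) a.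
Proof.
  destruct (excluded_middle_informative (a = b)) as [<-|h].
  - exists 1%nat, (fun _ => RtoC 1). split; [apply holomorphic_const|].
    exists 1. split; [lra|]. intros z hz _. simpl. field. now apply Cminus_neq0.
  - now apply holomorphic_polar, holomorphic_inv_affine.
Qed.

Lemma polar_comp_scale a k b f :
  0 < k -> polar_at f (RtoC k * a + b)%C -> polar_at (fun z => f (RtoC k * z + b)%C) a.
Proof.
  intros hk [m [g [Hg [d [hd E]]]]].
  assert (k0 : RtoC k <> RtoC 0) by (intros e; apply RtoC_inj in e; lra).
  exists m, (fun z => ((/ RtoC k) ^ m * g (RtoC k * z + b))%C). split.
  - apply holomorphic_scal. now apply holomorphic_comp_scale.
  - exists (d / k). split; [now apply Rdiv_lt_0_compat|].
    intros z hz Hz.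
    assert (e : (RtoC k * z + b - (RtoC k * a + b) = RtoC k * (z - a))%C) by cring.
    rewrite E.
    + rewrite e, Cpow_mult_l, Cpow_inv by exact k0. field.
      split; [now apply Cpow_nz | now apply Cpow_minus_neq0].
    + intros e'. apply (Cmult_neq_0 (RtoC k) (z - a)%C); [exact k0 | now apply Cminus_neq0|].
      rewrite <- e, e'. cring.
    + rewrite e, Cmod_mult, Cmod_R, Rabs_pos_eq by lra.
      apply (Rmult_lt_compat_l k) in Hz; [|lra]. replace (k * (d / k)) with d in Hz by (field; lra). exact Hz.
Qed.

Lemma holomorphic_inv_pow_affine a b m : a <> b -> holomorphic_at (fun z => (/ (z - b) ^ m)%C) a.
Proof.
  intros h. apply (holomorphic_ext a (fun z => ((/ (z - b)) ^ m)%C)).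
  - assert (hp : 0 < Cmod (a - b)) by now apply Cmod_gt_0, Cminus_neq0.
    exists (Cmod (a - b)). split; [exact hp|]. intros z Hz. apply Cpow_inv, Cminus_neq0.
    intros ->. rewrite Cmod_minus_sym in Hz. lra.
  - apply holomorphic_pow. now apply holomorphic_inv_affine.
Qed.

Lemma nearC_neq a b : a <> b -> nearC a (fun z => z <> b).
Proof.
  intros h. assert (hp : 0 < Cmod (a - b)) by now apply Cmod_gt_0, Cminus_neq0.
  exists (Cmod (a - b)). split; [exact hp|]. intros z Hz ->. rewrite Cmod_minus_sym in Hz. lra.
Qed.

Lemma polar_holomorphic_near a f : polar_at f a -> nearC' a (holomorphic_at f).
Proof.
  intros [m [g [Hg E]]].
  pose proof (nearC'_and _ _ _ (nearC'_nearC_near _ _ E) (nearC_nearC' _ _ (holomorphic_near a g Hg))) as H.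
  destruct H as [d [hd H]]. exists d. split; [exact hd|]. intros b hb Hb.
  destruct (H b hb Hb) as [h1 h2].
  apply (holomorphic_ext b (fun z => (g z * / (z - a) ^ m)%C)).
  - eapply nearC_imp; [|exact h1]. intros z ->. reflexivity.
  - apply holomorphic_mult; [exact h2 | now apply holomorphic_inv_pow_affine].
Qed.

Lemma C1_neq0 : RtoC 1 <> RtoC 0.
Proof. intros E. apply RtoC_inj in E. lra. Qed.

(** Zeros accumulating at [a] along one ray exclude the second case of [holomorphic_dichotomy], in
    which a punctured disc contains no zero. *)
Lemma polar_zero_of_right_zeros a f :
  polar_at f a ->
  (forall e, 0 < e -> exists t, 0 < t < e /\ f (a + RtoC t)%C = RtoC 0) ->
  nearC' a (fun z => f z = RtoC 0).
Proof.
  intros [m [g [Hg E]]] Hz.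
  destruct (holomorphic_dichotomy a g Hg) as [Z|[p [h [Hh [h0 Eh]]]]].
  - eapply nearC'_imp; [|exact (nearC'_and _ _ _ E (nearC_nearC' _ _ Z))].
    cbv beta. intros z [-> ->]. unfold Cdiv. cring.
  - exfalso.
    destruct (nearC'_and _ _ _ (nearC'_and _ _ _ E (nearC_nearC' _ _ Eh))
                (nearC_nearC' _ _ (holomorphic_nonzero_near a h Hh h0))) as [d [hd H]].
    destruct (Hz d hd) as [t [ht Et]].
    assert (e : (a + RtoC t - a = RtoC t)%C) by cring.
    assert (na : (a + RtoC t)%C <> a).
    { intros e'. rewrite e', Cminus_diag in e. apply RtoC_inj in e. lra. }
    destruct (H (a + RtoC t)%C na) as [[h1 h2] h3].
    + rewrite e, Cmod_R, Rabs_pos_eq; lra.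
    + rewrite Et, h2 in h1. revert h1. intros h1.
      assert (h4 : ((a + RtoC t - a) ^ p * h (a + RtoC t) * / (a + RtoC t - a) ^ m)%C <> RtoC 0).
      { apply Cmult_neq_0; [apply Cmult_neq_0|].
        - now apply Cpow_minus_neq0.
        - exact h3.
        - intros e'.
          assert (h5 : ((a + RtoC t - a) ^ m * / (a + RtoC t - a) ^ m = RtoC 1)%C)
            by (apply Cinv_r; now apply Cpow_minus_neq0).
          rewrite e' in h5. apply C1_neq0. rewrite <- h5. cring. }
      apply h4. symmetry. exact h1.
Qed.

(* Zeros propagate to the left along a horizontal line: the supremum of the abscissae
   around which [f] does not vanish identically would itself be a limit of zeros. *)
Lemma polar_zero_half_plane (M c : R) (f : C -> C) :
  (forall a, M < Re a -> polar_at f a) ->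
  (forall z, c < Re z -> f z = RtoC 0) ->
  forall a, M < Re a -> nearC' a (fun z => f z = RtoC 0).
Proof.
  intros Hf Hz a Ha.
  set (T := fun t : R => nearC' (a + RtoC t)%C (fun z => f z = RtoC 0)).
  assert (Rea : forall t, Re (a + RtoC t)%C = Re a + t) by (intros t; unfold Re; simpl; reflexivity).
  destruct (excluded_middle_informative (T 0)) as [h|N].
  { unfold T in h. replace (a + RtoC 0)%C with a in h by cring. exact h. }
  exfalso.
  set (E := fun t => 0 <= t /\ ~ T t).
  assert (Eb : forall t, E t -> t <= Rabs (c - Re a)).
  { intros t [h1 h2]. apply Rnot_lt_le. intros h3. apply h2.
    pose proof (Rle_abs (c - Re a)).
    exists (t - (c - Re a)). split; [lra|]. intros z _ hz. apply Hz.
    pose proof (re_le_Cmod (z - (a + RtoC t))%C) as h4.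
    replace (Re (z - (a + RtoC t))%C) with (Re z - (Re a + t)) in h4
      by (unfold Re; simpl; ring).
    apply Rabs_le_between in h4. lra. }
  destruct (completeness E) as [s [hs1 hs2]].
  - exists (Rabs (c - Re a)). exact Eb.
  - exists 0. split; [lra | exact N].
  - assert (s0 : 0 <= s) by (apply hs1; split; [lra | exact N]).
    assert (Ts : forall t, s < t -> T t).
    { intros t ht. destruct (excluded_middle_informative (T t)) as [h|h]; [exact h|].
      assert (t <= s) by (apply hs1; split; [lra | exact h]). lra. }
    assert (Tz : T s).
    { apply polar_zero_of_right_zeros; [apply Hf; rewrite Rea; lra|].
      intros e he. destruct (Ts (s + e/2) ltac:(lra)) as [d [hd H]].
      set (t := Rmin d (e/2) / 2).
      pose proof (Rmin_l d (e/2)). pose proof (Rmin_r d (e/2)).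
      assert (0 < Rmin d (e/2)) by (apply Rmin_glb_lt; lra).
      exists (e/2 + t). split; [unfold t; lra|]. 
      assert (e1 : (a + RtoC s + RtoC (e/2 + t) - (a + RtoC (s + e/2)) = RtoC t)%C)
        by (rewrite !RtoC_plus; cring).
      apply H.
      - intros e2. rewrite e2, Cminus_diag in e1. apply RtoC_inj in e1. unfold t in e1. lra.
      - rewrite e1, Cmod_R, Rabs_pos_eq; unfold t; lra. }
    (* Vanishing about the point of abscissa [s] spreads to an interval on its left, so that
       [s - d/2] is a smaller upper bound of [E]. *)
    destruct (nearC'_nearC_near _ _ Tz) as [d [hd H]].
    assert (s <= s - d/2); [|lra].
    apply hs2. intros t [ht1 ht2]. apply Rnot_lt_le. intros ht3. apply ht2.
    destruct (Rtotal_order t s) as [h|[->|h]]; [|exact Tz|now apply Ts].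
    assert (e1 : (a + RtoC t - (a + RtoC s) = RtoC (t - s))%C) by (rewrite RtoC_minus; cring).
    apply nearC_nearC', H.
    + intros e2. rewrite e2, Cminus_diag in e1. apply RtoC_inj in e1. lra.
    + rewrite e1, Cmod_R, Rabs_left; lra.
Qed.

Lemma polar_identity (M c : R) (f g : C -> C) :
  (forall a, M < Re a -> polar_at f a) -> (forall a, M < Re a -> polar_at g a) ->
  (forall z, c < Re z -> f z = g z) ->
  forall a, M < Re a -> nearC' a (fun z => f z = g z).
Proof.
  intros Hf Hg H a Ha.
  eapply nearC'_imp; [|apply (polar_zero_half_plane M c (fun z => (f z - g z)%C))]; auto.
  - cbv beta. intros z E. replace (f z) with ((f z - g z) + g z)%C by cring. rewrite E. cring.
  - intros b Hb. apply polar_minus; auto.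
  - intros z hz. rewrite H by exact hz. apply Cminus_diag.
Qed.

Lemma analytic_polar f a : analytic_at f a -> polar_at f a.
Proof. intros H. now apply holomorphic_polar, analytic_holomorphic. Qed.

Lemma pole_polar f a : pole_at f a -> polar_at f a.
Proof.
  intros [m [g [_ [Hg [_ E]]]]]. exists m, g. split; [now apply analytic_holomorphic|].
  apply nearC'_locally' in E. exact E.
Qed.

Lemma meromorphic_polar f a : meromorphic f -> polar_at f a.
Proof. intros H. destruct (H a); [now apply analytic_polar | now apply pole_polar]. Qed.

Lemma nearC'_exists (a : C) (P : C -> Prop) : nearC' a P -> exists z, P z.
Proof.
  intros [d [hd H]]. exists (a + RtoC (d/2))%C.
  assert (e : (a + RtoC (d/2) - a = RtoC (d/2))%C) by cring.
  apply H.
  - intros e'. rewrite e', Cminus_diag in e. apply RtoC_inj in e. lra.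
  - rewrite e, Cmod_R, Rabs_pos_eq; lra.
Qed.

Lemma punctured_limit_unique (a : C) (f : C -> C) v w :
  (forall eps, 0 < eps -> nearC' a (fun z => Cmod (f z - v) < eps)) ->
  (forall eps, 0 < eps -> nearC' a (fun z => Cmod (f z - w) < eps)) -> v = w.
Proof.
  intros H K. apply Ceq_eps. intros eps He.
  destruct (nearC'_exists _ _ (nearC'_and _ _ _ (H (eps/2) ltac:(lra)) (K (eps/2) ltac:(lra)))) as [z [h1 h2]].
  replace (v - w)%C with ((f z - w) - (f z - v))%C by cring.
  eapply Rle_lt_trans; [apply Cmod_triangle_minus|]. lra.
Qed.

Lemma holomorphic_punctured_limit a f : holomorphic_at f a ->
  forall eps, 0 < eps -> nearC' a (fun z => Cmod (f z - f a) < eps).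
Proof. intros H eps He. apply nearC_nearC'. now apply holomorphic_continuous. Qed.

Lemma punctured_limit_ext (a : C) (f g : C -> C) v :
  nearC' a (fun z => f z = g z) ->
  (forall eps, 0 < eps -> nearC' a (fun z => Cmod (f z - v) < eps)) ->
  (forall eps, 0 < eps -> nearC' a (fun z => Cmod (g z - v) < eps)).
Proof.
  intros E H eps He. eapply nearC'_imp; [|exact (nearC'_and _ _ _ E (H eps He))].
  cbv beta. intros z [h1 h2]. now rewrite <- h1.
Qed.

(** Off [a] the numerator [g] of a pole equals [(z - a) ^ m * h z], which tends to 0 because
    [m >= 1], whereas [g a] is nonzero. *)
Lemma not_pole_of_holomorphic a f h :
  holomorphic_at h a -> nearC' a (fun z => f z = h z) -> ~ pole_at f a.
Proof.
  intros Hh E [m [g [hm [Hg [g0 Eg]]]]].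
  apply analytic_holomorphic in Hg. apply nearC'_locally' in Eg.
  apply g0. apply (punctured_limit_unique a g); [now apply holomorphic_punctured_limit|].
  assert (Hk : holomorphic_at (fun z => ((z - a) ^ m * h z)%C) a).
  { apply holomorphic_mult; [|exact Hh]. apply (holomorphic_pow a (fun z => (z - a)%C)), holomorphic_affine. }
  assert (k0 : RtoC 0 = ((a - a) ^ m * h a)%C).
  { rewrite Cminus_diag. destruct m as [|m]; [lia|]. simpl. cring. }
  rewrite k0. apply (punctured_limit_ext a (fun z => ((z - a) ^ m * h z)%C)).
  - destruct (nearC'_and _ _ _ E Eg) as [d [hd H]]. exists d. split; [exact hd|].
    intros z hz Hz. destruct (H z hz Hz) as [h1 h2].
    change (f z = g z / (z - a) ^ m)%C in h2. rewrite <- h1, h2. field. now apply Cpow_minus_neq0.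
  - exact (holomorphic_punctured_limit a _ Hk).
Qed.

(** [meromorphic] excludes removable singularities, so agreement off [a] forces agreement at [a].
    Values and derivatives of a continuation can therefore be read off any holomorphic local
    formula. *)
Lemma meromorphic_eq_holomorphic a f h :
  meromorphic f -> holomorphic_at h a -> nearC' a (fun z => f z = h z) -> nearC a (fun z => f z = h z).
Proof.
  intros Hf Hh E. destruct (Hf a) as [H|H]; [|now apply (not_pole_of_holomorphic a f h) in H].
  apply analytic_holomorphic in H. apply nearC'_nearC; [|exact E].
  apply (punctured_limit_unique a h); [|now apply holomorphic_punctured_limit].
  apply (punctured_limit_ext a f); [exact E | now apply holomorphic_punctured_limit].
Qed.

Lemma meromorphic_continuation_spec u :
  (exists Z, is_meromorphic_continuation u Z) ->
  is_meromorphic_continuation u (meromorphic_continuation u).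
Proof. exact (epsilon_spec (inhabits (fun _ : C => RtoC 0)) (is_meromorphic_continuation u)). Qed.

(** [F] is controlled only on the half-plane [Re > M]; this is how formulas of finite expansion
    depth are compared with the continuation selected by choice. *)
Lemma continuation_agrees u Z F M :
  is_meromorphic_continuation u Z ->
  (forall a, M < Re a -> polar_at F a) ->
  (exists c, forall s, c < Re s -> is_series (fun j => u j s) (F s)) ->
  forall a, M < Re a -> nearC' a (fun z => Z z = F z).
Proof.
  intros [HZ [c HcZ]] HF [c' HcF]. apply (polar_identity M (Rmax c c')).
  - intros a _. now apply meromorphic_polar.
  - exact HF.
  - intros z hz. pose proof (Rmax_l c c'). pose proof (Rmax_r c c').
    apply (is_series_C_unique (fun j => u j z)); [apply HcZ | apply HcF]; lra.
Qed.

Lemma continuation_agrees_holomorphic u Z F M :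
  is_meromorphic_continuation u Z ->
  (forall a, M < Re a -> polar_at F a) ->
  (exists c, forall s, c < Re s -> is_series (fun j => u j s) (F s)) ->
  forall a, M < Re a -> holomorphic_at F a -> nearC a (fun z => Z z = F z).
Proof.
  intros HZ HF Hc a Ha Hh. apply meromorphic_eq_holomorphic; [apply HZ | exact Hh|].
  now apply (continuation_agrees u Z F M).
Qed.

Lemma nearC_Re_gt M a : M < Re a -> nearC a (fun z => M < Re z).
Proof.
  intros H. exists (Re a - M). split; [lra|]. intros z Hz.
  pose proof (re_le_Cmod (z - a)%C) as h4.
  replace (Re (z - a)%C) with (Re z - Re a) in h4 by (unfold Re; simpl; ring).
  apply Rabs_le_between in h4. lra.
Qed.

(* Removable singularities are filled in by the punctured limit. *)
Lemma glue_meromorphic (u : nat -> C -> C) (F : nat -> C -> C) (c : R) :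
  (forall L a, - INR L < Re a -> polar_at (F L) a) ->
  (forall L a, c < Re a -> - INR L < Re a -> holomorphic_at (F L) a) ->
  (forall L s, c < Re s -> - INR L < Re s -> is_series (fun j => u j s) (F L s)) ->
  exists Z, is_meromorphic_continuation u Z.
Proof.
  intros HF Hh Hs.
  assert (HL : forall a : C, exists L, - INR L < Re a).
  { intros a. destruct (nfloor_ex (Rabs (Re a)) (Rabs_pos _)) as [L [h1 h2]].
    exists (S L). rewrite S_INR. pose proof (Rle_abs (- Re a)) as h. rewrite Rabs_Ropp in h. lra. }
  (* Far to the right both functions sum the series; the identity theorem carries their agreement
     over the common half-plane. *)
  assert (Hagree : forall L L' a, - INR L < Re a -> - INR L' < Re a ->
             nearC' a (fun z => F L z = F L' z)).
  { intros L L' a h1 h2.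
    apply (polar_identity (Rmax (- INR L) (- INR L')) (Rmax c (Rmax (- INR L) (- INR L')))).
    - intros b hb. apply HF. eapply Rle_lt_trans; [apply Rmax_l|exact hb].
    - intros b hb. apply HF. eapply Rle_lt_trans; [apply Rmax_r|exact hb].
    - intros z hz. pose proof (Rmax_l c (Rmax (- INR L) (- INR L'))).
      pose proof (Rmax_r c (Rmax (- INR L) (- INR L'))).
      pose proof (Rmax_l (- INR L) (- INR L')). pose proof (Rmax_r (- INR L) (- INR L')).
      apply (is_series_C_unique (fun j => u j z)); apply Hs; lra.
    - now apply Rmax_lub_lt. }
  set (la := fun a => proj1_sig (constructive_indefinite_description _ (HL a))).
  assert (Hla : forall a, - INR (la a) < Re a) by (intros a; unfold la; apply proj2_sig).
  set (lim := fun a v => forall eps, 0 < eps -> nearC' a (fun z => Cmod (F (la a) z - v) < eps)).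
  set (Z := fun a => epsilon (inhabits (RtoC 0)) (lim a)).
  assert (HZlim : forall a L h, - INR L < Re a -> holomorphic_at h a ->
            nearC' a (fun z => F L z = h z) -> Z a = h a).
  { intros a L h ha Hhol E.
    assert (Hl : lim a (h a)).
    { unfold lim. apply (punctured_limit_ext a h).
      - eapply nearC'_imp; [|exact (nearC'_and _ _ _ E (Hagree L (la a) a ha (Hla a)))].
        cbv beta. intros z [e1 e2]. congruence.
      - now apply holomorphic_punctured_limit. }
    apply (punctured_limit_unique a (F (la a))); [|exact Hl].
    exact (epsilon_spec (inhabits (RtoC 0)) (lim a) (ex_intro _ _ Hl)). }
  (* At points near [a] but different from it [F L] is holomorphic, so the limit that defines [Z]
     there is its value. *)
  assert (HZnear : forall a L, - INR L < Re a -> nearC' a (fun z => F L z = Z z)).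
  { intros a L ha.
    eapply nearC'_imp; [|exact (nearC'_and _ _ _ (polar_holomorphic_near _ _ (HF L a ha))
        (nearC_nearC' _ _ (nearC_Re_gt _ _ ha)))].
    cbv beta. intros b [hb1 hb2]. symmetry. apply (HZlim b L); auto. }
  exists Z. split.
  - intros a. set (L := la a). pose proof (Hla a : - INR L < Re a) as hL.
    assert (Hrem : forall h, holomorphic_at h a -> nearC' a (fun z => F L z = h z) -> analytic_at Z a).
    { intros h Hhol E. apply holomorphic_analytic, (holomorphic_ext a h); [|exact Hhol].
      apply nearC'_nearC; [symmetry; now apply (HZlim a L)|].
      eapply nearC'_imp; [|exact (nearC'_and _ _ _ E (HZnear a L hL))].
      cbv beta. intros z [e1 e2]. congruence. }
    destruct (HF L a hL) as [m [g [Hg E]]].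
    destruct (holomorphic_dichotomy a g Hg) as [G0|[p [h [Hhol [h0 Eh]]]]].
    + left. apply (Hrem (fun _ => RtoC 0)); [apply holomorphic_const|].
      eapply nearC'_imp; [|exact (nearC'_and _ _ _ E (nearC_nearC' _ _ G0))].
      cbv beta. intros z [-> ->]. unfold Cdiv. cring.
    + pose proof (nearC'_and _ _ _ E (nearC_nearC' _ _ Eh)) as E2.
      (* Near [a], [F L] is [(z - a) ^ p * h / (z - a) ^ m] with [h a] nonzero: removable for
         [m <= p], otherwise a pole of exact order [m - p]. *)
      destruct (le_lt_dec m p) as [hmp|hmp].
      * left. apply (Hrem (fun z => ((z - a) ^ (p - m) * h z)%C)).
        { apply holomorphic_mult; [|exact Hhol].
          apply (holomorphic_pow a (fun z => (z - a)%C)), holomorphic_affine. }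
        destruct E2 as [d [hd E2]]. exists d. split; [exact hd|]. intros z hz Hz.
        destruct (E2 z hz Hz) as [-> ->].
        replace ((z - a) ^ p)%C with ((z - a) ^ (p - m) * (z - a) ^ m)%C
          by (rewrite <- Cpow_add_r; f_equal; lia).
        field. now apply Cpow_minus_neq0.
      * right. exists (m - p)%nat, h. split; [lia|]. split; [now apply holomorphic_analytic|].
        split; [exact h0|]. apply nearC'_locally'.
        destruct (nearC'_and _ _ _ E2 (HZnear a L hL)) as [d [hd E3]].
        exists d. split; [exact hd|]. intros z hz Hz.
        destruct (E3 z hz Hz) as [[e1 e2] e3].
        change (Z z = (h z / (z - a) ^ (m - p))%C). rewrite <- e3, e1, e2.
        replace ((z - a) ^ m)%C with ((z - a) ^ (m - p) * (z - a) ^ p)%C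
          by (rewrite <- Cpow_add_r; f_equal; lia).
        field. split; now apply Cpow_minus_neq0.
  - exists c. intros s hs.
    replace (Z s) with (F (la s) s); [now apply Hs|].
    symmetry. apply (HZlim s (la s) (F (la s))); [apply Hla | now apply Hh|].
    exists 1. split; [lra|]. reflexivity.
Qed.

(** * Exponential and binomial series *)

Lemma Ceq_parts (z w : C) : Re z = Re w -> Im z = Im w -> z = w.
Proof. destruct z, w. simpl. congruence. Qed.

Lemma Cexp_plus z w : Cexp (z + w) = (Cexp z * Cexp w)%C.
Proof.
  unfold Cexp. apply Ceq_parts; unfold Re, Im; simpl; rewrite exp_plus, ?cos_plus, ?sin_plus; ring.
Qed.

Lemma Cexp_0 : Cexp 0 = RtoC 1.
Proof.
  unfold Cexp. apply Ceq_parts; unfold Re, Im; simpl; rewrite exp_0, ?cos_0, ?sin_0; ring.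
Qed.

Lemma Cmod_Cexp z : Cmod (Cexp z) = exp (Re z).
Proof.
  unfold Cexp, Cmod. simpl.
  replace ((exp (Re z) * cos (Im z)) * (exp (Re z) * cos (Im z) * 1) +
     exp (Re z) * sin (Im z) * (exp (Re z) * sin (Im z) * 1))
    with (exp (Re z) * exp (Re z)).
  - apply sqrt_square. left. apply exp_pos.
  - pose proof (sin2_cos2 (Im z)) as h. unfold Rsqr in h.
    replace (exp (Re z) * exp (Re z)) with (exp (Re z) * exp (Re z) *
      (sin (Im z) * sin (Im z) + cos (Im z) * cos (Im z))) by (rewrite h; ring). ring.
Qed.

Lemma Cexp_RtoC x : Cexp (RtoC x) = RtoC (exp x).
Proof.
  unfold Cexp. apply Ceq_parts; unfold Re, Im; simpl; rewrite ?cos_0, ?sin_0; ring.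
Qed.

Lemma Cexp_conj z : Cexp (Cconj z) = Cconj (Cexp z).
Proof.
  unfold Cexp. apply Ceq_parts; unfold Re, Im; simpl; rewrite ?cos_neg, ?sin_neg; ring.
Qed.

Lemma csum_parts (a : nat -> C) n :
  Re (sum_n a n) = sum_n (fun k => Re (a k)) n /\ Im (sum_n a n) = sum_n (fun k => Im (a k)) n.
Proof.
  induction n as [|n [IH1 IH2]].
  - rewrite csum_O, !rsum_O. now split.
  - rewrite csum_S, !rsum_S, <- IH1, <- IH2. now split.
Qed.

Lemma is_series_C_parts (a : nat -> C) (l : C) :
  is_series (fun n => Re (a n)) (Re l) -> is_series (fun n => Im (a n)) (Im l) -> is_series a l.
Proof.
  rewrite !is_series_R_eps, is_series_C_eps. intros H K eps He.
  destruct (H (eps/2)) as [N1 h1]; [lra|]. destruct (K (eps/2)) as [N2 h2]; [lra|].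
  exists (max N1 N2). intros n Hn.
  destruct (csum_parts a n) as [E1 E2].
  eapply Rle_lt_trans; [apply Cmod_2Rmax|].
  change (fst (sum_n a n - l)%C) with (Re (sum_n a n) - Re l).
  change (snd (sum_n a n - l)%C) with (Im (sum_n a n) - Im l).
  rewrite E1, E2. specialize (h1 n ltac:(lia)). specialize (h2 n ltac:(lia)).
  pose proof sqrt2_bound.
  assert (Rmax (Rabs (sum_n (fun k => Re (a k)) n - Re l)) (Rabs (sum_n (fun k => Im (a k)) n - Im l)) < eps/2)
    by (apply Rmax_lub_lt; assumption).
  nra.
Qed.

Lemma is_series_Re_Im (a : nat -> C) (l : C) :
  is_series a l -> is_series (fun n => Re (a n)) (Re l) /\ is_series (fun n => Im (a n)) (Im l).
Proof.
  rewrite !is_series_R_eps, is_series_C_eps. intros H.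
  split; intros eps He; destruct (H eps He) as [N HN]; exists N; intros n Hn;
    specialize (HN n Hn); destruct (csum_parts a n) as [E1 E2]; eapply Rle_lt_trans; [|exact HN| |exact HN];
    pose proof (Rmax_Cmod (sum_n a n - l)%C) as h;
    change (fst (sum_n a n - l)%C) with (Re (sum_n a n) - Re l) in h;
    change (snd (sum_n a n - l)%C) with (Im (sum_n a n) - Im l) in h;
    rewrite E1, E2 in h.
  - eapply Rle_trans; [apply Rmax_l | exact h].
  - eapply Rle_trans; [apply Rmax_r | exact h].
Qed.

(** * Power series on a real interval as solutions of linear differential equations *)

Definition curve_derive (y : R -> C) (t : R) (l : C) : Prop :=
  is_derive (fun x => Re (y x)) t (Re l) /\ is_derive (fun x => Im (y x)) t (Im l).

Lemma curve_derive_mult y w t l m :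
  curve_derive y t l -> curve_derive w t m ->
  curve_derive (fun x => (y x * w x)%C) t (l * w t + y t * m)%C.
Proof.
  intros [H1 H2] [K1 K2]. split.
  - change (is_derive (fun x => Re (y x) * Re (w x) - Im (y x) * Im (w x)) t
      ((Re l * Re (w t) - Im l * Im (w t)) + (Re (y t) * Re m - Im (y t) * Im m))).
    replace ((Re l * Re (w t) - Im l * Im (w t)) + (Re (y t) * Re m - Im (y t) * Im m))
      with ((Re l * Re (w t) + Re (y t) * Re m) - (Im l * Im (w t) + Im (y t) * Im m)) by ring.
    apply (is_derive_minus (fun x => Re (y x) * Re (w x)) (fun x => Im (y x) * Im (w x))).
    + apply (is_derive_mult (fun x => Re (y x)) (fun x => Re (w x))); auto. intros; apply Rmult_comm.
    + apply (is_derive_mult (fun x => Im (y x)) (fun x => Im (w x))); auto. intros; apply Rmult_comm.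
  - change (is_derive (fun x => Re (y x) * Im (w x) + Im (y x) * Re (w x)) t
      ((Re l * Im (w t) + Im l * Re (w t)) + (Re (y t) * Im m + Im (y t) * Re m))).
    replace ((Re l * Im (w t) + Im l * Re (w t)) + (Re (y t) * Im m + Im (y t) * Re m))
      with ((Re l * Im (w t) + Re (y t) * Im m) + (Im l * Re (w t) + Im (y t) * Re m)) by ring.
    apply (is_derive_plus (fun x => Re (y x) * Im (w x)) (fun x => Im (y x) * Re (w x))).
    + apply (is_derive_mult (fun x => Re (y x)) (fun x => Im (w x))); auto. intros; apply Rmult_comm.
    + apply (is_derive_mult (fun x => Im (y x)) (fun x => Re (w x))); auto. intros; apply Rmult_comm.
Qed.

Lemma is_derive_zero_const (f : R -> R) (r : R) :
  (forall t, Rabs t < r -> is_derive f t 0) -> forall t, Rabs t < r -> f t = f 0.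
Proof.
  intros H t Ht.
  destruct (MVT_gen f 0 t (fun _ => 0)) as [c [_ hc]].
  - intros x hx. apply H. unfold Rmin, Rmax in hx. destruct (Rle_dec 0 t);
    apply Rabs_def1; apply Rabs_def2 in Ht; lra.
  - intros x hx. apply continuity_pt_filterlim. apply (ex_derive_continuous f).
    exists 0. apply H. unfold Rmin, Rmax in hx. destruct (Rle_dec 0 t);
    apply Rabs_def1; apply Rabs_def2 in Ht; lra.
  - lra.
Qed.

Lemma curve_derive_zero_const (y : R -> C) (r : R) :
  (forall t, Rabs t < r -> curve_derive y t 0) -> forall t, Rabs t < r -> y t = y 0.
Proof.
  intros H t Ht. apply Ceq_parts.
  - apply (is_derive_zero_const (fun x => Re (y x)) r); [intros; now apply H | exact Ht].
  - apply (is_derive_zero_const (fun x => Im (y x)) r); [intros; now apply H | exact Ht].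
Qed.

Lemma Rabs_Im_le (z : C) : Rabs (Im z) <= Cmod z.
Proof. eapply Rle_trans; [apply Rmax_r | apply (Rmax_Cmod z)]. Qed.

Lemma real_pseries_derive (b : nat -> R) (r M : R) :
  0 < r -> (forall n, sum_n (fun k => Rabs (b k) * r ^ k) n <= M) ->
  forall t, Rabs t < r ->
  is_derive (PSeries b) t (PSeries (PS_derive b) t) /\
  is_series (fun k => b k * t ^ k) (PSeries b t) /\
  is_series (fun k => INR (S k) * b (S k) * t ^ k) (PSeries (PS_derive b) t).
Proof.
  intros hr HM t ht.
  assert (hcv : Rbar_lt (Finite (Rabs t)) (CV_radius b)).
  { apply Rbar_lt_le_trans with (Finite r); [exact ht|].
    apply (proj1 (CV_radius_bounded b)). exists M. intros n.
    eapply Rle_trans; [|apply (HM n)].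
    rewrite Rabs_mult, (Rabs_pos_eq (r ^ n)) by (apply pow_le; lra).
    apply (term_le_rsum (fun k => Rabs (b k) * r ^ k)).
    intros k. apply Rmult_le_pos; [apply Rabs_pos | apply pow_le; lra]. }
  split; [now apply is_derive_PSeries|]. split.
  - apply is_pseries_R. apply PSeries_correct. apply CV_radius_inside. exact hcv.
  - apply (is_pseries_R (PS_derive b)). apply PSeries_correct. apply CV_radius_inside.
    rewrite CV_radius_derive. exact hcv.
Qed.

Lemma complex_pseries_derive (c : nat -> C) (r M : R) :
  0 < r -> (forall n, sum_n (fun k => Cmod (c k) * r ^ k) n <= M) ->
  exists E D : R -> C, forall t, Rabs t < r ->
    curve_derive E t (D t) /\ is_series (fun k => (c k * RtoC t ^ k)%C) (E t) /\
    is_series (fun k => (RtoC (INR (S k)) * c (S k) * RtoC t ^ k)%C) (D t).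
Proof.
  intros hr HM.
  set (x := fun k => Re (c k)). set (y := fun k => Im (c k)).
  exists (fun t => (PSeries x t, PSeries y t)), (fun t => (PSeries (PS_derive x) t, PSeries (PS_derive y) t)).
  intros t ht.
  destruct (real_pseries_derive x r M hr) with (t := t) as [X1 [X2 X3]]; [|exact ht|].
  { intros n. eapply Rle_trans; [|apply (HM n)]. apply rsum_le. intros k _.
    apply Rmult_le_compat_r; [apply pow_le; lra | apply re_le_Cmod]. }
  destruct (real_pseries_derive y r M hr) with (t := t) as [Y1 [Y2 Y3]]; [|exact ht|].
  { intros n. eapply Rle_trans; [|apply (HM n)]. apply rsum_le. intros k _.
    apply Rmult_le_compat_r; [apply pow_le; lra | apply Rabs_Im_le]. }
  split; [now split|].
  split; apply is_series_C_parts; simpl.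
  - eapply is_series_ext; [|exact X2]. intros k. rewrite <- RtoC_pow. unfold Re, x; simpl. unfold Re. ring.
  - eapply is_series_ext; [|exact Y2]. intros k. rewrite <- RtoC_pow. unfold Re, Im, y; simpl. unfold Im. ring.
  - eapply is_series_ext; [|exact X3]. intros k. rewrite <- RtoC_pow. unfold Re, x; simpl. unfold Re. ring.
  - eapply is_series_ext; [|exact Y3]. intros k. rewrite <- RtoC_pow. unfold Re, Im, y; simpl. unfold Im. ring.
Qed.

Lemma Cexp_curve_derive w (g : R -> R) (t l : R) :
  is_derive g t l -> curve_derive (fun x => Cexp (w * RtoC (g x))) t (w * RtoC l * Cexp (w * RtoC (g t)))%C.
Proof.
  intros H. unfold curve_derive, Cexp. unfold Re, Im. simpl. split.
  - auto_derive; [repeat split; exists l; exact H|].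
    replace (Derive (fun x => g x) t) with l by (symmetry; apply is_derive_unique; exact H). unfold Rminus. rring.
  - auto_derive; [repeat split; exists l; exact H|].
    replace (Derive (fun x => g x) t) with l by (symmetry; apply is_derive_unique; exact H). unfold Rminus. rring.
Qed.

(** The hypothesis on [E] and [D] is the equation [y' = w g' y] at the level of series. The sum
    multiplied by [Cexp (- w * g t)] has derivative zero and is 1 at 0. The exponential and the
    binomial series are both instances. *)
Lemma curve_ode (c : nat -> C) (r M : R) (w : C) (g g' : R -> R) :
  0 < r -> (forall n, sum_n (fun k => Cmod (c k) * r ^ k) n <= M) ->
  (forall t, Rabs t < r -> is_derive g t (g' t)) -> g 0 = 0 -> c 0%nat = RtoC 1 ->
  (forall t (E D : C), Rabs t < r -> is_series (fun k => (c k * RtoC t ^ k)%C) E ->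
     is_series (fun k => (RtoC (INR (S k)) * c (S k) * RtoC t ^ k)%C) D -> D = (w * RtoC (g' t) * E)%C) ->
  forall t, Rabs t < r -> is_series (fun k => (c k * RtoC t ^ k)%C) (Cexp (w * RtoC (g t))).
Proof.
  intros hr HM Hg g0 c0 Hode t ht.
  destruct (complex_pseries_derive c r M hr HM) as [E [D H]].
  assert (K : forall t, Rabs t < r -> (E t * Cexp (- w * RtoC (g t)))%C = RtoC 1).
  { intros u hu.
    assert (E0 : E 0 = RtoC 1).
    { apply (is_series_C_unique (fun k => (c k * RtoC 0 ^ k)%C)).
      - apply H. rewrite Rabs_R0. exact hr.
      - apply is_series_C_first; [intros k|]; simpl; rewrite ?c0; cring. }
    rewrite (curve_derive_zero_const (fun t => (E t * Cexp (- w * RtoC (g t)))%C) r); [|clear u hu|exact hu].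
    - rewrite E0, g0. replace (- w * 0)%C with (RtoC 0) by cring. rewrite Cexp_0. cring.
    - intros u hu. destruct (H u hu) as [h1 [h2 h3]].
      replace (RtoC 0) with (D u * Cexp (- w * RtoC (g u)) + E u * (- w * RtoC (g' u) * Cexp (- w * RtoC (g u))))%C.
      + apply curve_derive_mult; [exact h1|]. apply Cexp_curve_derive. now apply Hg.
      + rewrite (Hode u (E u) (D u) hu h2 h3). cring. }
  replace (Cexp (w * RtoC (g t))) with (E t); [now apply H|].
  transitivity (E t * (Cexp (- w * RtoC (g t)) * Cexp (w * RtoC (g t))))%C.
  - rewrite <- Cexp_plus. replace (- w * RtoC (g t) + w * RtoC (g t))%C with (RtoC 0) by cring.
    rewrite Cexp_0. cring.
  - rewrite Cmult_assoc, (K t ht). cring.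
Qed.

Lemma exp_sum_le x n : 0 <= x -> sum_n (fun k => x ^ k / INR (fact k)) n <= exp x.
Proof.
  intros hx. apply is_series_R_le.
  - intros k. apply Rmult_le_pos; [now apply pow_le|]. left. apply Rinv_0_lt_compat, INR_fact_lt_0.
  - pose proof (is_exp_Reals x) as h. apply is_pseries_R in h.
    eapply is_series_ext; [|exact h]. intros k. simpl. unfold Rdiv. ring.
Qed.

Lemma is_series_Cexp z : is_series (fun k => (z ^ k / RtoC (INR (fact k)))%C) (Cexp z).
Proof.
  assert (fnz : forall k, RtoC (INR (fact k)) <> RtoC 0).
  { intros k e. apply RtoC_inj in e. pose proof (INR_fact_lt_0 k). lra. }
  replace (Cexp z) with (Cexp (z * RtoC 1)) by (f_equal; cring).
  (* [Cexp z] is the end point of the curve [Cexp (z * t)] at [t = 1]; the radius 2 leaves room for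
     it. *)
  eapply is_series_C_ext; [|apply (curve_ode (fun k => (z ^ k / RtoC (INR (fact k)))%C) 2 (exp (Cmod z * 2)) z (fun t => t) (fun _ => 1))].
  - intros k. simpl. rewrite Cpow_1_l. cring.
  - lra.
  - intros n. eapply Rle_trans; [|apply (exp_sum_le (Cmod z * 2) n)].
    + apply rsum_le. intros k _. rewrite Cmod_div by apply fnz.
      rewrite Cmod_pow, Cmod_R, Rabs_pos_eq, Rpow_mult_distr by (left; apply INR_fact_lt_0).
      right. field. apply INR_fact_neq_0.
    + apply Rmult_le_pos; [apply Cmod_ge_0 | lra].
  - intros t _. exact (is_derive_id (K := R_AbsRing) t).
  - reflexivity.
  - simpl. field.
  - intros t E D _ HE HD. apply (is_series_C_unique _ _ _ HD).
    eapply is_series_C_ext; [|apply (is_series_C_scal (z * RtoC 1)%C _ _ HE)].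
    intros k. cbv beta. rewrite fact_simpl, mult_INR, RtoC_mult. simpl (z ^ S k)%C. field.
    split; [apply fnz|]. intros e. apply RtoC_inj in e. apply (not_0_INR (S k)) in e; lia.
  - rewrite Rabs_pos_eq; lra.
Qed.

Lemma wiener_coef_Cexp_lin a r w :
  0 <= r -> wiener_coef a r (fun s => Cexp (w * s)) (exp (Re (w * a)) * exp (Cmod w * r))
              (fun k => (Cexp (w * a) * (w ^ k / RtoC (INR (fact k))))%C).
Proof.
  intros hr.
  assert (fnz : forall k, RtoC (INR (fact k)) <> RtoC 0).
  { intros k e. apply RtoC_inj in e. pose proof (INR_fact_lt_0 k). lra. }
  split.
  - intros n. apply Rle_trans with (exp (Re (w * a)) * sum_n (fun k => (Cmod w * r) ^ k / INR (fact k)) n).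
    + rewrite <- rsum_mult_l. apply rsum_le. intros k _.
      rewrite Cmod_mult, Cmod_Cexp, Cmod_div, Cmod_pow, Cmod_R, Rabs_pos_eq, Rpow_mult_distr
        by (try (left; apply INR_fact_lt_0); apply fnz).
      right. field. apply INR_fact_neq_0.
    + apply Rmult_le_compat_l; [left; apply exp_pos|]. apply exp_sum_le.
      apply Rmult_le_pos; [apply Cmod_ge_0 | exact hr].
  - intros z _. replace (w * z)%C with (w * a + w * (z - a))%C by cring. rewrite Cexp_plus.
    eapply is_series_C_ext; [|apply is_series_C_scal, is_series_Cexp].
    intros k. simpl. rewrite Cpow_mult_l. field. apply fnz.
Qed.

Lemma wiener_Cexp_lin a r w :
  0 <= r -> wiener a r (fun s => Cexp (w * s)) (exp (Re (w * a)) * exp (Cmod w * r)).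
Proof. intros hr. eexists. now apply wiener_coef_Cexp_lin. Qed.

Lemma is_derive_Cexp_lin w a : is_derive (fun s => Cexp (w * s)) a (w * Cexp (w * a))%C.
Proof.
  replace (w * Cexp (w * a))%C with (Cexp (w * a) * (w ^ 1 / RtoC (INR (fact 1))))%C
    by (simpl; field).
  apply (wiener_coef_is_derive a 1 _ _ _ Rlt_0_1 (wiener_coef_Cexp_lin a 1 w Rle_0_1)).
Qed.

(* Coefficients of the binomial series [(1 - u) ^ (- a) = \sum_k (a)_k / k! u ^ k]. *)
Fixpoint rising (a : C) (k : nat) : C :=
  match k with
  | O => RtoC 1
  | S j => (rising a j * (a + RtoC (INR j)) / RtoC (INR (S j)))%C
  end.

Fixpoint risingR (a : R) (k : nat) : R :=
  match k with
  | O => 1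
  | S j => risingR a j * (a + INR j) / INR (S j)
  end.

Lemma INR_S_neq0 k : INR (S k) <> 0.
Proof. apply not_0_INR. lia. Qed.

Lemma INR_S_pos k : 0 < INR (S k).
Proof. apply lt_0_INR. lia. Qed.

Lemma CINR_S_neq0 k : RtoC (INR (S k)) <> RtoC 0.
Proof. intros e. apply RtoC_inj in e. now apply INR_S_neq0 in e. Qed.

Lemma risingR_pos a k : 0 < a -> 0 < risingR a k.
Proof.
  intros ha. induction k as [|k IH]; [simpl; lra|].
  change (0 < risingR a k * (a + INR k) / INR (S k)).
  pose proof (INR_S_pos k). pose proof (pos_INR k).
  apply Rdiv_lt_0_compat; [|assumption]. apply Rmult_lt_0_compat; lra.
Qed.

Lemma Cmod_rising_le a A k : Cmod a <= A -> Cmod (rising a k) <= risingR A k.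
Proof.
  intros h. induction k as [|k IH]; [simpl; rewrite Cmod_1; lra|].
  change (Cmod (rising a k * (a + RtoC (INR k)) / RtoC (INR (S k))) <= risingR A k * (A + INR k) / INR (S k)).
  pose proof (INR_S_pos k).
  rewrite Cmod_div, Cmod_mult, Cmod_R, (Rabs_pos_eq (INR (S k))) by (try apply CINR_S_neq0; lra).
  apply Rmult_le_compat_r; [left; now apply Rinv_0_lt_compat|].
  apply Rmult_le_compat; try apply Cmod_ge_0; [exact IH|].
  eapply Rle_trans; [apply Cmod_triangle|]. rewrite Cmod_R, Rabs_pos_eq by apply pos_INR. lra.
Qed.

Lemma risingR_series a r : 0 < a -> 0 < r < 1 ->
  exists B, forall n, sum_n (fun k => risingR a k * r ^ k) n <= B.
Proof.
  intros ha hr.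
  assert (hpos : forall k, 0 < risingR a k * r ^ k).
  { intros k. apply Rmult_lt_0_compat; [now apply risingR_pos | apply pow_lt; lra]. }
  destruct (ex_series_DAlembert (fun k => risingR a k * r ^ k) r) as [l Hl].
  - lra.
  - intros n. specialize (hpos n). lra.
  - apply (is_lim_seq_ext (fun n => r + (a - 1) * r * / INR (S n))).
    + intros n. rewrite Rabs_pos_eq by (left; apply Rdiv_lt_0_compat; apply hpos).
      change (risingR a (S n)) with (risingR a n * (a + INR n) / INR (S n)).
      change (r ^ S n) with (r * r ^ n).
      pose proof (risingR_pos a n ha). pose proof (pow_lt r n ltac:(lra)).
      pose proof (INR_S_neq0 n). rewrite S_INR in *. field. repeat split; lra.
    + replace (Finite r) with (Finite (r + (a - 1) * r * 0)) by (f_equal; ring).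
      apply is_lim_seq_plus'; [apply is_lim_seq_const|].
      apply is_lim_seq_mult'; [apply is_lim_seq_const|].
      apply (is_lim_seq_incr_1 (fun n => / INR n)).
      apply (is_lim_seq_inv INR p_infty); [apply is_lim_seq_INR | discriminate].
  - exists l. intros n. apply is_series_R_le; [intros k; left; apply hpos|].
    eapply is_series_ext; [|exact Hl]. intros k. simpl. apply Rabs_pos_eq. left. apply hpos.
Qed.

(** The recursion [(k + 1) c_(k+1) = (a + k) c_k] amounts to [(1 - t) D = a E], the equation of
    [curve_ode] for [g t = - ln (1 - t)]. *)
Lemma is_series_rising (a : C) (u : R) : Rabs u < 1 ->
  is_series (fun k => (rising a k * RtoC u ^ k)%C) (Rcpow (1 - u) (- a)).
Proof.
  intros hu. set (r := (Rabs u + 1) / 2). pose proof (Rabs_pos u).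
  assert (hr : 0 < r < 1) by (unfold r; lra).
  destruct (risingR_series (Cmod a + 1) r) as [B HB]; [pose proof (Cmod_ge_0 a); lra | exact hr|].
  unfold Rcpow. replace (- a * RtoC (ln (1 - u)))%C with (a * RtoC (- ln (1 - u)))%C by (rewrite RtoC_opp; cring).
  apply (curve_ode (rising a) r B a (fun t => - ln (1 - t)) (fun t => / (1 - t))).
  - lra.
  - intros n. eapply Rle_trans; [|apply (HB n)]. apply rsum_le. intros k _.
    apply Rmult_le_compat_r; [apply pow_le; lra|]. apply Cmod_rising_le. lra.
  - intros t ht. apply Rabs_def2 in ht. auto_derive; [lra|]. field. lra.
  - rewrite Rminus_0_r, ln_1. ring.
  - reflexivity.
  - intros t E D ht HE HD. apply Rabs_def2 in ht.
    assert (ht1 : RtoC (1 - t) <> RtoC 0) by (intros e; apply RtoC_inj in e; lra).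
    assert (HtD : is_series (fun k => (RtoC (INR k) * rising a k * RtoC t ^ k)%C) (RtoC t * D)%C).
    { replace (RtoC t * D)%C with ((fun k => (RtoC (INR k) * rising a k * RtoC t ^ k)%C) 0%nat + RtoC t * D)%C
        by (simpl; cring).
      apply is_series_C_shift. eapply is_series_C_ext; [|apply (is_series_C_scal (RtoC t) _ _ HD)].
      intros k. cbv beta. simpl (_ ^ S k)%C. cring. }
    assert (ED : D = (a * E + RtoC t * D)%C).
    { apply (is_series_C_unique _ _ _ HD).
      eapply is_series_C_ext; [|apply is_series_C_plus; [apply (is_series_C_scal a _ _ HE) | exact HtD]].
      intros k. cbv beta.
      change (rising a (S k)) with (rising a k * (a + RtoC (INR k)) / RtoC (INR (S k)))%C.
      field. apply CINR_S_neq0. }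
    assert (ED' : (RtoC (1 - t) * D = a * E)%C).
    { rewrite RtoC_minus. transitivity (D - RtoC t * D)%C; [cring|]. rewrite ED at 1. cring. }
    rewrite RtoC_inv by lra. transitivity ((RtoC (1 - t) * D) / RtoC (1 - t))%C; [field; exact ht1|].
    rewrite ED'. unfold Cdiv. cring.
  - unfold r. lra.
Qed.

(** Each factor [p s + q + j] has norm at most [A + j], where [A] is the first argument of
    [risingR]; the summand 1 in [A] keeps all the majorants positive. *)
Lemma wiener_rising a r k (p : R) (q : C) :
  0 < r -> 0 <= p ->
  wiener a r (fun s => rising (RtoC p * s + q) k) (risingR (p * (r + Cmod a) + Cmod q + 1) k).
Proof.
  intros hr hp. set (A := p * (r + Cmod a) + Cmod q + 1).
  assert (hA : 0 < A).
  { unfold A. pose proof (Cmod_ge_0 a). pose proof (Cmod_ge_0 q).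
    assert (0 <= p * (r + Cmod a)) by (apply Rmult_le_pos; lra). lra. }
  induction k as [|k IH].
  - simpl. eapply wiener_mono; [|apply (wiener_const a r 1)]. rewrite Cmod_1. lra.
  - pose proof (INR_S_pos k).
    apply (wiener_ext a r (fun s => ((rising (RtoC p * s + q) k * (RtoC p * (s - 0) + (q + RtoC (INR k)))) * / RtoC (INR (S k)))%C)).
    { intros z _. change (rising (RtoC p * z + q) (S k)) with
        (rising (RtoC p * z + q) k * (RtoC p * z + q + RtoC (INR k)) / RtoC (INR (S k)))%C.
      field. apply CINR_S_neq0. }
    eapply wiener_mono; [|apply wiener_mult; [exact hr| |apply wiener_const]; apply wiener_mult; [exact hr|exact IH|];
      apply wiener_plus; [lra| apply wiener_scal, wiener_affine; lra | apply wiener_const]].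
    rewrite Cmod_inv, !Cmod_R, (Rabs_pos_eq p), (Rabs_pos_eq (INR (S k))) by (try apply CINR_S_neq0; lra).
    change (risingR A (S k)) with (risingR A k * (A + INR k) / INR (S k)).
    apply Rmult_le_compat_r; [left; now apply Rinv_0_lt_compat|].
    apply Rmult_le_compat_l; [left; now apply risingR_pos|].
    replace (a - 0)%C with a by cring.
    pose proof (Cmod_triangle q (RtoC (INR k))) as h. rewrite Cmod_R, Rabs_pos_eq in h by apply pos_INR.
    unfold A. lra.
Qed.

(** * Complex powers of positive reals *)

Lemma Rcpow_plus x s t : Rcpow x (s + t) = (Rcpow x s * Rcpow x t)%C.
Proof. unfold Rcpow. rewrite <- Cexp_plus. f_equal. cring. Qed.

Lemma Rcpow_0 x : Rcpow x 0 = RtoC 1.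
Proof. unfold Rcpow. replace (0 * RtoC (ln x))%C with (RtoC 0) by cring. apply Cexp_0. Qed.

Lemma Rcpow_mult_base x y s : 0 < x -> 0 < y -> Rcpow (x * y) s = (Rcpow x s * Rcpow y s)%C.
Proof.
  intros hx hy. unfold Rcpow. rewrite ln_mult, <- Cexp_plus by assumption. f_equal.
  rewrite RtoC_plus. cring.
Qed.

Lemma Rcpow_RtoC x y : Rcpow x (RtoC y) = RtoC (Rpower x y).
Proof. unfold Rcpow. rewrite <- RtoC_mult, Cexp_RtoC. reflexivity. Qed.

Lemma Rcpow_INR x k : 0 < x -> Rcpow x (RtoC (INR k)) = RtoC (x ^ k).
Proof. intros hx. now rewrite Rcpow_RtoC, Rpower_pow. Qed.

Lemma Cmod_Rcpow x s : Cmod (Rcpow x s) = Rpower x (Re s).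
Proof.
  unfold Rcpow. rewrite Cmod_Cexp. unfold Rpower. f_equal. unfold Re; simpl. ring.
Qed.

Lemma Rcpow_conj x s : Rcpow x (Cconj s) = Cconj (Rcpow x s).
Proof.
  unfold Rcpow. rewrite <- Cexp_conj. f_equal.
  rewrite Cmult_conj. f_equal. unfold Cconj, RtoC; simpl. f_equal. ring.
Qed.

(** The bound is the modulus at the leftmost point [a - r] of the disc. The parameters [p] and [q]
    cover both [s] itself and the exponents [2 s - 2 m] on the sphere. *)
Lemma wiener_Rcpow a r x (p q : R) :
  1 <= x -> 0 <= p -> 0 <= r ->
  wiener a r (fun s => Rcpow x (- (RtoC p * s - RtoC q))) (Rpower x (q - p * Re a + p * r)).
Proof.
  intros hx hp hr.
  assert (hl : 0 <= ln x) by (rewrite <- ln_1; apply ln_le; lra).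
  apply (wiener_ext a r (fun s => (Rcpow x (RtoC q) * Cexp (RtoC (- p * ln x) * s))%C)).
  { intros z _. unfold Rcpow. rewrite <- Cexp_plus. f_equal. rewrite RtoC_mult, RtoC_opp. cring. }
  eapply wiener_mono; [|apply wiener_scal, wiener_Cexp_lin; exact hr].
  right. rewrite Cmod_Rcpow, Cmod_R. unfold Rpower.
  rewrite Rabs_left1.
  - rewrite <- !exp_plus. f_equal. unfold Re; simpl. ring.
  - rewrite <- Ropp_mult_distr_l. apply Ropp_le_cancel. rewrite Ropp_0, Ropp_involutive. now apply Rmult_le_pos.
Qed.

Lemma holomorphic_Rcpow x c b a : holomorphic_at (fun s => Rcpow x (c * s + b)) a.
Proof.
  apply (holomorphic_ext a (fun s => (Rcpow x b * Cexp ((c * RtoC (ln x)) * s))%C)).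
  - exists 1. split; [lra|]. intros z _. unfold Rcpow. rewrite <- Cexp_plus. f_equal. cring.
  - apply holomorphic_scal. eapply (wiener_holomorphic a 1); [lra|]. apply wiener_Cexp_lin. lra.
Qed.

(** Comparison with the telescoping differences of [2 / sqrt x]. The exponent [3/2], here and in the
    convergence conditions below, is a convenient number beyond 1. *)
Lemma sum_inv_three_halves n :
  sum_n (fun j => Rpower (INR (S j)) (- (3/2))) n <= 3.
Proof.
  assert (E : forall x, 0 < x -> Rpower x (- (3/2)) = / (x * sqrt x)).
  { intros x hx. rewrite Rpower_Ropp. f_equal.
    replace (3/2) with (1 + /2) by lra. rewrite Rpower_plus, Rpower_1, Rpower_sqrt by exact hx. reflexivity. }
  assert (H : sum_n (fun j => Rpower (INR (S j)) (- (3/2))) n <= 3 - 2 / sqrt (INR (S n))).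
  { induction n as [|n IH].
    - rewrite rsum_O. change (INR 1) with 1. rewrite E, sqrt_1 by lra. lra.
    - rewrite rsum_S. pose proof (INR_S_pos n) as hx. set (x := INR (S n)) in *.
      assert (ex : INR (S (S n)) = x + 1) by (rewrite S_INR; reflexivity). rewrite ex.
      rewrite (E (x + 1)) by lra.
      assert (hy : 0 < sqrt x) by now apply sqrt_lt_R0.
      assert (hz : sqrt x < sqrt (x + 1)) by (apply sqrt_lt_1; lra).
      assert (ey : sqrt x * sqrt x = x) by (apply sqrt_sqrt; lra).
      assert (ez : sqrt (x + 1) * sqrt (x + 1) = x + 1) by (apply sqrt_sqrt; lra).
      set (y := sqrt x) in *. set (z := sqrt (x + 1)) in *.
      assert (h : / ((x + 1) * z) <= 2 / y - 2 / z).
      { rewrite <- ez. replace (2 / y - 2 / z) with (2 / (y * z * (z + y))).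
        - replace (/ (z * z * z)) with (2 / (2 * (z * z * z))) by (field; lra).
          apply Rmult_le_compat_l; [lra|]. apply Rinv_le_contravar.
          + apply Rmult_lt_0_compat; [apply Rmult_lt_0_compat|]; lra.
          + replace (2 * (z * z * z)) with (z * z * (2 * z)) by ring.
            apply Rmult_le_compat; try nra.
        - replace (2 / y - 2 / z) with (2 * (z - y) / (y * z)) by (field; lra).
          assert (e1 : (z - y) * (z + y) = 1) by nra.
          replace (2 * (z - y)) with (2 * ((z - y) * (z + y)) / (z + y)) by (field; lra).
          rewrite e1. field. lra. }
      lra. }
  assert (0 < 2 / sqrt (INR (S n))); [|lra].
  apply Rdiv_lt_0_compat; [lra|]. apply sqrt_lt_R0, INR_S_pos.
Qed.

Lemma Rpower_le_three_halves j J y :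
  y <= - (3/2) -> Rpower (INR (S j + J)) y <= Rpower (INR (S j)) (- (3/2)).
Proof.
  intros hy. unfold Rpower.
  assert (h1 : 1 <= INR (S j)) by (replace 1 with (INR 1) by reflexivity; apply le_INR; lia).
  assert (h2 : INR (S j) <= INR (S j + J)) by (apply le_INR; lia).
  assert (h3 : 0 <= ln (INR (S j))) by (rewrite <- ln_1; apply ln_le; lra).
  assert (h4 : ln (INR (S j)) <= ln (INR (S j + J))) by (apply ln_le; lra).
  assert (h5 : y * ln (INR (S j + J)) <= - (3/2) * ln (INR (S j))) by nra.
  destruct (Rle_lt_or_eq_dec _ _ h5) as [h|h]; [left; now apply exp_increasing | rewrite h; lra].
Qed.

(** * Dirichlet series with analytic coefficients *)

Definition C_series (a : nat -> C) : C :=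
  epsilon (inhabits (RtoC 0)) (fun l : C => is_series a l).

Lemma C_series_correct (a : nat -> C) : (exists l : C, is_series a l) -> is_series a (C_series a).
Proof. exact (epsilon_spec (inhabits (RtoC 0)) (fun l : C => is_series a l)). Qed.

Lemma C_series_unique (a : nat -> C) (l : C) : is_series a l -> C_series a = l.
Proof.
  intros H. apply (is_series_C_unique a); [|exact H]. apply C_series_correct. now exists l.
Qed.

Definition normal_series (a : C) (r : R) (f : nat -> C -> C) (F : C -> C) : Prop :=
  exists (N : nat -> R) (M : R),
    (forall j, wiener a r (f j) (N j)) /\ (forall n, sum_n N n <= M) /\
    forall z, Cmod (z - a) <= r -> is_series (fun j => f j z) (F z).

Lemma wiener_bounds_converge a r (f : nat -> C -> C) (N : nat -> R) M z :
  (forall j, wiener a r (f j) (N j)) -> (forall n, sum_n N n <= M) ->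
  Cmod (z - a) <= r -> is_series (fun j => f j z) (C_series (fun j => f j z)).
Proof.
  intros Hf HM Hz. apply C_series_correct. apply (bounded_ex_series_C _ M).
  intros n. eapply Rle_trans; [|apply (HM n)]. apply rsum_le. intros j _.
  now apply (wiener_le a r (f j)).
Qed.

Lemma normal_series_intro a r (f : nat -> C -> C) (N : nat -> R) M :
  (forall j, wiener a r (f j) (N j)) -> (forall n, sum_n N n <= M) ->
  normal_series a r f (fun z => C_series (fun j => f j z)).
Proof.
  intros Hf HM. exists N, M. repeat split; auto. intros z Hz.
  now apply (wiener_bounds_converge a r f N M).
Qed.

Lemma normal_series_holomorphic a r f F : 0 < r -> normal_series a r f F -> holomorphic_at F a.
Proof.
  intros hr [N [M [H1 [H2 H3]]]]. exists r, M. split; [exact hr|].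
  now apply (wiener_series a r f N).
Qed.

(** The coefficient of index 1 of the sum is the sum of the coefficients of index 1, and these are
    the derivatives at the centre. *)
Lemma normal_series_derive a r f F (d : nat -> C) :
  0 < r -> normal_series a r f F -> (forall j, is_derive (f j) a (d j)) ->
  exists D : C, is_derive F a D /\ is_series d D.
Proof.
  intros hr [N [M [H1 [H2 H3]]]] Hd.
  set (c := fun j => proj1_sig (constructive_indefinite_description _ (H1 j))).
  assert (Hc : forall j, wiener_coef a r (f j) (N j) (c j)) by (intros j; unfold c; apply proj2_sig).
  destruct (wiener_coef_series a r f N M c F hr Hc H2 H3) as [T [HT HS]].
  exists (T 1%nat). split; [now apply (wiener_coef_is_derive a r F M)|].
  eapply is_series_C_ext; [|apply (HS 1%nat)]. intros j. cbv beta.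
  rewrite <- (is_C_derive_unique (f j) a (c j 1%nat)); [|now apply (wiener_coef_is_derive a r (f j) (N j))].
  now apply is_C_derive_unique.
Qed.

Fixpoint psum (a : nat -> C) (L : nat) : C :=
  match L with O => RtoC 0 | S l => (psum a l + a l)%C end.

Lemma psum_ext (a b : nat -> C) L : (forall l, (l < L)%nat -> a l = b l) -> psum a L = psum b L.
Proof.
  intros H. induction L as [|L IH]; [reflexivity|]. simpl. rewrite IH, H; auto.
Qed.

Lemma is_series_C_psum (u : nat -> nat -> C) (v : nat -> C) L :
  (forall l, (l < L)%nat -> is_series (fun j => u j l) (v l)) -> is_series (fun j => psum (u j) L) (psum v L).
Proof.
  intros H. induction L as [|L IH]; [apply is_series_C_0|]. simpl.
  apply is_series_C_plus; [apply IH; auto | apply H; lia].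
Qed.

Lemma is_series_C_tail (a : nat -> C) (l : C) L :
  is_series a l -> is_series (fun k => a (L + k)%nat) (l - psum a L)%C.
Proof.
  intros H. induction L as [|L IH].
  - simpl. replace (l - 0)%C with l by cring. exact H.
  - simpl psum. replace (l - (psum a L + a L))%C with ((l - psum a L) - a (L + 0)%nat)%C
      by (rewrite Nat.add_0_r; cring).
    eapply is_series_C_ext; [|apply (is_series_C_unshift _ _ IH)].
    intros k. simpl. f_equal. lia.
Qed.

Lemma holomorphic_psum a (f : nat -> C -> C) L :
  (forall l, (l < L)%nat -> holomorphic_at (f l) a) -> holomorphic_at (fun s => psum (fun l => f l s) L) a.
Proof.
  intros H. induction L as [|L IH]; [exact (holomorphic_const a 0)|]. simpl.
  apply (holomorphic_plus a (fun s => psum (fun l => f l s) L)); [apply IH; auto | apply H; lia].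
Qed.

Lemma polar_psum a (f : nat -> C -> C) L :
  (forall l, (l < L)%nat -> polar_at (f l) a) -> polar_at (fun s => psum (fun l => f l s) L) a.
Proof.
  intros H. induction L as [|L IH]; [exact (holomorphic_polar a _ (holomorphic_const a 0))|]. simpl.
  apply (polar_plus a (fun s => psum (fun l => f l s) L)); [apply IH; auto | apply H; lia].
Qed.

Lemma rsum_shift_le (a : nat -> R) L n :
  (forall k, 0 <= a k) -> sum_n (fun k => a (L + k)%nat) n <= sum_n a (L + n)%nat.
Proof.
  intros H. induction n as [|n IH].
  - rewrite rsum_O. rewrite Nat.add_0_r. now apply term_le_rsum.
  - rewrite rsum_S, Nat.add_succ_r, rsum_S. lra.
Qed.

(** Norms on every disc are summable against [rho ^ l]. Hence the sum of [F l s * w ^ l] is entire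
    in [s] for [0 <= w <= rho], and its tail from index [L] on is smaller by the factor
    [(w / rho) ^ L]. *)
Definition entire_family (F : nat -> C -> C) (rho : R) : Prop :=
  forall a r, 0 < r -> exists (N : nat -> R) (B : R),
    (forall l, wiener a r (F l) (N l)) /\ forall n, sum_n (fun l => N l * rho ^ l) n <= B.

Lemma entire_family_holomorphic F rho l a : entire_family F rho -> holomorphic_at (F l) a.
Proof.
  intros H. destruct (H a 1 Rlt_0_1) as [N [B [HN _]]].
  exists 1, (N l). split; [lra | apply HN].
Qed.

(** * Dirichlet series whose terms are expanded in inverse squares, cut at depth L *)

Section Tail.

Variables (F : nat -> C -> C) (rho : R).
Hypothesis (HF : entire_family F rho) (hrho : 0 < rho).

Lemma tail_series (w : R) (L : nat) a r N B s :
  0 <= w <= rho -> 0 < r ->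
  (forall l, wiener a r (F l) (N l)) -> (forall n, sum_n (fun l => N l * rho ^ l) n <= B) ->
  Cmod (s - a) <= r ->
  is_series (fun l => (RtoC w ^ (L + l) * F (L + l)%nat s)%C)
    (C_series (fun l => (F l s * RtoC w ^ l)%C) - psum (fun l => (F l s * RtoC w ^ l)%C) L)%C.
Proof.
  intros hw hr HN HB Hs.
  eapply is_series_C_ext; [|apply is_series_C_tail, C_series_correct].
  - intros l. apply Cmult_comm.
  - apply (bounded_ex_series_C _ B). intros n. eapply Rle_trans; [|apply (HB n)].
    apply rsum_le. intros l _. rewrite Cmod_mult, Cmod_pow, Cmod_R, Rabs_pos_eq by lra.
    apply Rmult_le_compat; [apply Cmod_ge_0 | apply pow_le; lra | now apply (wiener_le a r (F l)) |].
    apply pow_incr. lra.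
Qed.

Lemma wiener_tail (w : R) (L : nat) a r N B :
  0 <= w <= rho -> 0 < r ->
  (forall l, wiener a r (F l) (N l)) -> (forall n, sum_n (fun l => N l * rho ^ l) n <= B) ->
  wiener a r
    (fun s => (C_series (fun l => (F l s * RtoC w ^ l)%C) - psum (fun l => (F l s * RtoC w ^ l)%C) L)%C)
    ((w / rho) ^ L * B).
Proof.
  intros hw hr HN HB.
  assert (N0 : forall l, 0 <= N l) by (intros l; apply (wiener_ge0 a r (F l)); [lra | apply HN]).
  assert (hq : 0 <= w / rho <= 1).
  { split; [apply Rmult_le_pos; [lra | left; now apply Rinv_0_lt_compat]|].
    apply Rmult_le_reg_r with rho; [exact hrho|]. unfold Rdiv. rewrite Rmult_assoc, Rinv_l; lra. }
  apply (wiener_series a r (fun l s => (RtoC w ^ (L + l) * F (L + l)%nat s)%C)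
           (fun l => (w / rho) ^ L * (N (L + l)%nat * rho ^ (L + l)))).
  - exact hr.
  - intros l. eapply wiener_mono; [|apply wiener_scal, HN].
    rewrite Cmod_pow, Cmod_R, Rabs_pos_eq by lra.
    rewrite (Rmult_comm (N _)), <- Rmult_assoc. apply Rmult_le_compat_r; [apply N0|].
    replace w with (w / rho * rho) at 1 by (field; lra).
    rewrite Rpow_mult_distr. apply Rmult_le_compat_r; [apply pow_le; lra|].
    rewrite pow_add. rewrite <- (Rmult_1_r ((w / rho) ^ L)) at 2.
    apply Rmult_le_compat_l; [apply pow_le; lra|].
    rewrite <- (pow1 l). apply pow_incr. lra.
  - intros n. rewrite rsum_mult_l. apply Rmult_le_compat_l; [apply pow_le; lra|].
    eapply Rle_trans; [|apply (HB (L + n)%nat)].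
    apply (rsum_shift_le (fun l => N l * rho ^ l)).
    intros k. apply Rmult_le_pos; [apply N0 | apply pow_le; lra].
  - intros z Hz. now apply (tail_series w L a r N B).
Qed.

Variables (kappa : R) (J : nat) (p q : R).
Hypothesis (hk : 0 <= kappa) (hkr : kappa <= rho * INR (S J) ^ 2) (hp : 0 <= p).

(** The outer series runs over the integers [x > J]; [hkr] says that [kappa / x ^ 2] is at most
    [rho] at the first of them, hence at all. *)
Definition node (j : nat) : R := INR (S j + J).

Definition inner (j : nat) (s : C) : C :=
  C_series (fun l => (F l s * RtoC (kappa / node j ^ 2) ^ l)%C).

Definition remainder_term (L j : nat) (s : C) : C :=
  (Rcpow (node j) (- (RtoC p * s - RtoC q)) *
   (inner j s - psum (fun l => F l s * RtoC (kappa / node j ^ 2) ^ l) L))%C.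

Definition remainder (L : nat) (s : C) : C := C_series (fun j => remainder_term L j s).

Lemma node_ge1 j : 1 <= node j.
Proof. unfold node. replace 1 with (INR 1) by reflexivity. apply le_INR. lia. Qed.

Lemma node_weight j : 0 <= kappa / node j ^ 2 <= rho.
Proof.
  pose proof (node_ge1 j) as h.
  assert (h2 : 0 < node j ^ 2) by (apply pow_lt; lra).
  split; [apply Rmult_le_pos; [exact hk | left; now apply Rinv_0_lt_compat]|].
  apply Rmult_le_reg_r with (node j ^ 2); [exact h2|].
  replace (kappa / node j ^ 2 * node j ^ 2) with kappa by (field; lra).
  eapply Rle_trans; [apply hkr|]. apply Rmult_le_compat_l; [lra|]. apply pow_incr.
  split; [apply pos_INR|]. unfold node. apply le_INR. lia.
Qed.

(** Cutting the inner series at [L] gains [node j ^ (- 2 L)] from [(kappa / node j ^ 2) ^ L], so the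
    half-plane of convergence moves to the left as [L] grows. *)
Lemma remainder_normal (L : nat) a r :
  0 < r -> q - p * Re a + p * r - 2 * INR L <= - (3/2) ->
  normal_series a r (remainder_term L) (remainder L).
Proof.
  intros hr he. destruct (HF a r hr) as [N [B [HN HB]]].
  assert (B0 : 0 <= B).
  { eapply Rle_trans; [|apply (HB 0%nat)]. rewrite rsum_O. simpl. rewrite Rmult_1_r.
    apply (wiener_ge0 a r (F 0%nat)); [lra | apply HN]. }
  assert (hkr0 : 0 <= kappa / rho) by (apply Rmult_le_pos; [lra | left; now apply Rinv_0_lt_compat]).
  apply (normal_series_intro a r (remainder_term L)
    (fun j => (kappa / rho) ^ L * B * Rpower (INR (S j)) (- (3/2))) ((kappa / rho) ^ L * B * 3)).
  - intros j. unfold remainder_term.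
    pose proof (node_ge1 j) as h1.
    eapply wiener_mono; [|apply wiener_mult; [exact hr | apply wiener_Rcpow; lra |
       apply (wiener_tail _ L a r N B (node_weight j) hr HN HB)]].
    replace ((kappa / node j ^ 2 / rho) ^ L) with ((kappa / rho) ^ L * Rpower (node j) (- (2 * INR L))).
    + replace (Rpower (node j) (q - p * Re a + p * r) * ((kappa / rho) ^ L * Rpower (node j) (- (2 * INR L)) * B))
        with ((kappa / rho) ^ L * B * (Rpower (node j) (q - p * Re a + p * r) * Rpower (node j) (- (2 * INR L)))) by ring.
      apply Rmult_le_compat_l; [apply Rmult_le_pos; [now apply pow_le | exact B0]|].
      rewrite <- Rpower_plus. apply Rpower_le_three_halves. lra.
    + rewrite Rpower_Ropp.
      replace (2 * INR L) with (INR (2 * L)) by (rewrite mult_INR; reflexivity).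
      rewrite Rpower_pow, pow_mult by lra. rewrite <- pow_inv, <- Rpow_mult_distr.
      f_equal. field. split; lra.
  - intros n. rewrite rsum_mult_l. apply Rmult_le_compat_l; [|apply sum_inv_three_halves].
    apply Rmult_le_pos; [now apply pow_le | exact B0].
Qed.

Lemma remainder_holomorphic (L : nat) a :
  q - p * Re a - 2 * INR L < - (3/2) -> holomorphic_at (remainder L) a.
Proof.
  (* [e] is the exponent to spare; the radius [e / (p + 1)] uses up only [p * e / (p + 1) <= e] of
     it. *)
  intros h. set (e := - (3/2) - (q - p * Re a - 2 * INR L)). 
  apply (normal_series_holomorphic a (e / (p + 1)) (remainder_term L)).
  - apply Rdiv_lt_0_compat; unfold e; lra.
  - apply remainder_normal; [apply Rdiv_lt_0_compat; unfold e; lra|].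
    assert (p * (e / (p + 1)) <= e); [|unfold e in *; lra].
    replace (p * (e / (p + 1))) with (e - e / (p + 1)) by (field; lra).
    assert (0 < e / (p + 1)) by (apply Rdiv_lt_0_compat; unfold e; lra). lra.
Qed.

Lemma Rcpow_node_weight j l t :
  (Rcpow (node j) (- t) * RtoC (kappa / node j ^ 2) ^ l
   = RtoC kappa ^ l * Rcpow (node j) (- (t + RtoC (2 * INR l))))%C.
Proof.
  pose proof (node_ge1 j) as h1.
  replace (- (t + RtoC (2 * INR l)))%C with (- t + RtoC (- (2 * INR l)))%C by (rewrite RtoC_opp; cring).
  rewrite Rcpow_plus, Rcpow_RtoC, Rpower_Ropp.
  replace (2 * INR l) with (INR (2 * l)) by (rewrite mult_INR; reflexivity).
  rewrite Rpower_pow, pow_mult by lra. rewrite <- pow_inv, RtoC_pow.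
  unfold Rdiv. rewrite RtoC_mult, Cpow_mult_l. cring.
Qed.

(** Summed over the nodes, the inner term of index [l] is the Dirichlet series [Zf] at an argument
    raised by [2 l]. The right-hand side makes sense far to the left as soon as [Zf] is
    continued. *)
Lemma remainder_expand (Zf : C -> C) (L : nat) s :
  (forall t, 3/2 < Re t -> is_series (fun j => Rcpow (node j) (- t)) (Zf t)) ->
  3/2 < p * Re s - q ->
  is_series (fun j => (Rcpow (node j) (- (RtoC p * s - RtoC q)) * inner j s)%C)
    (psum (fun l => F l s * RtoC kappa ^ l * Zf (RtoC p * s - RtoC q + RtoC (2 * INR l))) L + remainder L s)%C.
Proof.
  intros HZ hs.
  set (e := p * Re s - q - 3/2).
  assert (he : 0 < e / (p + 1)) by (apply Rdiv_lt_0_compat; unfold e; lra).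
  destruct (remainder_normal L s (e / (p + 1)) he) as [N [M [_ [_ H3]]]].
  { assert (p * (e / (p + 1)) <= e).
    { replace (p * (e / (p + 1))) with (e - e / (p + 1)) by (field; lra). lra. }
    pose proof (pos_INR L). unfold e in *. lra. }
  specialize (H3 s). rewrite Cminus_diag, Cmod_0 in H3. specialize (H3 (Rlt_le _ _ he)).
  eapply is_series_C_ext; [|apply is_series_C_plus; [|exact H3];
    apply (is_series_C_psum (fun j l => (F l s * RtoC kappa ^ l * Rcpow (node j) (- (RtoC p * s - RtoC q + RtoC (2 * INR l))))%C))].
  - intros j. cbv beta. unfold remainder_term.
    set (c := Rcpow (node j) (- (RtoC p * s - RtoC q))).
    assert (E : forall K, psum (fun l => (F l s * RtoC kappa ^ l * Rcpow (node j) (- (RtoC p * s - RtoC q + RtoC (2 * INR l))))%C) K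
       = (c * psum (fun l => F l s * RtoC (kappa / node j ^ 2) ^ l) K)%C).
    { induction K as [|K IH]; cbn [psum]; [cring|]. rewrite IH.
      pose proof (Rcpow_node_weight j K (RtoC p * s - RtoC q)) as e1. fold c in e1.
      rewrite <- (Cmult_assoc (F K s)), <- e1. cring. }
    rewrite E. cring.
  - intros l _. apply is_series_C_scal. apply HZ.
    unfold Re; simpl. pose proof (pos_INR l). unfold Re in hs. lra.
Qed.

End Tail.

(** * The zeta function *)

Lemma rsum_even_le (a : nat -> R) n :
  (forall k, 0 <= a k) -> sum_n (fun l => a (2 * l)%nat) n <= sum_n a (2 * n)%nat.
Proof.
  intros H. induction n as [|n IH]; [rewrite !rsum_O; simpl; lra|].
  rewrite rsum_S. replace (2 * S n)%nat with (S (S (2 * n))) by lia. rewrite !rsum_S.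
  pose proof (H (S (2 * n))). lra.
Qed.

Lemma rsum_odd_le (a : nat -> R) n :
  (forall k, 0 <= a k) -> sum_n (fun l => a (2 * l + 1)%nat) n <= sum_n a (2 * n + 1)%nat.
Proof.
  intros H. induction n as [|n IH].
  - change (2 * 0 + 1)%nat with 1%nat. rewrite rsum_S, !rsum_O. simpl. pose proof (H 0%nat). lra.
  - rewrite rsum_S. replace (2 * S n + 1)%nat with (S (S (2 * n + 1))) by lia. rewrite !rsum_S.
    pose proof (H (S (2 * n + 1))). lra.
Qed.

Lemma is_series_C_odd (a : nat -> C) (l : C) :
  (forall k, a (2 * k)%nat = RtoC 0) -> is_series a l -> is_series (fun k => a (2 * k + 1)%nat) l.
Proof.
  intros H0. rewrite !is_series_C_eps. intros H eps He. destruct (H eps He) as [N HN].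
  exists N. intros n Hn.
  replace (sum_n (fun k => a (2 * k + 1)%nat) n) with (sum_n a (2 * n + 1)%nat); [apply HN; lia|].
  clear Hn. induction n as [|n IH].
  - change (2 * 0 + 1)%nat with 1%nat. rewrite csum_S, !csum_O. rewrite (H0 0%nat : a 0%nat = _).
    change (2 * 0 + 1)%nat with 1%nat. cring.
  - replace (2 * S n + 1)%nat with (S (2 * S n)) by lia. rewrite csum_S, (csum_S _ n).
    replace (2 * S n)%nat with (S (2 * n + 1)) by lia. rewrite csum_S, IH.
    replace (S (2 * n + 1)) with (2 * S n)%nat by lia. rewrite H0.
    replace (2 * S n + 1)%nat with (S (2 * S n)) by lia. cring.
Qed.

Lemma is_series_C_even (a : nat -> C) (l : C) :
  (forall k, a (2 * k + 1)%nat = RtoC 0) -> is_series a l -> is_series (fun k => a (2 * k)%nat) l.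
Proof.
  intros H0. rewrite !is_series_C_eps. intros H eps He. destruct (H eps He) as [N HN].
  exists N. intros n Hn.
  replace (sum_n (fun k => a (2 * k)%nat) n) with (sum_n a (2 * n)%nat); [apply HN; lia|].
  clear Hn. induction n as [|n IH].
  - change (2 * 0)%nat with 0%nat. rewrite !csum_O. reflexivity.
  - rewrite (csum_S _ n). replace (2 * S n)%nat with (S (2 * n + 1)) by lia. rewrite csum_S.
    replace (2 * n + 1)%nat with (S (2 * n)) at 1 by lia. rewrite csum_S, IH.
    replace (S (2 * n)) with (2 * n + 1)%nat by lia. rewrite H0. cring.
Qed.

Lemma psum_S_first (a : nat -> C) L : psum a (S L) = (a 0%nat + psum (fun l => a (S l)) L)%C.
Proof.
  induction L as [|L IH]; [simpl; cring|].
  change (psum a (S (S L))) with (psum a (S L) + a (S L))%C. rewrite IH. simpl. cring.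
Qed.

(** Odd part of a binomial series: [x^s ((x - 1/2)^(1 - s) - (x + 1/2)^(1 - s))] is the sum over [l]
    of [zeta_coef l s (1 / (4 x^2))^l]. *)
Definition zeta_coef (l : nat) (s : C) : C := rising (1 * s + - (1)) (2 * l + 1).

Lemma zeta_coef_entire : entire_family zeta_coef (1/4).
Proof.
  intros a r hr. set (A := 1 * (r + Cmod a) + Cmod (- (1)) + 1).
  assert (hA : 0 < A).
  { unfold A. pose proof (Cmod_ge_0 a). pose proof (Cmod_ge_0 (- (1))). lra. }
  (* [(1/4) ^ l = 2 * (1/2) ^ (2 l + 1)], so only the odd terms of the majorant series at [1/2]
     enter. *)
  destruct (risingR_series A (1/2) hA) as [B HB]; [lra|].
  exists (fun l => risingR A (2 * l + 1)), (2 * B). split.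
  - intros l. apply wiener_rising; lra.
  - intros n. apply Rle_trans with (2 * sum_n (fun l => (fun k => risingR A k * (1/2) ^ k) (2 * l + 1)%nat) n).
    + rewrite <- rsum_mult_l. right. apply sum_n_ext. intros l.
      rewrite pow_add, pow_mult. replace ((1/2)^2) with (1/4) by (simpl; lra). simpl. lra.
    + apply Rmult_le_compat_l; [lra|]. eapply Rle_trans; [|apply (HB (2 * n + 1)%nat)].
      apply (rsum_odd_le (fun k => risingR A k * (1/2) ^ k)). intros k. apply Rmult_le_pos; [left; now apply risingR_pos | apply pow_le; lra].
Qed.

Lemma zeta_nodeE j : node 0 j = INR (S j).
Proof. unfold node. now rewrite Nat.add_0_r. Qed.

(** With [u = 1 / (2 x)] the two bases are [x (1 - u)] and [x (1 + u)]. Their difference keeps the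
    odd powers of [u], and [2 x u = 1] absorbs the surplus factor. *)
Lemma zeta_inner_value j s :
  (Rcpow (node 0 j) (- (RtoC 1 * s - RtoC 0)) * inner zeta_coef (1/4) 0 j s)%C
  = (Rcpow (INR j + 1/2) (1 - s) - Rcpow (INR (S j) + 1/2) (1 - s))%C.
Proof.
  rewrite zeta_nodeE. set (x := INR (S j)). assert (hx : 1 <= x).
  { unfold x. replace 1 with (INR 1) by reflexivity. apply le_INR. lia. }
  set (u := 1 / (2 * x)).
  assert (hu : 0 < u <= 1/2).
  { unfold u. split; [apply Rdiv_lt_0_compat; lra|].
    apply Rmult_le_reg_r with (2 * x); [lra|]. field_simplify; lra. }
  assert (xu : x * u = 1/2) by (unfold u; field; lra).
  assert (u0 : RtoC u <> RtoC 0) by (intros e; apply RtoC_inj in e; lra).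
  set (b := (1 * s + - (1))%C).
  pose proof (is_series_rising b u ltac:(rewrite Rabs_pos_eq; lra)) as H1.
  pose proof (is_series_rising b (- u) ltac:(rewrite Rabs_left; lra)) as H2.
  pose proof (is_series_C_minus _ _ _ _ H1 H2) as H. cbv beta in H.
  assert (He : forall k, ((- RtoC u) ^ (2 * k) = RtoC u ^ (2 * k))%C).
  { intros k. rewrite !Cpow_mult_r. f_equal. simpl. cring. }
  apply is_series_C_odd in H.
  2:{ intros k. rewrite RtoC_opp, He. cring. }
  apply (is_series_C_scal (RtoC x)%C) in H.
  assert (HI : inner zeta_coef (1/4) 0 j s = (RtoC x * (Rcpow (1 - u) (- b) - Rcpow (1 - - u) (- b)))%C).
  { apply C_series_unique. eapply is_series_C_ext; [|exact H]. intros k. cbv beta.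
    rewrite RtoC_opp, !Cpow_add_r, He. unfold zeta_coef. fold b.
    rewrite zeta_nodeE. fold x.
    replace (1/4 / x ^ 2) with (u ^ 2) by (unfold u; field; lra).
    rewrite (RtoC_pow u 2), <- Cpow_mult_r. rewrite !Cpow_1_r.
    transitivity (rising b (2 * k + 1) * RtoC u ^ (2 * k) * (RtoC 2 * (RtoC x * RtoC u)))%C; [cring|].
    rewrite <- (RtoC_mult x), xu, <- RtoC_mult. replace (2 * (1/2)) with 1 by lra. cring. }
  rewrite HI.
  replace (INR j + 1/2) with (x * (1 - u)) by (unfold x in *; rewrite S_INR in *; lra).
  replace (x + 1/2) with (x * (1 - - u)) by lra.
  rewrite !Rcpow_mult_base by lra.
  replace (- b)%C with (1 - s)%C by (unfold b; cring).
  assert (ex : Rcpow x (1 - s) = (RtoC x * Rcpow x (- (RtoC 1 * s - RtoC 0)))%C).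
  { replace (1 - s)%C with (RtoC (INR 1) + - (RtoC 1 * s - RtoC 0))%C by (simpl (INR 1); cring).
    rewrite Rcpow_plus, Rcpow_INR by lra. now rewrite pow_1. }
  rewrite ex. cring.
Qed.

Lemma Rpower_lim0 (y : R) eps : y < 0 -> 0 < eps ->
  exists N, forall n, (N <= n)%nat -> Rpower (INR (S n) + 1/2) y < eps.
Proof.
  intros hy he. destruct (nfloor_ex (exp (ln eps / y))) as [N [_ hN]]; [left; apply exp_pos|].
  exists N. intros n hn. apply le_INR in hn.
  assert (h : exp (ln eps / y) < INR (S n) + 1/2) by (rewrite S_INR; lra).
  apply ln_increasing in h; [|apply exp_pos]. rewrite ln_exp in h.
  unfold Rpower. replace eps with (exp (ln eps)) by (apply exp_ln; exact he).
  apply exp_increasing. apply (Rmult_lt_gt_compat_neg_l y) in h; [|exact hy].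
  replace (y * (ln eps / y)) with (ln eps) in h by (field; lra). lra.
Qed.

Lemma zeta_telescope s : 1 < Re s ->
  is_series (fun j => (Rcpow (node 0 j) (- (RtoC 1 * s - RtoC 0)) * inner zeta_coef (1/4) 0 j s)%C)
    (Rcpow (1/2) (1 - s)).
Proof.
  intros hs. apply is_series_C_eps. intros eps He.
  destruct (Rpower_lim0 (1 - Re s) eps) as [N HN]; [lra | exact He|].
  exists N. intros n hn.
  assert (E : sum_n (fun j => (Rcpow (node 0 j) (- (RtoC 1 * s - RtoC 0)) * inner zeta_coef (1/4) 0 j s)%C) n
     = (Rcpow (1/2) (1 - s) - Rcpow (INR (S n) + 1/2) (1 - s))%C :> C).
  { clear hn. induction n as [|n IH].
    - rewrite csum_O, zeta_inner_value. simpl (INR 0). rewrite Rplus_0_l. reflexivity.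
    - rewrite csum_S, IH, zeta_inner_value. cring. }
  rewrite E.
  replace (Rcpow (1/2) (1 - s) - Rcpow (INR (S n) + 1/2) (1 - s) - Rcpow (1/2) (1 - s))%C
    with (- Rcpow (INR (S n) + 1/2) (1 - s))%C by cring.
  rewrite Cmod_opp, Cmod_Rcpow.
  replace (Re (1 - s)) with (1 - Re s) by (unfold Re; simpl; ring). now apply HN.
Qed.

Definition zeta_sum (s : C) : C := C_series (fun j => Rcpow (INR (S j)) (- s)).

Lemma zeta_sum_normal a r : 0 < r -> - Re a + r <= - (3/2) ->
  normal_series a r (fun j s => Rcpow (INR (S j)) (- s)) zeta_sum.
Proof.
  intros hr h.
  apply (normal_series_intro a r (fun j s => Rcpow (INR (S j)) (- s)) (fun j => Rpower (INR (S j)) (- (3/2))) 3).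
  - intros j. assert (h1 : 1 <= INR (S j)).
    { replace 1 with (INR 1) by reflexivity. apply le_INR. lia. }
    eapply wiener_ext; [|eapply wiener_mono; [|apply (wiener_Rcpow a r (INR (S j)) 1 0); lra]].
    + intros z _. cbv beta. f_equal. cring.
    + rewrite <- (Nat.add_0_r (S j)) at 1. apply Rpower_le_three_halves. lra.
  - apply sum_inv_three_halves.
Qed.

Lemma zeta_sum_series s : 3/2 < Re s -> is_series (fun j => Rcpow (INR (S j)) (- s)) (zeta_sum s).
Proof.
  intros h. destruct (zeta_sum_normal s (Re s - 3/2)) as [N [M [_ [_ H]]]]; [lra | lra|].
  apply H. rewrite Cminus_diag, Cmod_0. lra.
Qed.

Lemma zeta_sum_holomorphic s : 3/2 < Re s -> holomorphic_at zeta_sum s.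
Proof.
  intros h. apply (normal_series_holomorphic s (Re s - 3/2) (fun j s => Rcpow (INR (S j)) (- s))); [lra|].
  apply zeta_sum_normal; lra.
Qed.

Definition zeta_remainder := remainder zeta_coef (1/4) 0 1 0.

Lemma zeta_coef_0 s : zeta_coef 0 s = (s - 1)%C.
Proof. unfold zeta_coef. simpl. field. Qed.

Definition shifted_term (f : C -> C) (s : C) (l : nat) : C :=
  (zeta_coef (S l) s * RtoC (1/4) ^ S l * f (s + RtoC (2 * INR (S l))))%C.

(** The telescoped identity with its leading inner coefficient [s - 1] split off; solved for
    [zeta_sum s] it becomes a recursion through [s + 2, s + 4, ...]. *)
Lemma zeta_sum_expand L s : 3/2 < Re s ->
  Rcpow (1/2) (1 - s) =
  ((s - 1) * zeta_sum s
   + psum (shifted_term zeta_sum s) L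
   + zeta_remainder (S L) s)%C.
Proof.
  intros hs. apply (is_series_C_unique _ _ _ (zeta_telescope s ltac:(lra))).
  assert (HZ : forall t, 3/2 < Re t -> is_series (fun j => Rcpow (node 0 j) (- t)) (zeta_sum t)).
  { intros t ht. eapply is_series_C_ext; [|apply (zeta_sum_series t ht)].
    intros j. cbv beta. now rewrite zeta_nodeE. }
  pose proof (remainder_expand zeta_coef (1/4) zeta_coef_entire ltac:(lra) (1/4) 0 1 0 ltac:(lra)
    ltac:(simpl; lra) ltac:(lra) zeta_sum (S L) s HZ ltac:(lra)) as H.
  rewrite psum_S_first, zeta_coef_0 in H.
  replace ((s - 1) * zeta_sum s)%C
    with ((s - 1) * RtoC (1/4) ^ 0 * zeta_sum (RtoC 1 * s - RtoC 0 + RtoC (2 * INR 0)))%C.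
  - eapply is_series_C_ext; [|revert H].
    + intros j. reflexivity.
    + intros H. erewrite psum_ext; [exact H|]. intros l _. unfold shifted_term. do 2 f_equal. cring.
  - simpl (_ ^ 0)%C. replace (RtoC 1 * s - RtoC 0 + RtoC (2 * INR 0))%C with s; [cring|].
    simpl (INR 0). rewrite Rmult_0_r. cring.
Qed.

(** Each level solves the expanded identity for zeta, inserts the previous level at
    [s + 2, s + 4, ...], and so moves the half-plane of validity to the left by 2. *)
Fixpoint zeta_approx (L : nat) : C -> C :=
  match L with
  | O => zeta_sum
  | S K => fun s =>
      ((Rcpow (1/2) (1 - s)
        - psum (shifted_term (zeta_approx K) s) K
        - zeta_remainder (S K) s) * / (s - 1))%C
  end.

Lemma Re_plus_RtoC s x : Re (s + RtoC x)%C = Re s + x.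
Proof. unfold Re; simpl. ring. Qed.

Lemma zeta_approx_eq L s : 3/2 < Re s -> zeta_approx L s = zeta_sum s.
Proof.
  revert s. induction L as [|L IH]; intros s hs; [reflexivity|].
  assert (h1 : (s - 1)%C <> RtoC 0).
  { apply Cminus_neq0. intros ->. unfold Re in hs; simpl in hs. lra. }
  cbn [zeta_approx].
  rewrite (psum_ext _ (shifted_term zeta_sum s)).
  - rewrite (zeta_sum_expand L s hs). field. exact h1.
  - intros l _. unfold shifted_term. rewrite IH; [reflexivity|]. rewrite Re_plus_RtoC.
    pose proof (pos_INR (S l)). lra.
Qed.

(* The points [1, -1, -3, ...]: the exceptional set produced by iterating the recursion. *)
Definition zeta_regular (a : C) : Prop := forall k : nat, a <> RtoC (1 - 2 * INR k).

(** The exceptional set is stable under subtracting 2, so the recursion started at a regular point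
    meets only regular points. *)
Lemma zeta_regular_shift a l : zeta_regular a -> zeta_regular (a + RtoC (2 * INR l))%C.
Proof.
  intros H k E. apply (H (k + l)%nat).
  replace a with ((a + RtoC (2 * INR l)) - RtoC (2 * INR l))%C by cring.
  rewrite E, <- RtoC_minus, plus_INR. f_equal. ring.
Qed.

Lemma zeta_remainder_holomorphic L a : 3/2 - 2 * INR L < Re a -> holomorphic_at (zeta_remainder L) a.
Proof.
  intros h. apply (remainder_holomorphic zeta_coef (1/4) zeta_coef_entire ltac:(lra) (1/4) 0 1 0 ltac:(lra)
    ltac:(simpl; lra) ltac:(lra)). lra.
Qed.

Lemma holomorphic_comp_shift a b f :
  holomorphic_at f (a + b)%C -> holomorphic_at (fun z => f (z + b)%C) a.
Proof.
  intros H. replace (fun z => f (z + b)%C) with (fun z => f (RtoC 1 * z + b)%C)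
    by (apply functional_extensionality; intros z; f_equal; cring).
  apply holomorphic_comp_scale; [lra|]. replace (RtoC 1 * a + b)%C with (a + b)%C by cring. exact H.
Qed.

Lemma polar_comp_shift a b f :
  polar_at f (a + b)%C -> polar_at (fun z => f (z + b)%C) a.
Proof.
  intros H. replace (fun z => f (z + b)%C) with (fun z => f (RtoC 1 * z + b)%C)
    by (apply functional_extensionality; intros z; f_equal; cring).
  apply polar_comp_scale; [lra|]. replace (RtoC 1 * a + b)%C with (a + b)%C by cring. exact H.
Qed.

Lemma holomorphic_half_pow a : holomorphic_at (fun s => Rcpow (1/2) (1 - s)) a.
Proof.
  replace (fun s => Rcpow (1/2) (1 - s)) with (fun s => Rcpow (1/2) (- (1) * s + 1)%C)
    by (apply functional_extensionality; intros z; f_equal; cring).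
  apply holomorphic_Rcpow.
Qed.

Lemma zeta_approx_polar L a : 3/2 - 2 * INR L < Re a ->
  polar_at (zeta_approx L) a /\ (zeta_regular a -> holomorphic_at (zeta_approx L) a).
Proof.
  revert a. induction L as [|L IH]; intros a ha.
  - simpl in ha. split; [apply holomorphic_polar|intros _]; apply zeta_sum_holomorphic; lra.
  - assert (hl : forall l, 3/2 - 2 * INR L < Re (a + RtoC (2 * INR (S l)))%C).
    { intros l. rewrite Re_plus_RtoC. rewrite S_INR in *. pose proof (pos_INR l). lra. }
    assert (hc : forall l, holomorphic_at (fun s => (zeta_coef (S l) s * RtoC (1/4) ^ S l)%C) a).
    { intros l. apply holomorphic_mult; [|apply holomorphic_const].
      exact (entire_family_holomorphic _ _ (S l) a zeta_coef_entire). }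
    cbn [zeta_approx]. split.
    + apply polar_mult; [|apply polar_inv_affine].
      apply polar_minus; [apply polar_minus|].
      * apply holomorphic_polar, holomorphic_half_pow.
      * apply (polar_psum a (fun l s => shifted_term (zeta_approx L) s l)).
        intros l _. apply polar_mult; [apply holomorphic_polar, hc|].
        apply (polar_comp_shift a (RtoC (2 * INR (S l))) (zeta_approx L)). now apply IH.
      * now apply holomorphic_polar, zeta_remainder_holomorphic.
    + intros hreg. apply holomorphic_mult.
      2:{ apply holomorphic_inv_affine. replace (RtoC 1) with (RtoC (1 - 2 * INR 0)); [apply hreg|].
          f_equal. simpl. ring. }
      apply holomorphic_minus; [apply holomorphic_minus|].
      * apply holomorphic_half_pow.
      * apply (holomorphic_psum a (fun l s => shifted_term (zeta_approx L) s l)).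
        intros l _. apply holomorphic_mult; [apply hc|].
        apply (holomorphic_comp_shift a (RtoC (2 * INR (S l))) (zeta_approx L)). apply IH; [apply hl|].
        now apply zeta_regular_shift.
      * now apply zeta_remainder_holomorphic.
Qed.

Lemma zeta_regular_half_plane a : 1 < Re a -> zeta_regular a.
Proof. intros h k ->. unfold Re in h; simpl in h. pose proof (pos_INR k). lra. Qed.

Lemma zeta_approx_series L s : 3/2 < Re s -> is_series (fun j => Rcpow (INR (S j)) (- s)) (zeta_approx L s).
Proof. intros h. rewrite zeta_approx_eq by exact h. now apply zeta_sum_series. Qed.

Lemma riemann_zeta_continuation :
  is_meromorphic_continuation (fun j s => Rcpow (INR (S j)) (- s)) riemann_zeta.
Proof.
  apply meromorphic_continuation_spec.
  apply (glue_meromorphic _ (fun L => zeta_approx (S L)) (3/2)).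
  - intros L a h. apply zeta_approx_polar. rewrite S_INR. pose proof (pos_INR L). lra.
  - intros L a h h'. apply zeta_approx_polar; [|apply zeta_regular_half_plane; lra].
    pose proof (pos_INR (S L)). lra.
  - intros L s h _. now apply zeta_approx_series.
Qed.

Lemma riemann_zeta_near L a : 3/2 - 2 * INR L < Re a -> zeta_regular a ->
  nearC a (fun z => riemann_zeta z = zeta_approx L z).
Proof.
  intros h hreg.
  apply (continuation_agrees_holomorphic _ _ _ (3/2 - 2 * INR L) riemann_zeta_continuation).
  - intros b hb. now apply zeta_approx_polar.
  - exists (3/2). intros s hs. now apply zeta_approx_series.
  - exact h.
  - now apply zeta_approx_polar.
Qed.

Lemma riemann_zeta_polar a : polar_at riemann_zeta a.
Proof. apply meromorphic_polar, riemann_zeta_continuation. Qed.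

Lemma riemann_zeta_holomorphic a : zeta_regular a -> holomorphic_at riemann_zeta a.
Proof.
  intros h. destruct (nfloor_ex (Rabs (Re a)) (Rabs_pos _)) as [L [_ hL]].
  assert (hl : 3/2 - 2 * INR (S (S L)) < Re a).
  { rewrite !S_INR. pose proof (Rle_abs (- Re a)) as e. rewrite Rabs_Ropp in e. pose proof (pos_INR L). lra. }
  apply (holomorphic_ext a (zeta_approx (S (S L)))); [|now apply zeta_approx_polar].
  eapply nearC_imp; [|apply (riemann_zeta_near _ _ hl h)]. intros z ->. reflexivity.
Qed.

Lemma riemann_zeta_series s : 3/2 < Re s ->
  is_series (fun j => Rcpow (INR (S j)) (- s)) (riemann_zeta s).
Proof.
  intros h. rewrite (nearC_point _ _ (riemann_zeta_near 0 s ltac:(simpl; lra) (zeta_regular_half_plane s ltac:(lra)))).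
  now apply zeta_approx_series.
Qed.

(** Exceptional points are odd integers. Every zeta value that occurs for the sphere at [s = 0] has
    an even argument. *)
Lemma zeta_regular_even (z : Z) : zeta_regular (RtoC (2 * IZR z)).
Proof.
  intros k E. apply RtoC_inj in E. rewrite INR_IZR_INZ, <- !mult_IZR, <- minus_IZR in E.
  apply eq_IZR in E. lia.
Qed.

(** * Wallis' product and Stirling's constant *)

Definition wallis_int (n : nat) : R := RInt (fun x => sin x ^ n) 0 (PI / 2).

Lemma continuous_sin_pow n x : continuous (fun x => sin x ^ n) x.
Proof. apply (ex_derive_continuous (fun x => sin x ^ n)). auto_derive. trivial. Qed.

Lemma is_RInt_sin_pow n : is_RInt (fun x => sin x ^ n) 0 (PI / 2) (wallis_int n).
Proof.
  apply (RInt_correct (fun x => sin x ^ n)), (ex_RInt_continuous (fun x => sin x ^ n)).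
  intros x _. apply continuous_sin_pow.
Qed.

(** Integrates the derivative of [sin x ^ (n + 1) * cos x], which vanishes at both ends of the
    interval. *)
Lemma wallis_int_rec n : INR (n + 2) * wallis_int (n + 2) = INR (n + 1) * wallis_int n.
Proof.
  assert (H : is_RInt (fun x => INR (n + 1) * sin x ^ n - INR (n + 2) * sin x ^ (n + 2)) 0 (PI / 2)
     (minus (sin (PI / 2) ^ (n + 1) * cos (PI / 2)) (sin 0 ^ (n + 1) * cos 0))).
  { apply (is_RInt_derive (fun x => sin x ^ (n + 1) * cos x)).
    - intros x _. auto_derive; [trivial|].
      replace (Init.Nat.pred (n + 1)) with n by lia.
      pose proof (sin2_cos2 x) as h. unfold Rsqr in h.
      rewrite !plus_INR, !pow_add. simpl.
      assert (e : cos x * cos x = 1 - sin x * sin x) by lra.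
      transitivity (INR n * (cos x * cos x) * sin x ^ n + (cos x * cos x) * sin x ^ n - sin x ^ n * sin x * sin x); [ring|].
      rewrite e. ring.
    - intros x _. apply (ex_derive_continuous (fun x => INR (n + 1) * sin x ^ n - INR (n + 2) * sin x ^ (n + 2))).
      auto_derive. trivial. }
  assert (K : is_RInt (fun x => INR (n + 1) * sin x ^ n - INR (n + 2) * sin x ^ (n + 2)) 0 (PI / 2)
     (INR (n + 1) * wallis_int n - INR (n + 2) * wallis_int (n + 2))).
  { apply (is_RInt_minus (fun x => INR (n + 1) * sin x ^ n) (fun x => INR (n + 2) * sin x ^ (n + 2)));
      [apply (is_RInt_scal (fun x => sin x ^ n)) | apply (is_RInt_scal (fun x => sin x ^ (n + 2)))]; apply is_RInt_sin_pow. }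
  pose proof (is_RInt_unique _ _ _ _ H) as e1. pose proof (is_RInt_unique _ _ _ _ K) as e2.
  rewrite e1 in e2. rewrite cos_PI2, sin_0 in e2.
  assert (e3 : minus (sin (PI / 2) ^ (n + 1) * 0) (0 ^ (n + 1) * cos 0) = 0).
  { rewrite pow_i by lia. unfold minus, plus, opp; simpl. ring. }
  rewrite e3 in e2. lra.
Qed.

Lemma wallis_int_decr n : wallis_int (S n) <= wallis_int n.
Proof.
  apply RInt_le.
  - pose proof PI_RGT_0. lra.
  - eexists. apply is_RInt_sin_pow.
  - eexists. apply is_RInt_sin_pow.
  - intros x hx. assert (0 <= sin x) by (apply sin_ge_0; lra). pose proof (SIN_bound x).
    simpl. rewrite <- (Rmult_1_l (sin x ^ n)) at 2. apply Rmult_le_compat_r; [now apply pow_le | lra].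
Qed.

Lemma wallis_int_0 : wallis_int 0 = PI / 2.
Proof.
  unfold wallis_int. simpl. rewrite RInt_const. unfold scal; simpl. unfold mult; simpl. ring.
Qed.

Lemma wallis_int_1 : wallis_int 1 = 1.
Proof.
  assert (H : is_RInt (fun x => sin x ^ 1) 0 (PI / 2) (minus (- cos (PI / 2)) (- cos 0))).
  { apply (is_RInt_derive (fun x => - cos x)).
    - intros x _. auto_derive; [trivial|]. ring.
    - intros x _. apply continuous_sin_pow. }
  pose proof (is_RInt_unique _ _ _ _ H) as e. unfold wallis_int. rewrite e, cos_PI2, cos_0.
  unfold minus, plus, opp; simpl. ring.
Qed.

(* [central n = binomial (2 n) n / 4 ^ n]. *)
Fixpoint central (n : nat) : R :=
  match n with O => 1 | S m => central m * (2 * INR m + 1) / (2 * INR m + 2) end.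

Lemma central_pos n : 0 < central n.
Proof.
  induction n as [|n IH]; [simpl; lra|]. cbn [central]. pose proof (pos_INR n).
  apply Rdiv_lt_0_compat; [apply Rmult_lt_0_compat|]; lra.
Qed.

Lemma wallis_int_even n : wallis_int (2 * n) = PI / 2 * central n.
Proof.
  induction n as [|n IH]; [simpl; rewrite wallis_int_0; ring|].
  pose proof (wallis_int_rec (2 * n)) as h. replace (2 * S n)%nat with (2 * n + 2)%nat by lia.
  rewrite IH, !plus_INR, mult_INR in h. simpl in h. cbn [central]. pose proof (pos_INR n).
  apply Rmult_eq_reg_l with (2 * INR n + 2); [|lra].
  transitivity ((2 * INR n + 1) * (PI / 2 * central n)); [|field; lra].
  replace (wallis_int (2 * n + 2)) with (wallis_int (n + (n + 0) + 2)) by (f_equal; lia). lra.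
Qed.

Lemma wallis_int_odd n : wallis_int (2 * n + 1) * ((2 * INR n + 1) * central n) = 1.
Proof.
  induction n as [|n IH]; [simpl; rewrite wallis_int_1; ring|].
  pose proof (wallis_int_rec (2 * n + 1)) as h. replace (2 * S n + 1)%nat with (2 * n + 1 + 2)%nat by lia.
  rewrite !plus_INR, mult_INR in h. change (INR 2) with 2 in h. change (INR 1) with 1 in h.
  cbn [central]. rewrite S_INR. pose proof (pos_INR n).
  set (w := wallis_int (2 * n + 1 + 2)) in *. set (w0 := wallis_int (2 * n + 1)) in *.
  replace (w * ((2 * (INR n + 1) + 1) * (central n * (2 * INR n + 1) / (2 * INR n + 2))))
    with (((2 * INR n + 1 + 2) * w) * (central n * (2 * INR n + 1)) / (2 * INR n + 2)) by (field; lra).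
  rewrite h. transitivity (w0 * ((2 * INR n + 1) * central n)); [field; lra | exact IH].
Qed.

(** This is [wallis_int (2 n + 1) <= wallis_int (2 n)] multiplied by [(2 n + 1) * central n].
    [central_upper] uses the next pair of integrals, and together they squeeze
    [PI * n * central n ^ 2] to 1. *)
Lemma central_lower n : 1 <= PI * (INR n + 1/2) * central n ^ 2.
Proof.
  pose proof (wallis_int_decr (2 * n)) as h. pose proof (wallis_int_odd n) as e.
  replace (S (2 * n)) with (2 * n + 1)%nat in h by lia. rewrite wallis_int_even in h.
  pose proof (central_pos n) as hc. pose proof (pos_INR n).
  assert (hp : 0 < (2 * INR n + 1) * central n) by (apply Rmult_lt_0_compat; lra).
  apply (Rmult_le_compat_r _ _ _ (Rlt_le _ _ hp)) in h. rewrite e in h. simpl. lra.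
Qed.

Lemma central_upper n : PI * INR (S n) * central (S n) ^ 2 <= 1.
Proof.
  pose proof (wallis_int_decr (2 * n + 1)) as h. pose proof (wallis_int_odd n) as e.
  replace (S (2 * n + 1)) with (2 * S n)%nat in h by lia. rewrite wallis_int_even in h.
  pose proof (central_pos n) as hc. pose proof (central_pos (S n)) as hc'. pose proof (pos_INR n).
  assert (hp : 0 < (2 * INR n + 1) * central n) by (apply Rmult_lt_0_compat; lra).
  apply (Rmult_le_compat_r _ _ _ (Rlt_le _ _ hp)) in h. rewrite e in h.
  replace ((2 * INR n + 1) * central n) with ((2 * INR n + 2) * central (S n)) in h
    by (cbn [central]; field; lra).
  rewrite S_INR. set (c := central (S n)) in *. nra.
Qed.

Lemma fact_double n : INR (fact (2 * n)) = central n * 4 ^ n * INR (fact n) ^ 2.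
Proof.
  induction n as [|n IH]; [simpl; ring|].
  replace (2 * S n)%nat with (S (S (2 * n))) by lia.
  rewrite (fact_simpl (S (2 * n))), (fact_simpl (2 * n)), (fact_simpl n), !mult_INR, IH, !S_INR, mult_INR.
  cbn [central]. change (INR 2) with 2. simpl (4 ^ S n). pose proof (pos_INR n). field. lra.
Qed.

Lemma ln_diff_le x y : 0 < x -> 0 < y -> ln y - ln x <= (y - x) / x.
Proof.
  intros hx hy. pose proof (exp_ineq1_le (ln (y / x))) as h.
  rewrite exp_ln in h by now apply Rdiv_lt_0_compat.
  rewrite ln_div in h by assumption. replace ((y - x) / x) with (y / x - 1) by (field; lra). lra.
Qed.

(** Stirling's formula at the half-integer [n + 1/2], as it arises from the telescoping for zeta.
    Its convergence will come from that of the remainder series for zeta. *)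
Definition stirling_seq (n : nat) : R :=
  ln (INR (fact n)) - (INR n + 1/2) * ln (INR n + 1/2) + INR n.

(** The factorials combine to [central n], which Wallis bounds from both sides; all that is left are
    differences of logarithms at distances 1/4 and 1/2, of total size at most [1 / n]. *)
Lemma stirling_seq_duplication n : (1 <= n)%nat ->
  Rabs (2 * stirling_seq n - stirling_seq (2 * n) - (ln 2 / 2 + ln PI / 2 - 1/2)) <= / INR n.
Proof.
  intros hn. destruct n as [|m]; [lia|]. set (n := S m).
  assert (hN : 0 < INR n) by apply INR_S_pos.
  pose proof (central_lower n) as h1. pose proof (central_upper m) as h2. fold n in h2. clearbody n.
  pose proof (central_pos n) as hc. pose proof PI_RGT_0 as hpi.
  pose proof (INR_fact_lt_0 n) as hf.
  apply ln_le in h1; [|lra]. apply ln_le in h2; [|apply Rmult_lt_0_compat; [apply Rmult_lt_0_compat; lra | apply pow_lt; lra]].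
  rewrite ln_1 in *.
  assert (hc2 : 0 < central n ^ 2) by (apply pow_lt; lra).
  rewrite !ln_mult in h1, h2 by (try apply Rmult_lt_0_compat; lra).
  assert (e2 : ln (central n ^ 2) = 2 * ln (central n)) by (rewrite ln_pow; [simpl; ring | lra]).
  rewrite e2 in *. rewrite (ln_mult PI) in h1, h2 by lra.
  assert (ef : ln (INR (fact (2 * n))) = ln (central n) + 2 * INR n * ln 2 + 2 * ln (INR (fact n))).
  { rewrite fact_double.
    assert (0 < 4 ^ n) by (apply pow_lt; lra). assert (0 < INR (fact n) ^ 2) by (apply pow_lt; lra).
    rewrite !ln_mult, !ln_pow by (try apply Rmult_lt_0_compat; lra).
    replace 4 with (2 * 2) by lra. rewrite ln_mult by lra. simpl (INR 2). ring. }
  unfold stirling_seq. rewrite ef, mult_INR. change (INR 2) with 2.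
  replace (2 * INR n + 1/2) with (2 * (INR n + 1/4)) by lra. rewrite (ln_mult 2) by lra.
  pose proof (ln_diff_le (INR n + 1/4) (INR n + 1/2) ltac:(lra) ltac:(lra)) as d1.
  pose proof (ln_diff_le (INR n + 1/2) (INR n + 1/4) ltac:(lra) ltac:(lra)) as d2.
  pose proof (ln_diff_le (INR n) (INR n + 1/2) ltac:(lra) ltac:(lra)) as d3.
  set (N := INR n) in *.
  set (l1 := ln (N + 1/4)) in *. set (l2 := ln (N + 1/2)) in *.
  apply (Rmult_le_compat_l (2 * (N + 1/4))) in d1; [|lra].
  apply (Rmult_le_compat_l (2 * (N + 1/4))) in d2; [|lra].
  replace (2 * (N + 1/4) * ((N + 1/2 - (N + 1/4)) / (N + 1/4))) with (1/2) in d1 by (field; lra).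
  replace (2 * (N + 1/4) * ((N + 1/4 - (N + 1/2)) / (N + 1/2))) with (- (1/2) + 1/8 * / (N + 1/2)) in d2 by (field; lra).
  replace ((N + 1/2 - N) / N) with (1/2 * / N) in d3 by (field; lra).
  assert (h3 : / (N + 1/2) <= / N) by (apply Rinv_le_contravar; lra).
  assert (h4 : 0 < / N) by now apply Rinv_0_lt_compat.
  apply Rabs_le. split; nra || lra.
Qed.

(** A limit satisfies [A = 2 A - A], and the right-hand side is known from the duplication
    estimate. *)
Lemma stirling_limit (A : R) : is_lim_seq stirling_seq A -> A = ln 2 / 2 + ln PI / 2 - 1/2.
Proof.
  intros H. set (B := ln 2 / 2 + ln PI / 2 - 1/2).
  assert (H2 : is_lim_seq (fun n => stirling_seq (2 * n)) A).
  { apply (is_lim_seq_subseq stirling_seq A (fun n => 2 * n)%nat); [|exact H].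
    apply eventually_subseq. intros n. lia. }
  assert (H3 : is_lim_seq (fun n => 2 * stirling_seq n - stirling_seq (2 * n) - B) (2 * A - A - B)).
  { apply is_lim_seq_minus'; [apply is_lim_seq_minus'; [|exact H2]|apply is_lim_seq_const].
    apply is_lim_seq_mult'; [apply is_lim_seq_const | exact H]. }
  assert (H4 : is_lim_seq (fun n => 2 * stirling_seq n - stirling_seq (2 * n) - B) 0).
  { apply is_lim_seq_abs_0.
    apply (is_lim_seq_le_le_loc (fun _ => 0) _ (fun n => / INR n)).
    - exists 1%nat. intros n hn. split; [apply Rabs_pos | now apply stirling_seq_duplication].
    - apply is_lim_seq_const.
    - apply (is_lim_seq_inv INR p_infty); [apply is_lim_seq_INR | discriminate]. }
  apply is_lim_seq_unique in H3. apply is_lim_seq_unique in H4. rewrite H3 in H4.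
  injection H4. lra.
Qed.

(** * The derivative of zeta at 0 *)

(* The two canonical normed modules on [C] have different uniform structures but the same norm. *)
Lemma is_derive_C_AbsRing (f : C -> C) (a l : C) :
  is_derive f a l <-> is_derive (V := AbsRing_NormedModule C_AbsRing) f a l.
Proof.
  split; intros [_ H]; split.
  - apply is_linear_scal_l.
  - exact H.
  - apply is_linear_scal_l.
  - exact H.
Qed.

Lemma is_derive_C_mult (f g : C -> C) (a df dg : C) :
  is_derive f a df -> is_derive g a dg ->
  is_derive (fun z => (f z * g z)%C) a (df * g a + f a * dg)%C.
Proof.
  rewrite !is_derive_C_AbsRing. intros Hf Hg.
  exact (is_derive_mult (K := C_AbsRing) f g a df dg Hf Hg Cmult_comm).
Qed.

Lemma is_derive_C_plus (f g : C -> C) (a df dg : C) :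
  is_derive f a df -> is_derive g a dg -> is_derive (fun z => (f z + g z)%C) a (df + dg)%C.
Proof. exact (is_derive_plus (V := C_NormedModule) f g a df dg). Qed.

Lemma is_derive_C_minus (f g : C -> C) (a df dg : C) :
  is_derive f a df -> is_derive g a dg -> is_derive (fun z => (f z - g z)%C) a (df - dg)%C.
Proof. exact (is_derive_minus (V := C_NormedModule) f g a df dg). Qed.

Lemma is_derive_C_const (c a : C) : is_derive (fun _ : C => c) a (RtoC 0).
Proof. exact (is_derive_const (V := C_NormedModule) c a). Qed.

Lemma is_derive_C_id (a : C) : is_derive (fun z : C => z) a (RtoC 1).
Proof. apply is_derive_C_AbsRing. exact (is_derive_id (K := C_AbsRing) a). Qed.

Lemma is_derive_C_scal (c : C) (f : C -> C) (a df : C) :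
  is_derive f a df -> is_derive (fun z => (c * f z)%C) a (c * df)%C.
Proof.
  intros H. replace (c * df)%C with (0 * f a + c * df)%C by cring.
  apply (is_derive_C_mult (fun _ => c)); [apply is_derive_C_const | exact H].
Qed.

Lemma is_derive_C_ext (f g : C -> C) (a df : C) :
  nearC a (fun z => f z = g z) -> is_derive f a df -> is_derive g a df.
Proof.
  intros [d [hd H]]. apply (is_derive_ext_loc f g).
  exists (mkposreal d hd). exact H.
Qed.

Lemma is_derive_C_eq (f : C -> C) (a d1 d2 : C) : d1 = d2 -> is_derive f a d1 -> is_derive f a d2.
Proof. intros ->. trivial. Qed.

Lemma is_derive_C_unique (f : C -> C) (a d1 d2 : C) : is_derive f a d1 -> is_derive f a d2 -> d1 = d2.
Proof. intros H K. rewrite <- (is_C_derive_unique f a d1 H). now apply is_C_derive_unique. Qed.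

Lemma holomorphic_is_derive f a : holomorphic_at f a -> is_derive f a (C_derive f a).
Proof.
  intros [r [M [hr [c Hc]]]]. pose proof (wiener_coef_is_derive a r f M c hr Hc) as H.
  now rewrite (is_C_derive_unique _ _ _ H).
Qed.

Lemma is_derive_Rcpow x c b a :
  is_derive (fun s => Rcpow x (c * s + b)) a (c * RtoC (ln x) * Rcpow x (c * a + b))%C.
Proof.
  assert (E : forall s, (Rcpow x b * Cexp (c * RtoC (ln x) * s))%C = Rcpow x (c * s + b)).
  { intros s. unfold Rcpow. rewrite <- Cexp_plus. f_equal. cring. }
  apply (is_derive_C_ext (fun s => (Rcpow x b * Cexp (c * RtoC (ln x) * s))%C)).
  { exists 1. split; [lra|]. intros z _. apply E. }
  eapply is_derive_C_eq; [|apply is_derive_C_scal, is_derive_Cexp_lin].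
  rewrite <- E. cring.
Qed.

Lemma is_derive_comp_scale (k : R) (b : C) (f : C -> C) (a l : C) :
  is_derive f (RtoC k * a + b)%C l -> is_derive (fun z => f (RtoC k * z + b)%C) a (RtoC k * l)%C.
Proof.
  intros H.
  assert (Hg : is_derive (V := AbsRing_NormedModule C_AbsRing) (fun z : C => (RtoC k * z + b)%C) a (RtoC k)).
  { assert (H1 : is_derive (fun z : C => (RtoC k * z + b)%C) a (RtoC k)); [|now apply is_derive_C_AbsRing].
    eapply is_derive_C_eq; [|apply is_derive_C_plus; [apply is_derive_C_scal, is_derive_C_id | apply is_derive_C_const]].
    cring. }
  exact (is_derive_comp (K := C_AbsRing) (V := C_NormedModule) f (fun z : C => (RtoC k * z + b)%C) a l (RtoC k) H Hg).
Qed.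

(* With [x = node 0 j]: the [s]-derivative at [0] of
   [(x - 1/2) ^ (1 - s) - (x + 1/2) ^ (1 - s) - (s - 1) x ^ (- s)]. *)
Definition zeta_increment (j : nat) : R :=
  (INR (S j) + 1/2) * ln (INR (S j) + 1/2) - (INR j + 1/2) * ln (INR j + 1/2)
  - 1 - ln (INR (S j)).

Lemma zeta_remainder_term_eq j s :
  remainder_term zeta_coef (1/4) 0 1 0 1 j s =
  (Rcpow (INR j + 1/2) (- (1) * s + 1) - Rcpow (INR (S j) + 1/2) (- (1) * s + 1)
   - (s - 1) * Rcpow (INR (S j)) (- (1) * s + 0))%C.
Proof.
  unfold remainder_term.
  replace (- (1) * s + 1)%C with (1 - s)%C by cring.
  rewrite <- zeta_inner_value, zeta_nodeE. cbn [psum]. rewrite zeta_coef_0.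
  replace (- (1) * s + 0)%C with (- (RtoC 1 * s - RtoC 0))%C by cring. simpl (_ ^ 0)%C. cring.
Qed.

Lemma zeta_remainder_term_0 j : remainder_term zeta_coef (1/4) 0 1 0 1 j 0 = RtoC 0.
Proof.
  rewrite zeta_remainder_term_eq.
  replace (- (1) * 0 + 1)%C with (RtoC (INR 1)) by (simpl (INR 1); cring).
  replace (- (1) * 0 + 0)%C with (RtoC 0) by cring. pose proof (pos_INR j).
  rewrite Rcpow_0, !Rcpow_INR, !pow_1, S_INR by (rewrite ?S_INR; lra).
  replace (INR j + 1 + 1/2) with ((INR j + 1/2) + 1) by ring. rewrite (RtoC_plus (INR j + 1/2)). cring.
Qed.

Lemma zeta_remainder_term_derive j :
  is_derive (remainder_term zeta_coef (1/4) 0 1 0 1 j) (RtoC 0) (RtoC (zeta_increment j)).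
Proof.
  apply (is_derive_C_ext (fun s => (Rcpow (INR j + 1/2) (- (1) * s + 1) - Rcpow (INR (S j) + 1/2) (- (1) * s + 1)
   - (s - 1) * Rcpow (INR (S j)) (- (1) * s + 0))%C)).
  { exists 1. split; [lra|]. intros z _. symmetry. apply zeta_remainder_term_eq. }
  eapply is_derive_C_eq.
  2:{ apply is_derive_C_minus; [apply is_derive_C_minus; apply is_derive_Rcpow|].
      apply is_derive_C_mult; [|apply is_derive_Rcpow].
      apply is_derive_C_minus; [apply is_derive_C_id | apply is_derive_C_const]. }
  replace (- (1) * 0 + 1)%C with (RtoC (INR 1)) by (simpl (INR 1); cring).
  replace (- (1) * 0 + 0)%C with (RtoC 0) by cring. pose proof (pos_INR j).
  rewrite Rcpow_0, !Rcpow_INR, !pow_1 by (rewrite ?S_INR; lra).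
  unfold zeta_increment. rewrite !RtoC_minus, !RtoC_mult. cring.
Qed.

(** The half-integer terms telescope down to [- (1/2) ln (1/2)], while the terms [ln (INR (S j))]
    add up to the logarithm of a factorial. *)
Lemma zeta_increment_sum n :
  sum_n zeta_increment n = ln 2 / 2 - stirling_seq (S n).
Proof.
  unfold stirling_seq. induction n as [|n IH].
  - rewrite rsum_O. unfold zeta_increment. simpl (fact 1). simpl (INR 0). simpl (INR 1).
    rewrite ln_1, Rplus_0_l. replace (ln (1/2)) with (- ln 2); [lra|].
    unfold Rdiv. rewrite Rmult_1_l, ln_Rinv by lra. reflexivity.
  - rewrite rsum_S, IH. unfold zeta_increment.
    rewrite (fact_simpl (S n)), mult_INR, (ln_mult (INR (S (S n)))) by (apply INR_S_pos || apply INR_fact_lt_0).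
    rewrite (S_INR (S n)). lra.
Qed.

(** Every term vanishes at 0, and the derivative is the sum of the increments. Convergence of that
    sum supplies the limit which [stirling_limit] then identifies. *)
Lemma zeta_remainder_at_0 :
  zeta_remainder 1 0 = RtoC 0 /\ is_derive (zeta_remainder 1) (RtoC 0) (RtoC (1/2 - ln PI / 2)).
Proof.
  (* Since [1/2 - 2 = - (3/2)], the radius [1/2] is the largest that the convergence condition
     allows at depth 1. *)
  assert (HN : normal_series 0 (1/2) (remainder_term zeta_coef (1/4) 0 1 0 1) (zeta_remainder 1)).
  { apply (remainder_normal zeta_coef (1/4) zeta_coef_entire ltac:(lra) (1/4) 0 1 0 ltac:(lra)
      ltac:(simpl; lra) ltac:(lra)); simpl; lra. }
  split.
  - destruct HN as [N [M [_ [_ H]]]].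
    apply (is_series_C_unique (fun j => remainder_term zeta_coef (1/4) 0 1 0 1 j 0)).
    + apply H. rewrite Cminus_diag, Cmod_0. lra.
    + eapply is_series_C_ext; [|apply is_series_C_0]. intros j. symmetry. apply zeta_remainder_term_0.
  - destruct (normal_series_derive 0 (1/2) _ _ (fun j => RtoC (zeta_increment j)) ltac:(lra) HN zeta_remainder_term_derive)
      as [D [HD Hs]].
    destruct (is_series_Re_Im _ _ Hs) as [Hr Hi].
    assert (hi : Im D = 0).
    { apply (is_series_unique) in Hi. rewrite <- Hi. apply is_series_unique.
      apply (is_series_ext (fun _ => 0)); [reflexivity|].
      apply is_series_R_eps. intros eps He. exists 0%nat. intros n _.
      rewrite sum_n_const, Rmult_0_r, Rminus_0_r, Rabs_R0. exact He. }
    assert (hl : is_lim_seq stirling_seq (ln 2 / 2 - Re D)).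
    { apply is_lim_seq_incr_1.
      apply (is_lim_seq_ext (fun n => ln 2 / 2 - sum_n zeta_increment n)).
      - intros n. rewrite zeta_increment_sum. rring.
      - apply is_lim_seq_minus'; [apply is_lim_seq_const | exact Hr]. }
    apply stirling_limit in hl.
    replace (RtoC (1/2 - ln PI / 2)) with D; [exact HD|].
    apply Ceq_parts; unfold Re, Im in *; simpl; lra.
Qed.

(** At depth 1 the recursion contains no zeta value other than the one solved for, so value and
    derivative at 0 follow from [zeta_remainder 1] alone. *)
Lemma riemann_zeta_near_0 :
  nearC 0 (fun z => (Rcpow (1/2) (- (1) * z + 1) - zeta_remainder 1 z)%C = (riemann_zeta z * (z - 1))%C).
Proof.
  assert (h0 : zeta_regular 0).
  { replace (RtoC 0) with (RtoC (2 * IZR 0)) by (f_equal; simpl; ring). apply zeta_regular_even. }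
  assert (h1 : 3/2 - 2 * INR 1 < Re 0) by (unfold Re; simpl; lra).
  eapply nearC_imp; [|exact (nearC_and _ _ _ (riemann_zeta_near 1 0 h1 h0) (nearC_neq 0 1 (not_eq_sym C1_neq0)))].
  intros z [E hz]. rewrite E. cbn [zeta_approx psum].
  replace (- (1) * z + 1)%C with (1 - z)%C by cring. field. now apply Cminus_neq0.
Qed.

Lemma riemann_zeta_0 : riemann_zeta 0 = RtoC (- (1/2)).
Proof.
  pose proof (nearC_point _ _ riemann_zeta_near_0) as H. cbv beta in H.
  destruct zeta_remainder_at_0 as [h0 _]. rewrite h0 in H.
  replace (- (1) * 0 + 1)%C with (RtoC (INR 1)) in H by (simpl (INR 1); cring).
  rewrite Rcpow_INR, pow_1 in H by lra.
  rewrite RtoC_opp. transitivity (- (riemann_zeta 0 * (0 - 1)))%C; [cring|]. rewrite <- H. cring.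
Qed.

Lemma riemann_zeta_derive_0 : is_derive riemann_zeta (RtoC 0) (RtoC (- (ln 2 + ln PI) / 2)).
Proof.
  assert (h0 : zeta_regular 0).
  { replace (RtoC 0) with (RtoC (2 * IZR 0)) by (f_equal; simpl; ring). apply zeta_regular_even. }
  pose proof (holomorphic_is_derive _ _ (riemann_zeta_holomorphic 0 h0)) as Hz.
  destruct zeta_remainder_at_0 as [_ Hr].
  pose proof (is_derive_C_mult _ _ _ _ _ Hz
     (is_derive_C_minus _ _ _ _ _ (is_derive_C_id 0) (is_derive_C_const 1 0))) as H1.
  pose proof (is_derive_C_minus _ _ _ _ _ (is_derive_Rcpow (1/2) (- (1))%C (RtoC 1) (RtoC 0)) Hr) as H2.
  apply (is_derive_C_ext _ _ _ _ riemann_zeta_near_0) in H2.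
  pose proof (is_derive_C_unique _ _ _ _ H1 H2) as E. cbv beta in E.
  rewrite riemann_zeta_0 in E.
  replace (- (1) * 0 + 1)%C with (RtoC (INR 1)) in E by (simpl (INR 1); cring).
  rewrite Rcpow_INR, pow_1 in E by lra.
  replace (ln (1/2)) with (- ln 2) in E
    by (unfold Rdiv; rewrite Rmult_1_l, ln_Rinv by lra; reflexivity).
  eapply is_derive_C_eq; [|exact Hz].
  transitivity (- (C_derive riemann_zeta 0 * (0 - 1) + RtoC (- (1/2)) * (1 - 0)) + RtoC (- (1/2)))%C.
  - cring.
  - rewrite E. apply Ceq_parts; unfold Re, Im; simpl; lra.
Qed.

(** * Conjugation symmetry and reality of the derivatives of zeta *)

Lemma Cconj_RtoC x : Cconj (RtoC x) = RtoC x.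
Proof. apply Ceq_parts; unfold Re, Im; simpl; lra. Qed.

Lemma is_series_C_conj (a : nat -> C) (l : C) :
  is_series a l -> is_series (fun n => Cconj (a n)) (Cconj l).
Proof.
  rewrite !is_series_C_eps. intros H eps He. destruct (H eps He) as [N HN]. exists N. intros n hn.
  specialize (HN n hn).
  replace (sum_n (fun n => Cconj (a n)) n) with (Cconj (sum_n a n)).
  - rewrite <- Cminus_conj, Cmod_conj. exact HN.
  - clear. induction n as [|n IH]; [rewrite !csum_O; reflexivity|].
    rewrite !csum_S, <- IH. apply Cplus_conj.
Qed.

Lemma wiener_coef_conj a r f M c :
  wiener_coef a r f M c ->
  wiener_coef (Cconj a) r (fun z => Cconj (f (Cconj z))) M (fun k => Cconj (c k)).
Proof.
  intros [H1 H2]. split.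
  - intros n. rewrite (sum_n_ext _ (fun k => Cmod (c k) * r ^ k)); [apply H1|].
    intros k. now rewrite Cmod_conj.
  - intros z Hz. eapply is_series_C_ext; [|apply is_series_C_conj, H2].
    + intros k. cbv beta. now rewrite Cmult_conj, Cpow_conj, Cminus_conj, Cconj_conj.
    + rewrite <- Cmod_conj, Cminus_conj, Cconj_conj. exact Hz.
Qed.

Lemma holomorphic_conj a f :
  holomorphic_at f a -> holomorphic_at (fun z => Cconj (f (Cconj z))) (Cconj a).
Proof.
  intros [r [M [hr [c Hc]]]]. exists r, M. split; [exact hr|].
  eexists. apply wiener_coef_conj. exact Hc.
Qed.

Lemma polar_conj a f :
  polar_at f a -> polar_at (fun z => Cconj (f (Cconj z))) (Cconj a).
Proof.
  intros [m [g [Hg [d [hd E]]]]]. exists m, (fun z => Cconj (g (Cconj z))).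
  split; [now apply holomorphic_conj|]. exists d. split; [exact hd|]. intros z hz Hz.
  assert (hz' : Cconj z <> a) by (intros e; apply hz; rewrite <- e; symmetry; apply Cconj_conj).
  rewrite E.
  - rewrite Cdiv_conj, Cpow_conj, Cminus_conj, Cconj_conj; [reflexivity|].
    now apply Cpow_minus_neq0.
  - exact hz'.
  - rewrite <- (Cconj_conj a), <- Cminus_conj, Cmod_conj. exact Hz.
Qed.

Lemma holomorphic_nearC_eq a f g :
  holomorphic_at f a -> holomorphic_at g a -> nearC' a (fun z => f z = g z) -> nearC a (fun z => f z = g z).
Proof.
  intros Hf Hg E. apply nearC'_nearC; [|exact E].
  apply (punctured_limit_unique a g); [|now apply holomorphic_punctured_limit].
  apply (punctured_limit_ext a f); [exact E | now apply holomorphic_punctured_limit].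
Qed.

(** [f] and its reflection have conjugate coefficients at a real point; uniqueness of the derivative
    makes the coefficient of index 1 real. This serves the positivity of the determinant. *)
Lemma real_symmetric_derive f x :
  holomorphic_at f (RtoC x) -> nearC' (RtoC x) (fun z => Cconj (f (Cconj z)) = f z) ->
  Im (C_derive f (RtoC x)) = 0.
Proof.
  intros Hf E. pose proof (holomorphic_conj _ _ Hf) as Hg. rewrite Cconj_RtoC in Hg.
  pose proof (holomorphic_nearC_eq _ _ _ Hg Hf E) as E'.
  destruct Hf as [r [M [hr [c Hc]]]].
  pose proof (wiener_coef_is_derive _ _ _ _ _ hr Hc) as H1.
  pose proof (wiener_coef_conj _ _ _ _ _ Hc) as Hc'. rewrite Cconj_RtoC in Hc'.
  pose proof (wiener_coef_is_derive _ _ _ _ _ hr Hc') as H2.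
  apply (is_derive_C_ext _ f _ _ E') in H2.
  rewrite (is_C_derive_unique _ _ _ H1).
  pose proof (is_derive_C_unique _ _ _ _ H1 H2) as e.
  apply (f_equal Im) in e. unfold Im, Cconj in *; simpl in e. lra.
Qed.

Lemma riemann_zeta_conj a : nearC' a (fun z => Cconj (riemann_zeta (Cconj z)) = riemann_zeta z).
Proof.
  apply (polar_identity (Re a - 1) (3/2)).
  - intros b _. rewrite <- (Cconj_conj b). apply polar_conj, riemann_zeta_polar.
  - intros b _. apply riemann_zeta_polar.
  - intros z hz. apply (is_series_C_unique (fun j => Rcpow (INR (S j)) (- z))).
    + eapply is_series_C_ext; [|apply is_series_C_conj, riemann_zeta_series].
      * intros j. cbv beta. now rewrite <- Rcpow_conj, Copp_conj, Cconj_conj.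
      * exact hz.
    + now apply riemann_zeta_series.
  - lra.
Qed.

Lemma riemann_zeta_derive_real x : zeta_regular (RtoC x) -> Im (C_derive riemann_zeta (RtoC x)) = 0.
Proof.
  intros h. apply real_symmetric_derive; [now apply riemann_zeta_holomorphic | apply riemann_zeta_conj].
Qed.

(** * Stirling numbers and the multiplicities *)

Module Stirling.

Import all_boot all_algebra Rstruct.
Import GRing.Theory.
Local Open Scope ring_scope.

Lemma stirling1_0_0 : stirling1 0 0 = 1.
Proof. by rewrite /stirling1 big_ord0 coef1. Qed.

Lemma stirling1_0_S k : stirling1 0 k.+1 = 0.
Proof. by rewrite /stirling1 big_ord0 coef1. Qed.

Lemma stirling1_S_0 n : stirling1 n.+1 0 = - (stirling1 n 0 * n%:R).
Proof. by rewrite /stirling1 big_ord_recr /= mulrBr coefB coefMX coefMC sub0r. Qed.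

Lemma stirling1_S_S n k : stirling1 n.+1 k.+1 = stirling1 n k - stirling1 n k.+1 * n%:R.
Proof. by rewrite /stirling1 big_ord_recr /= mulrBr coefB coefMX coefMC. Qed.

End Stirling.

Lemma stirling1_0_0 : stirling1 0 0 = 1.
Proof. exact Stirling.stirling1_0_0. Qed.

Lemma stirling1_0_S k : stirling1 0 (S k) = 0.
Proof. exact (Stirling.stirling1_0_S k). Qed.

Lemma stirling1_S_0 n : stirling1 (S n) 0 = - (stirling1 n 0 * INR n).
Proof. rewrite Rstruct.INRE. exact (Stirling.stirling1_S_0 n). Qed.

Lemma stirling1_S_S n k : stirling1 (S n) (S k) = stirling1 n k - stirling1 n (S k) * INR n.
Proof. rewrite Rstruct.INRE. exact (Stirling.stirling1_S_S n k). Qed.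

Fixpoint falling (x : R) (n : nat) : R :=
  match n with O => 1 | S m => falling x m * (x - INR m) end.

Lemma falling_S_left x n : falling x (S n) = x * falling (x - 1) n.
Proof.
  induction n as [|n IH]; [simpl; ring|].
  change (falling x (S (S n))) with (falling x (S n) * (x - INR (S n))).
  rewrite IH, S_INR. simpl. ring.
Qed.

Lemma falling_nat_zero m n : (m < n)%nat -> falling (INR m) n = 0.
Proof.
  intros h. induction h as [|n h IH]; simpl; [ring | rewrite IH; ring].
Qed.

Lemma falling_fact a b : falling (INR (a + b)) b * INR (fact a) = INR (fact (a + b)).
Proof.
  induction b as [|b IH]; [simpl; rewrite Nat.add_0_r; ring|].
  rewrite Nat.add_succ_r, falling_S_left, fact_simpl, mult_INR, <- IH, S_INR.
  replace (INR (a + b) + 1 - 1) with (INR (a + b)) by ring. ring.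
Qed.

Lemma stirling1_high n k : (n < k)%nat -> stirling1 n k = 0.
Proof.
  revert k. induction n as [|n IH]; intros [|k] h; try lia; [apply stirling1_0_S|].
  rewrite stirling1_S_S, !IH by lia. ring.
Qed.

Lemma stirling1_low n : stirling1 (S n) 0 = 0.
Proof.
  induction n as [|n IH]; [rewrite stirling1_S_0; simpl; ring|].
  rewrite stirling1_S_0, IH. ring.
Qed.

Lemma stirling1_1 n : stirling1 (S n) 1 = (-1) ^ n * INR (fact n).
Proof.
  induction n as [|n IH]; [rewrite stirling1_S_S, stirling1_0_0, stirling1_0_S; simpl; ring|].
  rewrite stirling1_S_S, IH, stirling1_low, fact_simpl, mult_INR. simpl (_ ^ S n). ring.
Qed.

Lemma stirling1_eval n d x : (n <= d)%nat -> sum_n (fun k => stirling1 n k * x ^ k) d = falling x n.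
Proof.
  revert d. induction n as [|n IH]; intros d h.
  - rewrite rsum_first_only; [rewrite stirling1_0_0; simpl; rring|].
    intros k. rewrite stirling1_0_S. ring.
  - destruct d as [|d]; [lia|]. cbn [falling]. rewrite <- (IH d) by lia.
    assert (E : forall d, sum_n (fun k => stirling1 (S n) k * x ^ k) (S d)
      = x * sum_n (fun k => stirling1 n k * x ^ k) d - INR n * sum_n (fun k => stirling1 n k * x ^ k) (S d) :> R).
    { clear. induction d as [|d IH].
      - rewrite !rsum_S, !rsum_O, stirling1_S_0, stirling1_S_S. simpl. rring.
      - rewrite rsum_S, IH, stirling1_S_S, (rsum_S _ (S d)), (rsum_S _ d).
        change (x ^ S (S d)) with (x * (x ^ S d)). rring. }
    rewrite E, (rsum_S (fun k => stirling1 n k * x ^ k)), (stirling1_high n (S d)) by lia. rring.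
Qed.

(* [falling (y + m) (2 m + 1) = y (y^2 - 1) ... (y^2 - m^2)]. *)
Lemma falling_symmetric_S y m :
  falling (y + INR (S m)) (2 * S m + 1) = (y ^ 2 - INR (S m) ^ 2) * falling (y + INR m) (2 * m + 1).
Proof.
  replace (2 * S m + 1)%nat with (S (S (2 * m + 1))) by lia.
  rewrite falling_S_left. replace (y + INR (S m) - 1) with (y + INR m) by (rewrite S_INR; ring).
  cbn [falling]. rewrite plus_INR, mult_INR, !S_INR. simpl. ring.
Qed.

Lemma falling_symmetric_even m : exists p : nat -> R, forall y,
  y * falling (y + INR m) (2 * m + 1) = sum_n (fun i => p i * y ^ (2 * i)) (S m).
Proof.
  induction m as [|m [p Hp]].
  - exists (fun i => match i with 1%nat => 1 | _ => 0 end). intros y.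
    rewrite rsum_S, rsum_O. simpl. rring.
  - set (c := INR (S m) ^ 2).
    (* Coefficients of the product with [y ^ 2 - c]. The test cuts off at the old degree, because
       nothing is known about [p] beyond index [S m]. *)
    exists (fun i => match i with O => - c * p O | S k => p k - c * (if Nat.leb (S k) (S m) then p (S k) else 0) end).
    intros y. rewrite falling_symmetric_S. fold c.
    transitivity ((y ^ 2 - c) * (y * falling (y + INR m) (2 * m + 1))); [ring|]. rewrite Hp.
    assert (E : forall d, (d <= m)%nat ->
      sum_n (fun i => match i with O => - c * p O | S k => p k - c * (if Nat.leb (S k) (S m) then p (S k) else 0) end * y ^ (2 * i)) (S d)
      = y ^ 2 * sum_n (fun i => p i * y ^ (2 * i)) d - c * sum_n (fun i => p i * y ^ (2 * i)) (S d) :> R).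
    { induction d as [|d IH]; intros hd.
      - rewrite !rsum_S, !rsum_O. replace (Nat.leb 1 (S m)) with true by reflexivity. simpl. rring.
      - rewrite rsum_S, IH by lia. rewrite (rsum_S _ (S d)), (rsum_S _ d).
        replace (Nat.leb (S (S d)) (S m)) with true by (symmetry; apply Nat.leb_le; lia).
        replace (2 * S (S d))%nat with (2 * S d + 2)%nat by lia. rewrite (pow_add y (2 * S d) 2).
        rring. }
    rewrite (rsum_S _ (S m)), E by lia.
    replace (Nat.leb (S (S m)) (S m)) with false by (symmetry; apply Nat.leb_gt; lia).
    replace (2 * S (S m))%nat with (2 * S m + 2)%nat by lia. rewrite (pow_add y (2 * S m) 2).
    rewrite (rsum_S (fun i => p i * y ^ (2 * i)) m). rring.
Qed.

(* The multiplicities on the sphere of dimension [2 n + 1] as a polynomial in [y = k + n]. *)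
Definition mult_poly (n : nat) (y : R) : R :=
  2 * (y * falling (y + INR (n - 1)) (2 * n - 1)) / INR (fact (2 * n)).

Lemma mult_poly_even n : (1 <= n)%nat -> exists p : nat -> R, forall y,
  mult_poly n y = sum_n (fun i => p i * y ^ (2 * i)) n.
Proof.
  intros h. destruct n as [|m]; [lia|].
  destruct (falling_symmetric_even m) as [p Hp].
  exists (fun i => 2 / INR (fact (2 * S m)) * p i). intros y. unfold mult_poly.
  replace (S m - 1)%nat with m by lia. replace (2 * S m - 1)%nat with (2 * m + 1)%nat by lia.
  rewrite Hp. symmetry.
  rewrite (sum_n_ext _ (fun i => 2 / INR (fact (2 * S m)) * (p i * y ^ (2 * i)))) by (intros; cbv beta; unfold Rdiv; rring).
  rewrite rsum_mult_l. unfold Rdiv. rring.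
Qed.

Lemma mult_poly_opp n y : (1 <= n)%nat -> mult_poly n (- y) = mult_poly n y.
Proof.
  intros h. destruct (mult_poly_even n h) as [p Hp]. rewrite !Hp. apply sum_n_ext. intros i.
  rewrite !pow_mult. replace ((- y) ^ 2) with (y ^ 2) by ring. reflexivity.
Qed.

Lemma sphere_multiplicity_poly n k : (1 <= n)%nat -> (1 <= k)%nat ->
  sphere_multiplicity (2 * n + 1) k = mult_poly n (INR (k + n)).
Proof.
  intros hn hk. unfold sphere_multiplicity, mult_poly.
  replace (k + (2 * n + 1) - 2)%nat with (k + (2 * n - 1))%nat by lia.
  replace (2 * n + 1 - 1)%nat with (2 * n)%nat by lia.
  rewrite <- (falling_fact k (2 * n - 1)).
  replace (INR (k + n) + INR (n - 1)) with (INR (k + (2 * n - 1))) by (rewrite <- plus_INR; f_equal; lia).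
  pose proof (INR_fact_lt_0 k). pose proof (INR_fact_lt_0 (2 * n)).
  rewrite !(plus_INR _ n), plus_INR, mult_INR. simpl (INR 1). simpl (INR 2). field. lra.
Qed.

(** Together with [mult_poly_top]: a sum of [mult_poly n (i - n)] over [i > 2 n] is extended to all
    [i >= 1] at the cost of the single term [i = 2 n], of weight 1. *)
Lemma mult_poly_shift_zero n m : (1 <= n)%nat -> (1 <= m < 2 * n)%nat -> mult_poly n (INR m - INR n) = 0.
Proof.
  intros hn hm. unfold mult_poly.
  replace (INR m - INR n + INR (n - 1)) with (INR (m - 1)) by (rewrite !minus_INR by lia; ring).
  rewrite falling_nat_zero by lia. unfold Rdiv. ring.
Qed.

Lemma mult_poly_top n : (1 <= n)%nat -> mult_poly n (INR n) = 1.
Proof.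
  intros hn. unfold mult_poly.
  replace (INR n + INR (n - 1)) with (INR (0 + (2 * n - 1))) by (rewrite <- plus_INR; f_equal; lia).
  pose proof (falling_fact 0 (2 * n - 1)) as h. simpl (fact 0) in h. simpl (INR 1) in h. rewrite Rmult_1_r in h.
  rewrite h. replace (2 * n)%nat with (S (2 * n - 1)) at 2 by lia. rewrite fact_simpl, mult_INR.
  change (0 + (2 * n - 1))%nat with (2 * n - 1)%nat.
  replace (INR (S (2 * n - 1))) with (2 * INR n)
    by (replace (S (2 * n - 1)) with (2 * n)%nat by lia; rewrite mult_INR; reflexivity).
  pose proof (INR_fact_lt_0 (2 * n - 1)). assert (0 < INR n) by (apply lt_0_INR; lia).
  field. lra.
Qed.

Definition sphere_coef (n i : nat) : R :=
  (stirling1 (2 * n) i + stirling1 (2 * n + 1) (i + 1)) / INR (fact (2 * n)).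

(** The factor [2 (x - n)] splits as [x + (x - 2 n)]. The factor [x] turns
    [(x - 1) ... (x - 2 n + 1)] into the falling factorial of length [2 n]; the factor [x - 2 n]
    turns it into that of length [2 n + 1] divided by [x]. Hence the two Stirling numbers, the
    second with shifted index. *)
Lemma mult_poly_stirling n x : (1 <= n)%nat -> x <> 0 ->
  mult_poly n (x - INR n) = sum_n (fun i => sphere_coef n i * x ^ i) (2 * n).
Proof.
  intros hn hx. pose proof (INR_fact_lt_0 (2 * n)) as hf.
  assert (h1 : sum_n (fun k => stirling1 (2 * n) k * x ^ k) (2 * n) = x * falling (x - 1) (2 * n - 1)).
  { rewrite stirling1_eval by lia. rewrite <- falling_S_left. f_equal. lia. }
  assert (h2 : x * sum_n (fun k => stirling1 (2 * n + 1) (k + 1) * x ^ k) (2 * n)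
     = x * (falling (x - 1) (2 * n - 1) * (x - 2 * INR n))).
  { pose proof (stirling1_eval (2 * n + 1) (2 * n + 1) x ltac:(lia)) as e.
    replace (2 * n + 1)%nat with (S (2 * n)) in e by lia.
    rewrite falling_S_left in e.
    replace (falling (x - 1) (2 * n)) with (falling (x - 1) (2 * n - 1) * (x - 2 * INR n)) in e.
    - rewrite <- e. clear. replace (2 * n + 1)%nat with (S (2 * n)) by lia.
      assert (E : forall d, x * sum_n (fun k => stirling1 (S (2 * n)) (k + 1) * x ^ k) d
        = sum_n (fun k => stirling1 (S (2 * n)) k * x ^ k) (S d) :> R).
      { induction d as [|d IH].
        - rewrite rsum_S, !rsum_O, stirling1_low. simpl. rring.
        - rewrite (rsum_S _ (S d)), <- IH, rsum_S. replace (S d + 1)%nat with (S (S d)) by lia. simpl. rring. }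
      apply E.
    - replace (2 * n)%nat with (S (2 * n - 1)) at 2 by lia. cbn [falling].
      rewrite minus_INR, mult_INR by lia. simpl (INR 2). simpl (INR 1). ring. }
  apply Rmult_eq_reg_l in h2; [|exact hx].
  unfold sphere_coef.
  rewrite (sum_n_ext _ (fun i => / INR (fact (2 * n)) * (stirling1 (2 * n) i * x ^ i + stirling1 (2 * n + 1) (i + 1) * x ^ i)))
    by (intros; unfold Rdiv; rring).
  rewrite rsum_mult_l, rsum_plus, h1, h2. unfold mult_poly.
  replace (x - INR n + INR (n - 1)) with (x - 1) by (rewrite minus_INR by lia; simpl; ring).
  unfold Rdiv. rring.
Qed.

(** By evenness the first summand is [mult_poly n (- x - n)], so the two summands are one polynomial
    at [- x] and at [x], and its odd powers cancel. *)
Lemma mult_poly_average n x : (1 <= n)%nat -> x <> 0 ->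
  mult_poly n (x + INR n) + mult_poly n (x - INR n) = 2 * sum_n (fun i => sphere_coef n (2 * i) * x ^ (2 * i)) n.
Proof.
  intros hn hx. rewrite <- (mult_poly_opp n (x + INR n) hn).
  replace (- (x + INR n)) with (- x - INR n) by ring.
  rewrite !mult_poly_stirling by (try assumption; lra).
  set (c := sphere_coef n). clearbody c. clear hn hx. generalize n. clear n.
  induction n as [|n IH].
  - change (2 * 0)%nat with 0%nat. rewrite !rsum_O. simpl. rring.
  - replace (2 * S n)%nat with (S (S (2 * n))) at 1 2 by lia. rewrite !rsum_S.
    assert (e1 : (- x) ^ S (2 * n) = - x ^ S (2 * n)).
    { change ((- x) * (- x) ^ (2 * n) = - (x * x ^ (2 * n))). rewrite !pow_mult. replace ((- x) ^ 2) with (x ^ 2) by ring. ring. }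
    assert (e2 : (- x) ^ S (S (2 * n)) = x ^ S (S (2 * n))).
    { change ((- x) ^ S (S (2 * n))) with (- x * (- x) ^ S (2 * n)). rewrite e1. simpl. ring. }
    rewrite e1, e2. replace (S (S (2 * n))) with (2 * S n)%nat by lia.
    transitivity ((sum_n (fun i => c i * (- x) ^ i) (2 * n) + sum_n (fun i => c i * x ^ i) (2 * n))
       + 2 * (c (2 * S n)%nat * x ^ (2 * S n))); [rring|]. rewrite IH. rring.
Qed.

(** [s(2 n, 0) = 0] and [s(2 n + 1, 1) = (2 n)!], so the term [k = 0] of the averaged series is
    exactly [zeta (2 s)]. *)
Lemma sphere_coef_0 n : (1 <= n)%nat -> sphere_coef n 0 = 1.
Proof.
  intros h. unfold sphere_coef. destruct n as [|m]; [lia|].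
  replace (stirling1 (2 * S m) 0) with 0
    by (replace (2 * S m)%nat with (S (2 * m + 1)) by lia; symmetry; apply stirling1_low).
  replace (2 * S m + 1)%nat with (S (2 * S m)) by lia. change (0 + 1)%nat with 1%nat. rewrite stirling1_1, pow_1_even.
  pose proof (INR_fact_lt_0 (2 * S m)). field. lra.
Qed.

(** * The spectral zeta function of the sphere *)

Lemma wiener_minus a r f g M N :
  0 <= r -> wiener a r f M -> wiener a r g N -> wiener a r (fun z => (f z - g z)%C) (M + N).
Proof.
  intros hr Hf Hg. apply (wiener_ext a r (fun z => (f z + (- (1)) * g z)%C)); [intros; cring|].
  eapply wiener_mono; [|apply wiener_plus; [exact hr | exact Hf | apply wiener_scal, Hg]].
  rewrite Cmod_m1. lra.
Qed.

Lemma RtoC_sum (a : nat -> R) n : RtoC (sum_n a n) = psum (fun i => RtoC (a i)) (S n).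
Proof.
  induction n as [|n IH]; [rewrite rsum_O; simpl; cring|].
  rewrite rsum_S, RtoC_plus, IH. reflexivity.
Qed.

Lemma psum_mult_r (a : nat -> C) (c : C) L : (psum a L * c)%C = psum (fun i => (a i * c)%C) L.
Proof. induction L as [|L IH]; simpl; [cring|]. rewrite <- IH. cring. Qed.

Lemma psum_mult_l (a : nat -> C) (c : C) L : (c * psum a L)%C = psum (fun i => (c * a i)%C) L.
Proof. induction L as [|L IH]; simpl; [cring|]. rewrite <- IH. cring. Qed.

Lemma Rcpow_even_shift x m s : 0 < x ->
  (RtoC (x ^ m) * Rcpow x (- (RtoC 2 * s)))%C = Rcpow x (- (RtoC 2 * s - RtoC (INR m))).
Proof.
  intros hx. rewrite <- Rcpow_INR, <- Rcpow_plus by exact hx. f_equal. cring.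
Qed.

(** With [x = k + n] and [u = n / x] one has [k = x (1 - u)], [k + 2 n = x (1 + u)] and eigenvalue
    [x^2 (1 - u^2)]. These are the coefficients of [u ^ (2 l)] in the even part of [(1 - u)^(- 2 s)]
    minus [(1 - u^2)^(- s)]. *)
Definition sphere_family (l : nat) (s : C) : C :=
  (rising (RtoC 2 * s + 0) (2 * l) - rising (RtoC 1 * s + 0) l)%C.

Lemma sphere_family_entire y : 0 < y < 1 -> entire_family sphere_family (y ^ 2).
Proof.
  intros hy a r hr.
  set (A1 := 2 * (r + Cmod a) + Cmod 0 + 1). set (A2 := 1 * (r + Cmod a) + Cmod 0 + 1).
  pose proof (Cmod_ge_0 a) as ha.
  assert (h1 : 0 < A1) by (unfold A1; rewrite Cmod_0; lra).
  assert (h2 : 0 < A2) by (unfold A2; rewrite Cmod_0; lra).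
  destruct (risingR_series A1 y h1 hy) as [B1 HB1].
  destruct (risingR_series A2 (y ^ 2) h2) as [B2 HB2]; [simpl; nra|].
  exists (fun l => risingR A1 (2 * l) + risingR A2 l), (B1 + B2). split.
  - intros l. apply wiener_minus; [lra | apply wiener_rising; lra | apply wiener_rising; lra].
  - intros n.
    rewrite (sum_n_ext _ (fun l => (fun k => risingR A1 k * y ^ k) (2 * l)%nat + risingR A2 l * (y ^ 2) ^ l)).
    + rewrite rsum_plus. apply Rplus_le_compat; [|apply HB2].
      eapply Rle_trans; [|apply (HB1 (2 * n)%nat)].
      apply (rsum_even_le (fun k => risingR A1 k * y ^ k)). intros k.
      apply Rmult_le_pos; [left; now apply risingR_pos | apply pow_le; lra].
    + intros l. cbv beta. rewrite pow_mult. rring.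
Qed.

Section Sphere.

Variable (n : nat).
Hypothesis (hn : (1 <= n)%nat).

(** The largest value of [n / x] over the nodes [x > n]; its being below 1 makes the binomial
    expansions converge uniformly in the node. *)
Definition sphere_ratio : R := INR n / INR (S n).

Lemma sphere_ratio_bounds : 0 < sphere_ratio < 1.
Proof.
  unfold sphere_ratio. assert (0 < INR n) by (apply lt_0_INR; lia). rewrite S_INR.
  split; [apply Rdiv_lt_0_compat; lra|]. apply Rmult_lt_reg_r with (INR n + 1); [lra|].
  unfold Rdiv. rewrite Rmult_assoc, Rinv_l by lra. lra.
Qed.

Definition sphere_inner := inner sphere_family (INR n ^ 2) n.
Definition sphere_remainder (m : nat) := remainder sphere_family (INR n ^ 2) n 2 (2 * INR m).

Lemma sphere_inner_value j s :
  (Rcpow (node n j) (- (RtoC 2 * s)) * sphere_inner j s)%C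
  = (/ RtoC 2 * Rcpow (INR (S j)) (- (RtoC 2 * s)) + / RtoC 2 * Rcpow (INR (S j + 2 * n)) (- (RtoC 2 * s))
     - Rcpow (sphere_eigenvalue (2 * n + 1) (S j)) (- s))%C.
Proof.
  set (x := node n j).
  assert (hN : 0 < INR n) by (apply lt_0_INR; lia).
  pose proof (INR_S_pos j) as hj.
  assert (ex : x = INR (S j) + INR n) by (unfold x, node; apply plus_INR).
  set (u := INR n / x).
  assert (xu : x * u = INR n) by (unfold u; field; lra).
  assert (hu : 0 < u < 1).
  { unfold u. split; [apply Rdiv_lt_0_compat; lra|]. apply Rmult_lt_reg_r with x; [lra|].
    unfold Rdiv. rewrite Rmult_assoc, Rinv_l by lra. lra. }
  set (b := (RtoC 2 * s + 0)%C).
  pose proof (is_series_rising b u ltac:(rewrite Rabs_pos_eq; lra)) as H1.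
  pose proof (is_series_rising b (- u) ltac:(rewrite Rabs_left; lra)) as H2.
  pose proof (is_series_rising (RtoC 1 * s + 0) (u ^ 2) ltac:(rewrite Rabs_pos_eq; simpl; nra)) as H3.
  pose proof (is_series_C_plus _ _ _ _ H1 H2) as H. cbv beta in H.
  apply is_series_C_even in H.
  2:{ intros k. rewrite RtoC_opp, !Cpow_add_r, !Cpow_mult_r, !Cpow_1_r.
      replace ((- RtoC u) ^ 2)%C with (RtoC u ^ 2)%C by (simpl; cring). cring. }
  apply (is_series_C_scal (/ RtoC 2)%C) in H.
  pose proof (is_series_C_minus _ _ _ _ H H3) as K. cbv beta in K.
  assert (HI : sphere_inner j s = (/ RtoC 2 * (Rcpow (1 - u) (- b) + Rcpow (1 - - u) (- b))
                                   - Rcpow (1 - u ^ 2) (- (RtoC 1 * s + 0)))%C).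
  { apply C_series_unique. eapply is_series_C_ext; [|exact K]. intros k. cbv beta.
    unfold sphere_family. fold b. fold x.
    replace (INR n ^ 2 / x ^ 2) with (u ^ 2) by (unfold u; field; lra).
    rewrite RtoC_opp, !Cpow_mult_r. replace ((- RtoC u) ^ 2)%C with (RtoC u ^ 2)%C by (simpl; cring).
    rewrite RtoC_pow. field. }
  rewrite HI.
  replace (INR (S j)) with (x * (1 - u)) by lra.
  replace (INR (S j + 2 * n)) with (x * (1 - - u))
    by (rewrite plus_INR, mult_INR; simpl (INR 2); lra).
  replace (sphere_eigenvalue (2 * n + 1) (S j)) with (x * x * (1 - u ^ 2)).
  2:{ unfold sphere_eigenvalue. rewrite plus_INR, mult_INR. simpl (INR 2). simpl (INR 1).
      replace (x * x * (1 - u ^ 2)) with (x * x - (x * u) * (x * u)) by ring. rewrite xu, ex. ring. }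
  assert (h2 : 0 < 1 - u ^ 2) by (simpl; nra).
  rewrite !Rcpow_mult_base by (try apply Rmult_lt_0_compat; lra).
  replace (- b)%C with (- (RtoC 2 * s))%C by (unfold b; cring).
  replace (- (RtoC 1 * s + 0))%C with (- s)%C by cring.
  replace (- (RtoC 2 * s))%C with (- s + - s)%C at 1 by cring.
  rewrite <- Rcpow_plus.
  replace (- s + - s)%C with (- (RtoC 2 * s))%C by cring. cring.
Qed.

(** The nodes [x = k + n] start at [n + 1], so the first [n] terms of zeta are removed; they are
    entire and affect no pole. *)
Definition zeta_tail (t : C) : C :=
  (riemann_zeta t - psum (fun i => Rcpow (INR (S i)) (- t)) n)%C.

Lemma zeta_tail_series t : 3/2 < Re t -> is_series (fun j => Rcpow (node n j) (- t)) (zeta_tail t).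
Proof.
  intros ht. eapply is_series_C_ext; [|apply (is_series_C_tail _ _ n (riemann_zeta_series t ht))].
  intros j. cbv beta. unfold node. do 2 f_equal. lia.
Qed.

Lemma holomorphic_zeta_head a : holomorphic_at (fun t => psum (fun i => Rcpow (INR (S i)) (- t)) n) a.
Proof.
  apply (holomorphic_psum a (fun i t => Rcpow (INR (S i)) (- t))). intros i _.
  replace (fun t => Rcpow (INR (S i)) (- t)) with (fun t => Rcpow (INR (S i)) (- (1) * t + 0)%C)
    by (apply functional_extensionality; intros t; f_equal; cring).
  apply holomorphic_Rcpow.
Qed.

Lemma zeta_tail_polar a : polar_at zeta_tail a.
Proof. apply polar_minus; [apply riemann_zeta_polar | apply holomorphic_polar, holomorphic_zeta_head]. Qed.

Lemma zeta_tail_holomorphic a : zeta_regular a -> holomorphic_at zeta_tail a.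
Proof. intros h. apply holomorphic_minus; [now apply riemann_zeta_holomorphic | apply holomorphic_zeta_head]. Qed.

Definition correction_term (m l : nat) (s : C) : C :=
  (sphere_family l s * RtoC (INR n ^ 2) ^ l
   * zeta_tail (RtoC 2 * s - RtoC (2 * INR m) + RtoC (2 * INR l)))%C.

(* Continuation of [\sum_x x ^ (2 m - 2 s) \sum_l Q_l(s) (n / x) ^ (2 l)] over [x > n]. *)
Definition sphere_correction (m L : nat) (s : C) : C :=
  (psum (fun l => correction_term m l s) L + sphere_remainder m L s)%C.

Lemma sphere_weight_bound : INR n ^ 2 <= sphere_ratio ^ 2 * INR (S n) ^ 2.
Proof.
  rewrite <- Rpow_mult_distr. apply Req_le. f_equal. unfold sphere_ratio. field. apply INR_S_neq0.
Qed.

Lemma sphere_ratio2_pos : 0 < sphere_ratio ^ 2.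
Proof. apply pow_lt, sphere_ratio_bounds. Qed.

Lemma sphere_correction_series m L s : 3/2 < 2 * Re s - 2 * INR m ->
  is_series (fun j => (Rcpow (node n j) (- (RtoC 2 * s - RtoC (2 * INR m))) * sphere_inner j s)%C)
    (sphere_correction m L s).
Proof.
  intros h.
  exact (remainder_expand sphere_family (sphere_ratio ^ 2) (sphere_family_entire _ sphere_ratio_bounds)
    sphere_ratio2_pos (INR n ^ 2) n 2 (2 * INR m) (pow2_ge_0 _) sphere_weight_bound ltac:(lra)
    zeta_tail L s zeta_tail_series h).
Qed.

Lemma sphere_remainder_normal m L a r :
  0 < r -> 2 * INR m - 2 * Re a + 2 * r - 2 * INR L <= - (3/2) ->
  normal_series a r (remainder_term sphere_family (INR n ^ 2) n 2 (2 * INR m) L) (sphere_remainder m L).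
Proof.
  intros hr h.
  exact (remainder_normal sphere_family (sphere_ratio ^ 2) (sphere_family_entire _ sphere_ratio_bounds)
    sphere_ratio2_pos (INR n ^ 2) n 2 (2 * INR m) (pow2_ge_0 _) sphere_weight_bound ltac:(lra) L a r hr h).
Qed.

Lemma sphere_remainder_holomorphic m L a :
  2 * INR m - 2 * Re a - 2 * INR L < - (3/2) -> holomorphic_at (sphere_remainder m L) a.
Proof.
  intros h.
  exact (remainder_holomorphic sphere_family (sphere_ratio ^ 2) (sphere_family_entire _ sphere_ratio_bounds)
    sphere_ratio2_pos (INR n ^ 2) n 2 (2 * INR m) (pow2_ge_0 _) sphere_weight_bound ltac:(lra) L a h).
Qed.

Lemma sphere_family_holomorphic l a : holomorphic_at (sphere_family l) a.
Proof. exact (entire_family_holomorphic _ _ l a (sphere_family_entire _ sphere_ratio_bounds)). Qed.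

Lemma comp_scale_eq (f : C -> C) (b : C) (c : C) :
  (fun s => f (RtoC 2 * s - b + c)%C) = (fun s => f (RtoC 2 * s + (c - b))%C).
Proof. apply functional_extensionality. intros s. f_equal. cring. Qed.

Lemma sphere_correction_polar m L a :
  2 * INR m - 2 * Re a - 2 * INR L < - (3/2) -> polar_at (sphere_correction m L) a.
Proof.
  intros h. apply polar_plus; [|now apply holomorphic_polar, sphere_remainder_holomorphic].
  apply (polar_psum a (correction_term m)). intros l _. unfold correction_term. apply polar_mult.
  - apply holomorphic_polar, holomorphic_mult; [apply sphere_family_holomorphic | apply holomorphic_const].
  - rewrite comp_scale_eq. apply polar_comp_scale; [lra | apply zeta_tail_polar].
Qed.

Lemma sphere_correction_holomorphic m L a :
  2 * INR m - 2 * Re a - 2 * INR L < - (3/2) ->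
  (forall l, zeta_regular (RtoC 2 * a - RtoC (2 * INR m) + RtoC (2 * INR l))%C) ->
  holomorphic_at (sphere_correction m L) a.
Proof.
  intros h hreg. apply holomorphic_plus; [|now apply sphere_remainder_holomorphic].
  apply (holomorphic_psum a (correction_term m)). intros l _. unfold correction_term. apply holomorphic_mult.
  - apply holomorphic_mult; [apply sphere_family_holomorphic | apply holomorphic_const].
  - rewrite comp_scale_eq. apply holomorphic_comp_scale; [lra|]. apply zeta_tail_holomorphic.
    replace (RtoC 2 * a + (RtoC (2 * INR l) - RtoC (2 * INR m)))%C
      with (RtoC 2 * a - RtoC (2 * INR m) + RtoC (2 * INR l))%C by cring. apply hreg.
Qed.

Variable (p : nat -> R).
Hypothesis (hp : forall y, mult_poly n y = sum_n (fun i => p i * y ^ (2 * i)) n).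

Definition main_term (k : nat) (s : C) : C :=
  (RtoC (sphere_coef n (2 * k)) * riemann_zeta (RtoC 2 * s + RtoC (- (2 * INR k))))%C.

(** The averaged series with its boundary term, minus the corrections weighted by the coefficients
    [p m] of the even multiplicity polynomial. Only the corrections depend on the depth [L]. *)
Definition sphere_approx (L : nat) (s : C) : C :=
  (psum (fun k => main_term k s) (S n)
   - / RtoC 2 * Rcpow (INR (2 * n)) (- RtoC 2 * s + 0)
   - psum (fun m => RtoC (p m) * sphere_correction m L s) (S n))%C.

Lemma correction_total_series L s : INR n + 1 < Re s ->
  is_series (fun j => (RtoC (mult_poly n (node n j)) * (Rcpow (node n j) (- (RtoC 2 * s)) * sphere_inner j s))%C)
    (psum (fun m => RtoC (p m) * sphere_correction m L s) (S n))%C.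
Proof.
  intros hs.
  apply (is_series_C_ext (fun j => psum (fun m => (RtoC (p m) *
     (Rcpow (node n j) (- (RtoC 2 * s - RtoC (2 * INR m))) * sphere_inner j s))%C) (S n))).
  - intros j. rewrite hp, RtoC_sum, psum_mult_r. apply psum_ext. intros m _.
    rewrite (RtoC_mult (p m)). pose proof (node_ge1 n j).
    replace (2 * INR m) with (INR (2 * m)) by (rewrite mult_INR; reflexivity).
    rewrite <- Rcpow_even_shift by lra. cring.
  - apply (is_series_C_psum (fun j m => (RtoC (p m) *
     (Rcpow (node n j) (- (RtoC 2 * s - RtoC (2 * INR m))) * sphere_inner j s))%C)).
    intros m hm. apply is_series_C_scal, sphere_correction_series.
    assert (INR m <= INR n) by (apply le_INR; lia). lra.
Qed.

(** Half of the sum is over [i = k] with weight [P (i + n)], the other half over [i = k + 2 n] with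
    weight [P (i - n)]. Completing the second to all [i >= 1] adds the term [i = 2 n], after which
    the weights combine to the even polynomial of [mult_poly_average]. *)
Lemma main_total_series s : INR n + 1 < Re s ->
  is_series (fun j => (RtoC (mult_poly n (node n j)) *
     (/ RtoC 2 * Rcpow (INR (S j)) (- (RtoC 2 * s)) + / RtoC 2 * Rcpow (INR (S j + 2 * n)) (- (RtoC 2 * s))))%C)
    (psum (fun k => main_term k s) (S n)
     - / RtoC 2 * Rcpow (INR (2 * n)) (- RtoC 2 * s + 0))%C.
Proof.
  intros hs.
  set (hp_ := fun i => (RtoC (mult_poly n (INR (S i) + INR n)) * (/ RtoC 2 * Rcpow (INR (S i)) (- (RtoC 2 * s))))%C).
  set (hm_ := fun i => (RtoC (mult_poly n (INR (S i) - INR n)) * (/ RtoC 2 * Rcpow (INR (S i)) (- (RtoC 2 * s))))%C).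
  set (T := psum (fun k => main_term k s) (S n)).
  set (Hm := psum (fun i => (/ RtoC 2 * RtoC (sphere_coef n i)) * riemann_zeta (RtoC 2 * s - RtoC (INR i)))%C (S (2 * n))).
  assert (two : RtoC 2 <> RtoC 0) by (intros e; apply RtoC_inj in e; lra).
  assert (ReE : forall x, Re (RtoC 2 * s - RtoC x)%C = 2 * Re s - x) by (intros x; unfold Re; simpl; ring).
  assert (Sm : is_series hm_ Hm).
  { apply (is_series_C_ext (fun j => psum (fun i => (/ RtoC 2 * RtoC (sphere_coef n i)) *
        Rcpow (INR (S j)) (- (RtoC 2 * s - RtoC (INR i))))%C (S (2 * n)))).
    - intros j. unfold hm_. rewrite mult_poly_stirling by (try assumption; apply INR_S_neq0).
      rewrite RtoC_sum, psum_mult_r. apply psum_ext. intros i _.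
      rewrite (RtoC_mult (sphere_coef n i)), <- Rcpow_even_shift by apply INR_S_pos. cring.
    - apply (is_series_C_psum (fun j i => (/ RtoC 2 * RtoC (sphere_coef n i) *
        Rcpow (INR (S j)) (- (RtoC 2 * s - RtoC (INR i))))%C)).
      intros i hi. apply is_series_C_scal, riemann_zeta_series. rewrite ReE.
      assert (INR i <= INR (2 * n)) by (apply le_INR; lia). rewrite mult_INR in *. simpl (INR 2) in *. lra. }
  assert (St : is_series (fun i => (hp_ i + hm_ i)%C) T).
  { apply (is_series_C_ext (fun j => psum (fun k => RtoC (sphere_coef n (2 * k)) *
        Rcpow (INR (S j)) (- (RtoC 2 * s + RtoC (- (2 * INR k)))))%C (S n))).
    - intros j. unfold hp_, hm_.
      transitivity (RtoC (mult_poly n (INR (S j) + INR n) + mult_poly n (INR (S j) - INR n))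
          * (/ RtoC 2 * Rcpow (INR (S j)) (- (RtoC 2 * s))))%C; [|rewrite RtoC_plus; cring].
      rewrite mult_poly_average by (try assumption; apply INR_S_neq0).
      rewrite RtoC_mult.
      transitivity (RtoC (sum_n (fun i => (sphere_coef n (2 * i) * INR (S j) ^ (2 * i))%R) n) * Rcpow (INR (S j)) (- (RtoC 2 * s)))%C;
        [|field; exact two].
      rewrite RtoC_sum, psum_mult_r. apply psum_ext. intros k _.
      replace (RtoC 2 * s + RtoC (- (2 * INR k)))%C with (RtoC 2 * s - RtoC (INR (2 * k)))%C
        by (rewrite mult_INR, RtoC_opp; change (INR 2) with 2; cring).
      rewrite <- Rcpow_even_shift, (RtoC_mult (sphere_coef n (2 * k))) by apply INR_S_pos. cring.
    - apply (is_series_C_psum (fun j k => (RtoC (sphere_coef n (2 * k)) *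
        Rcpow (INR (S j)) (- (RtoC 2 * s + RtoC (- (2 * INR k)))))%C)).
      intros k hk. apply is_series_C_scal, riemann_zeta_series.
      replace (RtoC 2 * s + RtoC (- (2 * INR k)))%C with (RtoC 2 * s - RtoC (2 * INR k))%C
        by (rewrite RtoC_opp; cring).
      rewrite ReE. assert (INR k <= INR n) by (apply le_INR; lia). lra. }
  pose proof (is_series_C_tail _ _ (2 * n) Sm) as S2.
  (* Index [i] stands for the base [i + 1]: among the bases [1, ..., 2 n] only the last has nonzero
     weight. *)
  assert (Ehead : psum hm_ (2 * n) = (/ RtoC 2 * Rcpow (INR (2 * n)) (- RtoC 2 * s + 0))%C).
  { assert (Z : forall L, (L < 2 * n)%nat -> psum hm_ L = RtoC 0).
    { induction L as [|L IH]; intros hL; [reflexivity|]. cbn [psum]. rewrite IH by lia.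
      unfold hm_. rewrite mult_poly_shift_zero by lia. cring. }
    replace (2 * n)%nat with (S (2 * n - 1)) at 1 by lia. cbn [psum]. rewrite Z by lia.
    unfold hm_. replace (S (2 * n - 1)) with (2 * n)%nat by lia.
    replace (INR (2 * n) - INR n) with (INR n) by (rewrite mult_INR; simpl (INR 2); ring).
    rewrite mult_poly_top by exact hn.
    replace (- RtoC 2 * s + 0)%C with (- (RtoC 2 * s))%C by cring. cring. }
  rewrite Ehead in S2.
  (* The series of [hp_] is recovered as the completed sum minus that of [hm_]; the tail of [hm_]
     then runs over the bases from [2 n + 1] on. *)
  pose proof (is_series_C_plus _ _ _ _ (is_series_C_minus _ _ _ _ St Sm) S2) as S3. cbv beta in S3.
  replace (T - / RtoC 2 * Rcpow (INR (2 * n)) (- RtoC 2 * s + 0))%C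
    with (T - Hm + (Hm - / RtoC 2 * Rcpow (INR (2 * n)) (- RtoC 2 * s + 0)))%C by cring.
  eapply is_series_C_ext; [|exact S3]. intros j. unfold hp_, hm_.
  replace (S (2 * n + j)) with (S j + 2 * n)%nat by lia.
  replace (INR (S j + 2 * n) - INR n) with (INR (S j) + INR n)
    by (rewrite plus_INR, mult_INR; simpl (INR 2); ring).
  replace (node n j) with (INR (S j) + INR n) by (symmetry; apply plus_INR). cring.
Qed.

Definition sphere_term (j : nat) (s : C) : C :=
  (RtoC (sphere_multiplicity (2 * n + 1) (S j)) * Rcpow (sphere_eigenvalue (2 * n + 1) (S j)) (- s))%C.

Lemma sphere_approx_series L s : INR n + 1 < Re s -> is_series (fun j => sphere_term j s) (sphere_approx L s).
Proof.
  intros hs.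
  eapply is_series_C_ext; [|exact (is_series_C_minus _ _ _ _ (main_total_series s hs) (correction_total_series L s hs))].
  intros j. cbv beta. rewrite sphere_inner_value. unfold sphere_term.
  rewrite sphere_multiplicity_poly by lia. unfold node. cring.
Qed.

(** The margin [3/4] is half of the [3/2] required of the remainders, whose exponent is [2 s]; the
    worst case is [m = n]. *)
Lemma sphere_approx_polar L a :
  INR n - Re a - INR L < - (3/4) -> polar_at (sphere_approx L) a.
Proof.
  intros h. apply polar_minus; [apply polar_minus|].
  - apply (polar_psum a main_term).
    intros k _. apply polar_scal, polar_comp_scale; [lra | apply riemann_zeta_polar].
  - apply polar_scal, holomorphic_polar, holomorphic_Rcpow.
  - apply (polar_psum a (fun m s => (RtoC (p m) * sphere_correction m L s)%C)).
    intros m hm. apply polar_scal, sphere_correction_polar.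
    assert (INR m <= INR n) by (apply le_INR; lia). lra.
Qed.

Lemma sphere_approx_holomorphic L a :
  INR n - Re a - INR L < - (3/4) ->
  (forall k, (k <= n)%nat -> zeta_regular (RtoC 2 * a - RtoC (2 * INR k))%C) ->
  holomorphic_at (sphere_approx L) a.
Proof.
  intros h hreg. apply holomorphic_minus; [apply holomorphic_minus|].
  - apply (holomorphic_psum a main_term).
    intros k hk. apply holomorphic_scal, holomorphic_comp_scale; [lra|]. apply riemann_zeta_holomorphic.
    rewrite RtoC_opp. apply (hreg k). lia.
  - apply holomorphic_scal, holomorphic_Rcpow.
  - apply (holomorphic_psum a (fun m s => (RtoC (p m) * sphere_correction m L s)%C)).
    intros m hm. apply holomorphic_scal, sphere_correction_holomorphic.
    + assert (INR m <= INR n) by (apply le_INR; lia). lra.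
    + intros l. apply zeta_regular_shift, hreg. lia.
Qed.

Lemma sphere_zeta_continuation :
  is_meromorphic_continuation sphere_term (sphere_zeta (2 * n + 1)).
Proof.
  apply meromorphic_continuation_spec.
  apply (glue_meromorphic _ (fun L => sphere_approx (n + 1 + L)) (INR n + 1)).
  - intros L a h. apply sphere_approx_polar. rewrite !plus_INR. simpl (INR 1). lra.
  - intros L a h h'. apply sphere_approx_holomorphic; [rewrite !plus_INR; simpl (INR 1); lra|].
    intros k hk. apply zeta_regular_half_plane.
    replace (Re (RtoC 2 * a - RtoC (2 * INR k))%C) with (2 * Re a - 2 * INR k) by (unfold Re; simpl; ring).
    assert (INR k <= INR n) by (apply le_INR; lia). lra.
  - intros L s h _. now apply sphere_approx_series.
Qed.

(** Depth [n + 1] is the first one whose half-plane, here [Re > - 1/4], contains 0. *)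
Lemma sphere_zeta_near_0 : nearC 0 (fun z => sphere_zeta (2 * n + 1) z = sphere_approx (n + 1) z).
Proof.
  apply (continuation_agrees_holomorphic _ _ _ (- (1/4)) sphere_zeta_continuation).
  - intros a ha. apply sphere_approx_polar. rewrite plus_INR. simpl (INR 1). lra.
  - exists (INR n + 1). intros s hs. now apply sphere_approx_series.
  - unfold Re; simpl. lra.
  - apply sphere_approx_holomorphic; [rewrite plus_INR; unfold Re; simpl; lra|].
    intros k _. replace (RtoC 2 * 0 - RtoC (2 * INR k))%C with (RtoC (2 * IZR (- Z.of_nat k))).
    + apply zeta_regular_even.
    + rewrite opp_IZR, <- INR_IZR_INZ, !RtoC_mult, RtoC_opp. cring.
Qed.

End Sphere.

(** * Vanishing of the corrections to first order at 0 *)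

Lemma rising_0_S k : rising 0 (S k) = RtoC 0.
Proof.
  induction k as [|k IH]; [simpl; unfold Cdiv; cring|].
  change (rising 0 (S (S k))) with (rising 0 (S k) * (0 + RtoC (INR (S k))) / RtoC (INR (S (S k))))%C.
  rewrite IH. unfold Cdiv. cring.
Qed.

Lemma rising_derive_0 k :
  is_derive (fun s => rising s k) (RtoC 0) (match k with O => RtoC 0 | S j => (/ RtoC (INR (S j)))%C end).
Proof.
  induction k as [|k IH]; [exact (is_derive_C_const 1 0)|].
  apply (is_derive_C_ext (fun s => (/ RtoC (INR (S k)) * (rising s k * (s + RtoC (INR k))))%C)).
  { exists 1. split; [lra|]. intros z _.
    change (rising z (S k)) with (rising z k * (z + RtoC (INR k)) / RtoC (INR (S k)))%C. unfold Cdiv. cring. }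
  eapply is_derive_C_eq; [|apply is_derive_C_scal, is_derive_C_mult; [exact IH|];
    apply is_derive_C_plus; [apply is_derive_C_id | apply is_derive_C_const]].
  destruct k as [|k].
  - simpl. field.
  - rewrite rising_0_S. field. split; apply CINR_S_neq0.
Qed.

Lemma sphere_family_0 l : sphere_family l 0 = RtoC 0.
Proof.
  unfold sphere_family. replace (RtoC 2 * 0 + 0)%C with (RtoC 0) by cring.
  replace (RtoC 1 * 0 + 0)%C with (RtoC 0) by cring.
  destruct l as [|l]; [simpl; cring|]. replace (2 * S l)%nat with (S (2 * l + 1)) by lia.
  rewrite !rising_0_S. cring.
Qed.

(** [(s)_k / k!] has linear coefficient [1 / k] at 0 for [k >= 1], and [2 / (2 l) - 1 / l = 0]. For
    [l = 0] the difference is identically zero. *)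
Lemma sphere_family_derive_0 l : is_derive (sphere_family l) (RtoC 0) (RtoC 0).
Proof.
  pose proof (rising_derive_0 (2 * l)) as H1. pose proof (rising_derive_0 l) as H2.
  replace (RtoC 0) with (RtoC 2 * 0 + 0)%C in H1 at 1 by cring.
  replace (RtoC 0) with (RtoC 1 * 0 + 0)%C in H2 at 1 by cring.
  apply (is_derive_comp_scale 2 0 (fun s => rising s (2 * l))) in H1.
  apply (is_derive_comp_scale 1 0 (fun s => rising s l)) in H2.
  eapply is_derive_C_eq; [|exact (is_derive_C_minus _ _ _ _ _ H1 H2)].
  destruct l as [|l]; [simpl; cring|].
  replace (2 * S l)%nat with (S (2 * l + 1)) by lia. cbv iota.
  replace (INR (S (2 * l + 1))) with (2 * INR (S l))
    by (replace (S (2 * l + 1)) with (2 * S l)%nat by lia; rewrite mult_INR; reflexivity).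
  rewrite RtoC_mult. field. apply CINR_S_neq0.
Qed.

Lemma is_derive_C_psum (f : nat -> C -> C) (d : nat -> C) (a : C) L :
  (forall l, (l < L)%nat -> is_derive (f l) a (d l)) -> is_derive (fun s => psum (fun l => f l s) L) a (psum d L).
Proof.
  intros H. induction L as [|L IH]; [exact (is_derive_C_const 0 a)|]. simpl.
  apply (is_derive_C_plus (fun s => psum (fun l => f l s) L)); [apply IH; auto | apply H; lia].
Qed.

Lemma psum_0 (f : nat -> C) L : (forall l, (l < L)%nat -> f l = RtoC 0) -> psum f L = RtoC 0.
Proof.
  intros H. induction L as [|L IH]; [reflexivity|]. simpl. rewrite IH, H by auto. cring.
Qed.

Lemma is_derive_double_zero (f g : C -> C) (a : C) :
  f a = RtoC 0 -> is_derive f a (RtoC 0) -> holomorphic_at g a ->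
  is_derive (fun s => (f s * g s)%C) a (RtoC 0).
Proof.
  intros f0 Hf Hg.
  eapply is_derive_C_eq; [|apply is_derive_C_mult; [exact Hf | exact (holomorphic_is_derive _ _ Hg)]].
  rewrite f0. cring.
Qed.

(** The inner series is replaced by its closed form, whose derivative at 0 is a multiple of [ln (k
    (k + 2 n)) - ln k - ln (k + 2 n) = 0]. The finitely many subtracted terms have double zeros. *)
Lemma sphere_remainder_term_derive_0 n m L j : (1 <= n)%nat ->
  is_derive (remainder_term sphere_family (INR n ^ 2) n 2 (2 * INR m) L j) (RtoC 0) (RtoC 0).
Proof.
  intros hn. set (x := node n j).
  assert (hx : 0 < x) by (pose proof (node_ge1 n j); unfold x; lra).
  pose proof (INR_S_pos j) as hj.
  assert (hj2 : 0 < INR (S j + 2 * n)) by (apply lt_0_INR; lia).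
  set (w := INR n ^ 2 / x ^ 2).
  set (ev := sphere_eigenvalue (2 * n + 1) (S j)).
  assert (hev : ev = INR (S j) * INR (S j + 2 * n)).
  { unfold ev, sphere_eigenvalue. rewrite !plus_INR, mult_INR. change (INR 2) with 2. change (INR 1) with 1. ring. }
  apply (is_derive_C_ext (fun s =>
    (RtoC (x ^ (2 * m)) * (/ RtoC 2 * Rcpow (INR (S j)) (- RtoC 2 * s + 0)
        + / RtoC 2 * Rcpow (INR (S j + 2 * n)) (- RtoC 2 * s + 0) - Rcpow ev (- (1) * s + 0))
     - psum (fun l => sphere_family l s * RtoC w ^ l) L * Rcpow x (- RtoC 2 * s + RtoC (2 * INR m)))%C)).
  { exists 1. split; [lra|]. intros z _. unfold remainder_term. fold x.
    replace (- RtoC 2 * z + 0)%C with (- (RtoC 2 * z))%C by cring.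
    replace (- (1) * z + 0)%C with (- z)%C by cring.
    unfold ev. rewrite <- (sphere_inner_value n hn j z). fold x. fold w.
    replace (- RtoC 2 * z + RtoC (2 * INR m))%C with (- (RtoC 2 * z - RtoC (2 * INR m)))%C by cring.
    replace (2 * INR m) with (INR (2 * m)) by (rewrite mult_INR; reflexivity).
    rewrite <- (Rcpow_even_shift x (2 * m) z hx). unfold sphere_inner. cring. }
  eapply is_derive_C_eq.
  2:{ apply is_derive_C_minus.
      - apply is_derive_C_scal, is_derive_C_minus; [|apply is_derive_Rcpow].
        apply is_derive_C_plus; apply is_derive_C_scal, is_derive_Rcpow.
      - apply (is_derive_double_zero (fun s => psum (fun l => sphere_family l s * RtoC w ^ l)%C L)).
        + apply psum_0. intros l _. rewrite sphere_family_0. cring.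
        + eapply is_derive_C_eq; [|apply (is_derive_C_psum (fun l s => (sphere_family l s * RtoC w ^ l)%C) (fun _ => RtoC 0))].
          * now apply psum_0.
          * intros l _. apply (is_derive_double_zero (sphere_family l) (fun _ => (RtoC w ^ l)%C));
              [apply sphere_family_0 | apply sphere_family_derive_0 | apply holomorphic_const].
        + apply holomorphic_Rcpow. }
  replace (- RtoC 2 * 0 + 0)%C with (RtoC 0) by cring.
  replace (- (1) * 0 + 0)%C with (RtoC 0) by cring.
  rewrite !Rcpow_0, hev, ln_mult, RtoC_plus by assumption. field.
Qed.

Lemma even_regular_point m l : zeta_regular (RtoC 2 * 0 - RtoC (2 * INR m) + RtoC (2 * INR l))%C.
Proof.
  replace (RtoC 2 * 0 - RtoC (2 * INR m) + RtoC (2 * INR l))%C with (RtoC (2 * IZR (Z.of_nat l - Z.of_nat m))).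
  - apply zeta_regular_even.
  - rewrite minus_IZR, <- !INR_IZR_INZ, !RtoC_mult, RtoC_minus. cring.
Qed.

(** In the finite part the double zeros meet zeta at even integers, where it is holomorphic; the
    remainder is differentiated term by term. *)
Lemma sphere_correction_derive_0 n m : (1 <= n)%nat -> (m <= n)%nat ->
  is_derive (sphere_correction n m (n + 1)) (RtoC 0) (RtoC 0).
Proof.
  intros hn hm.
  assert (hmn : INR m <= INR n) by now apply le_INR.
  eapply is_derive_C_eq; [|apply is_derive_C_plus].
  2:{ apply (is_derive_C_psum (correction_term n m) (fun _ => RtoC 0)).
      intros l _.
      apply (is_derive_double_zero (fun s => (sphere_family l s * RtoC (INR n ^ 2) ^ l)%C)).
      - rewrite sphere_family_0. cring.
      - apply (is_derive_double_zero (sphere_family l) (fun _ => (RtoC (INR n ^ 2) ^ l)%C));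
          [apply sphere_family_0 | apply sphere_family_derive_0 | apply holomorphic_const].
      - rewrite (comp_scale_eq (zeta_tail n)). apply holomorphic_comp_scale; [lra|]. apply zeta_tail_holomorphic.
        replace (RtoC 2 * 0 + (RtoC (2 * INR l) - RtoC (2 * INR m)))%C
          with (RtoC 2 * 0 - RtoC (2 * INR m) + RtoC (2 * INR l))%C by cring. apply even_regular_point. }
  (* For [m = n] the exponent [2 m + 2 r - 2 (n + 1)] equals [- (3/2)] exactly at [r = 1/4]. *)
  2:{ destruct (normal_series_derive 0 (1/4) _ (sphere_remainder n m (n + 1)) (fun _ => RtoC 0) ltac:(lra)
        (sphere_remainder_normal n hn m (n + 1) 0 (1/4) ltac:(lra)
           ltac:(rewrite plus_INR; unfold Re; simpl; lra))) as [D [HD Hs]].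
      - intros j. now apply sphere_remainder_term_derive_0.
      - rewrite (is_series_C_unique _ _ _ Hs is_series_C_0) in HD. exact HD. }
  rewrite psum_0 by trivial. cring.
Qed.

(** * Assembly of the derivative and the determinant *)

Lemma sum_n_m_psum (f : nat -> C) n : sum_n_m f 1 n = psum (fun l => f (S l)) n.
Proof.
  induction n as [|n IH]; [exact (sum_n_m_zero f 1 0 (le_n 1))|].
  rewrite sum_n_Sm by lia. rewrite IH. reflexivity.
Qed.

Definition sphere_zeta_derivative (n : nat) : C :=
  (RtoC (2 / INR (fact (2 * n))) *
     sum_n_m (fun k : nat =>
        (C_derive riemann_zeta (RtoC (- (2 * INR k))) *
        RtoC (stirling1 (2 * n) (2 * k) + stirling1 (2 * n + 1) (2 * k + 1)))%C) 1 n
   + RtoC (ln (INR n / PI)))%C.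

Lemma sphere_zeta_is_derive n : (1 <= n)%nat ->
  is_derive (sphere_zeta (2 * n + 1)) (RtoC 0) (sphere_zeta_derivative n).
Proof.
  intros hn. destruct (mult_poly_even n hn) as [p hp].
  apply (is_derive_C_ext (sphere_approx n p (n + 1))).
  { eapply nearC_imp; [|exact (sphere_zeta_near_0 n hn p hp)]. intros z ->. reflexivity. }
  assert (hN : 0 < INR n) by (apply lt_0_INR; lia).
  pose proof (INR_fact_lt_0 (2 * n)) as hf.
  eapply is_derive_C_eq.
  2:{ apply is_derive_C_minus; [apply is_derive_C_minus|].
      - apply (is_derive_C_psum (main_term n)
          (fun k => (RtoC (sphere_coef n (2 * k)) * (RtoC 2 * C_derive riemann_zeta (RtoC (- (2 * INR k)))))%C)).
        intros k _. apply is_derive_C_scal, is_derive_comp_scale.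
        replace (RtoC 2 * 0 + RtoC (- (2 * INR k)))%C with (RtoC (- (2 * INR k))) by cring.
        apply holomorphic_is_derive, riemann_zeta_holomorphic.
        replace (- (2 * INR k)) with (2 * IZR (- Z.of_nat k))
          by (rewrite opp_IZR, <- INR_IZR_INZ; ring). apply zeta_regular_even.
      - apply is_derive_C_scal, is_derive_Rcpow.
      - apply (is_derive_C_psum (fun m s => (RtoC (p m) * sphere_correction n m (n + 1) s)%C) (fun m => (RtoC (p m) * 0)%C)).
        intros m hm. apply is_derive_C_scal, sphere_correction_derive_0; [exact hn | lia]. }
  rewrite (psum_0 (fun m => (RtoC (p m) * 0)%C)) by (intros; cring).
  rewrite psum_S_first. change (2 * 0)%nat with 0%nat. rewrite sphere_coef_0 by exact hn.
  replace (- (2 * INR 0)) with 0 by (simpl; ring).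
  rewrite (is_C_derive_unique _ _ _ riemann_zeta_derive_0).
  replace (- RtoC 2 * 0 + 0)%C with (RtoC 0) by cring. rewrite Rcpow_0.
  unfold sphere_zeta_derivative. rewrite sum_n_m_psum, psum_mult_l.
  rewrite (psum_ext _ (fun l => (RtoC (2 / INR (fact (2 * n))) *
     (C_derive riemann_zeta (RtoC (- (2 * INR (S l)))) *
      RtoC (stirling1 (2 * n) (2 * S l) + stirling1 (2 * n + 1) (2 * S l + 1))))%C)).
  2:{ intros l _. unfold sphere_coef, Rdiv. rewrite !RtoC_mult. cring. }
  (* The term [k = 0] contributes [2 zeta' 0 = - ln 2 - ln PI], and the boundary term
     [- (2 n) ^ (- 2 s) / 2] contributes [ln (2 n)]. *)
  replace (RtoC (ln (INR n / PI)))
    with (RtoC 1 * (RtoC 2 * RtoC (- (ln 2 + ln PI) / 2)) + RtoC (ln (INR (2 * n))))%C.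
  - field.
  - pose proof PI_RGT_0. rewrite mult_INR. change (INR 2) with 2.
    rewrite ln_div, ln_mult by lra. apply Ceq_parts; unfold Re, Im; simpl; field.
Qed.

Lemma Im_psum_0 (f : nat -> C) L : (forall l, Im (f l) = 0) -> Im (psum f L) = 0.
Proof.
  intros H. induction L as [|L IH]; [reflexivity|]. simpl.
  change (Im (psum f L) + Im (f L) = 0). rewrite IH, H. ring.
Qed.

Lemma sphere_zeta_derivative_real n : Im (sphere_zeta_derivative n) = 0.
Proof.
  unfold sphere_zeta_derivative. rewrite sum_n_m_psum, psum_mult_l.
  match goal with |- Im (?a + RtoC ?b)%C = 0 => change (Im a + 0 = 0) end.
  rewrite Im_psum_0; [ring|]. intros l.
  assert (h : Im (C_derive riemann_zeta (RtoC (- (2 * INR (S l))))) = 0).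
  { apply riemann_zeta_derive_real.
    replace (- (2 * INR (S l))) with (2 * IZR (- Z.of_nat (S l)))
      by (rewrite opp_IZR, <- INR_IZR_INZ; ring). apply zeta_regular_even. }
  revert h. generalize (C_derive riemann_zeta (RtoC (- (2 * INR (S l))))). intros c h.
  unfold Im in *; simpl. rewrite h. ring.
Qed.

Open Scope C_scope.

Theorem theorem2p7 (n : nat) (hn : (1 <= n)%nat) :
  (exists d : R,
      (0 < d)%R /\
      sphere_det (2 * n + 1) = RtoC d /\
      RtoC (- ln d) = C_derive (sphere_zeta (2 * n + 1)) 0) /\
  is_derive (sphere_zeta (2 * n + 1)) (RtoC 0)
    (RtoC (2 / INR (fact (2 * n))) *
       sum_n_m (fun k : nat =>
          C_derive riemann_zeta (RtoC (- (2 * INR k))) *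
          RtoC (stirling1 (2 * n) (2 * k) + stirling1 (2 * n + 1) (2 * k + 1)))
         1 n
     + RtoC (ln (INR n / PI))).
Proof.
  pose proof (sphere_zeta_is_derive n hn) as H. split; [|exact H].
  pose proof (is_C_derive_unique _ _ _ H) as E. unfold sphere_det. rewrite E.
  (* Reality of the derivative turns the complex exponential in [sphere_det] into a positive real
     number. *)
  assert (Ex : sphere_zeta_derivative n = RtoC (Re (sphere_zeta_derivative n)))
    by (apply Ceq_parts; [reflexivity | apply sphere_zeta_derivative_real]).
  rewrite Ex. exists (exp (- Re (sphere_zeta_derivative n))). split; [apply exp_pos|]. split.
  - rewrite <- RtoC_opp. apply Cexp_RtoC.
  - rewrite ln_exp, Ropp_involutive. reflexivity.
Qed.
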